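(* Let $\lambda,\mu>0$, let $f\in L^2(Q)$, and let $u\in V^{\Delta_x}_{0,\underline{0}}$ be the solution of $\partial_t u-\Delta_x u=f$ in $Q$, $u=0$ on $\Sigma$, $u=0$ on $\Sigma_0$. For any $v\in V^{\nabla_x\partial_t}_{0,\underline{0}}$ and any $\boldsymbol{y}\in H^{\mathrm{div}_x,1}(Q)$, with $e:=u-v$, the following inequality holds for all $\zeta\in[\tfrac12,+\infty)$, $\epsilon\in[1,+\infty)$ and $\beta_1,\beta_2>0$: $$(2-\tfrac1\zeta)\big(\lambda\|\nabla_x e\|_Q^2+\mu\|\partial_t e\|_Q^2\big)+\mu(1-\tfrac1\epsilon)\|\nabla_x e\|_{\Sigma_T}^2+\lambda\|e\|_{\Sigma_T}^2\le\overline{\mathrm M}^{\mathrm{II}}(v,\boldsymbol y;\zeta,\beta_i,\epsilon),$$ where $$\overline{\mathrm M}^{\mathrm{II}}(v,\boldsymbol y;\zeta,\beta_i,\epsilon):=\epsilon\,\mu\|\mathbf r_{\rm d}\|_{\Sigma_T}^2+\zeta\Big(\lambda\Big((1+\beta_1)\big((1+\beta_2)\|\mathbf r_{\rm d}\|_Q^2+(1+\tfrac1{\beta_2})C_{\rm F}^2\|\mathbf r_{\rm eq}\|_Q^2\big)+(1+\tfrac1{\beta_1})\tfrac{\mu^2}{\lambda^2}\|\partial_t\mathbf r_{\rm d}\|_Q^2\Big)+\mu\|\mathbf r_{\rm eq}\|_Q^2\Big),$$ with $\mathbf r_{\rm eq}=\mathbf r_{\rm eq}(v,\boldsymbol y):=f-\partial_t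 v+\mathrm{div}_x\boldsymbol y$ and $\mathbf r_{\rm d}=\mathbf r_{\rm d}(v,\boldsymbol y):=\boldsymbol y-\nabla_x v$.
   Context: $\Omega\subset\mathbb R^d$, $d\in\{1,2,3\}$, is a bounded Lipschitz domain, $0<T<+\infty$, $Q:=\Omega\times(0,T)$, $\Sigma:=\partial\Omega\times(0,T)$, $\Sigma_0:=\Omega\times\{0\}$, $\Sigma_T:=\Omega\times\{T\}$. $\nabla_x$, $\mathrm{div}_x$, $\Delta_x$ are the gradient, divergence and Laplacian in the spatial variables, and $\partial_t$ is the time derivative. $\|\cdot\|_Q$ and $\|\cdot\|_{\Sigma_T}$ are the $L^2(Q)$ and $L^2(\Sigma_T)$ norms (also for vector-valued functions). $H^1_0(Q):=\{u\in H^1(Q): u=0\text{ on }\Sigma\}$, $V^{\Delta_x}_{0,\underline 0}:=\{u\in H^1_0(Q): \Delta_x u\in L^2(Q),\ u=0\text{ on }\Sigma_0\}$, $V^{\nabla_x\partial_t}_{0,\underline 0}:=\{w\in V^{\Delta_x}_{0,\underline 0}:\nabla_x\partial_t w\in [L^2(Q)]^d\}$. $H^{\mathrm{div}_x,1}(Q):=\{\boldsymbol y\in[L^2(Q)]^d:\mathrm{div}_x\boldsymbol y\in L^2(Q),\ \partial_t\boldsymbol y\in[L^2(Q)]^d\}$. $C_{\rm F}>0$ is the constant in the Friedrichs inequality $\|w\|_Q\le C_{\rm F}\|\nabla_x w\|_Q$ for all $w\in L^2(Q)$ with $\nabla_x w\in[L^2(Q)]^d$ and $w=0$ on $\Sigma$.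 For $w\in V^{\Delta_x}_{0,\underline 0}$ the map $t\mapsto w(\cdot,t)$ is continuous with values in $H^1_0(\Omega)$, so $\|\nabla_x w\|_{\Sigma_T}$ is meaningful. For $f\in L^2(Q)$ and zero initial data the problem is uniquely solvable in $V^{\Delta_x}_{0,\underline 0}$. *)

(* Defs.v *)
From HB Require Import structures.
From mathcomp Require Import all_boot all_order all_algebra.
From mathcomp Require Import all_classical all_reals all_analysis.
Set Implicit Arguments.
Unset Strict Implicit.
Unset Printing Implicit Defensive.
Import Order.TTheory GRing.Theory Num.Theory.
Import numFieldNormedType.Exports.
Local Open Scope classical_set_scope.
Local Open Scope ring_scope.

Fact rV_display : measure_display. Proof. exact: default_measure_display. Qed.

Section rV_measurable.
Context {R : realType} {n : nat}.

Definition rV_coord (i : 'I_n) (x : 'rV[R]_n) : measurableTypeR R := x ord0 i.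

HB.instance Definition _ := @isMeasurable.Build rV_display 'rV[R]_n
  (g_sigma_preimage rV_coord) (@sigma_algebra0 _ _ _)
  (fun A => @sigma_algebraC _ _ A) (@sigma_algebra_bigcup _ _ _).

Lemma measurable_rV_coord (i : 'I_n) :
  measurable_fun [set: 'rV[R]_n] (rV_coord i).
Proof.
move=> _ Y mY; rewrite setTI; apply: sub_sigma_algebra => /=.
rewrite -bigcup_seq/=; exists i => /=; first by rewrite mem_index_enum.
by exists Y => //; rewrite setTI.
Qed.

Lemma measurable_fun_rV d (T : measurableType d) (f : T -> 'rV[R]_n) :
  (forall i, measurable_fun [set: T] (rV_coord i \o f)) ->
  measurable_fun [set: T] f.
Proof.
move=> mf; apply: measurability; first exact: erefl.
move=> _ [B + <-]; rewrite -bigcup_seq/= => -[i _] [C mC <-].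
by rewrite setTI; exact: mf.
Qed.

End rV_measurable.

Section rV_cons.
Context {R : realType} {n : nat}.
Implicit Types (p : measurableTypeR R * 'rV[R]_n) (x : 'rV[R]_n.+1).

Definition rV_cons p : 'rV[R]_n.+1 := \row_i oapp (p.2 ord0) p.1 (unlift ord0 i).

Definition rV_uncons x : measurableTypeR R * 'rV[R]_n :=
  (x ord0 ord0, \row_i x ord0 (lift ord0 i)).

Lemma rV_consK : cancel rV_cons rV_uncons.
Proof.
move=> [a y]; rewrite /rV_uncons /rV_cons mxE unlift_none /=; congr pair.
by apply/rowP => i; rewrite !mxE liftK.
Qed.

Lemma measurable_rV_cons :
  measurable_fun [set: measurableTypeR R * 'rV[R]_n] rV_cons.
Proof.
apply: measurable_fun_rV => i.
rewrite (_ : _ \o _ = fun p => oapp (p.2 ord0) p.1 (unlift ord0 i)).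
  case: unliftP => [j _|_] /=; last exact: measurable_fst.
  by apply: (measurableT_comp (measurable_rV_coord j)); exact: measurable_snd.
by apply/funext => p /=; rewrite /rV_coord mxE.
Qed.

Lemma measurable_rV_uncons : measurable_fun [set: 'rV[R]_n.+1] rV_uncons.
Proof.
apply/measurable_fun_pairP; split; first exact: (measurable_rV_coord ord0).
apply: measurable_fun_rV => i.
rewrite (_ : _ \o _ = rV_coord (lift ord0 i)); first exact: measurable_rV_coord.
by apply/funext => x /=; rewrite /rV_coord mxE.
Qed.

Variable m : {sigma_finite_measure set 'rV[R]_n -> \bar R}.

Definition lebesgue_cons : set 'rV[R]_n.+1 -> \bar R :=
  pushforward (@lebesgue_measure R \x m)%E rV_cons.

HB.instance Definition _ := Measure.copy lebesgue_cons
  (measure_function_pushforward__canonical__measure_function_Measure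
    (@lebesgue_measure R \x m)%E measurable_rV_cons).

Lemma lebesgue_cons_sigma_finite : sigma_finite setT lebesgue_cons.
Proof.
have /sigma_finiteP[F [FT ndF Foo]] := sigma_finiteT (@lebesgue_measure R).
have /sigma_finiteP[G [GT ndG Goo]] := sigma_finiteT m.
exists (fun k => rV_uncons @^-1` (F k `*` G k)) => [|k].
  rewrite -preimage_bigcup -[LHS](@preimage_setT _ _ rV_uncons).
  congr (_ @^-1` _).
  apply/seteqP; split=> // -[a y] _.
  have [i _ Fi] : (\bigcup_i F i) a by rewrite -FT.
  have [j _ Gj] : (\bigcup_i G i) y by rewrite -GT.
  exists (maxn i j) => //; split => /=.
    by move: a Fi; exact/subsetPset/ndF/leq_maxl.
  by move: y Gj; exact/subsetPset/ndG/leq_maxr.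
have [mF Fk] := Foo k; have [mG Gk] := Goo k.
have mFG : measurable (F k `*` G k) by exact: measurableX.
split.
  by rewrite -[X in measurable X]setTI; exact: measurable_rV_uncons.
rewrite /lebesgue_cons /pushforward -comp_preimage.
rewrite (_ : rV_uncons \o rV_cons = id); last first.
  by apply/funext => p; exact: rV_consK.
by rewrite preimage_id product_measure1E// lte_mul_pinfty// ge0_fin_numE.
Qed.

HB.instance Definition _ :=
  Measure_isSigmaFinite.Build _ _ _ lebesgue_cons lebesgue_cons_sigma_finite.

End rV_cons.

Fixpoint lebesgue_rV (R : realType) (n : nat) :
    {sigma_finite_measure set 'rV[R]_n -> \bar R} :=
  match n with
  | 0 => [the {sigma_finite_measure set 'rV[R]_0 -> \bar R}
            of \d_(0 : 'rV[R]_0)]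
  | n'.+1 => [the {sigma_finite_measure set 'rV[R]_n'.+1 -> \bar R}
                of lebesgue_cons (lebesgue_rV R n')]
  end.

Lemma measurable_box (R : realType) n (A : 'I_n -> set (measurableTypeR R)) :
  (forall i, measurable (A i)) ->
  measurable [set x : 'rV[R]_n | forall i, A i (x ord0 i)].
Proof.
move=> mA; rewrite (_ : [set _ | _] =
    \bigcap_(i in [set: 'I_n]) (rV_coord i @^-1` A i)).
  apply: fin_bigcap_measurable; first exact: finite_finset.
  move=> i _; rewrite -[X in measurable X]setTI; exact: (measurable_rV_coord i).
by apply/seteqP; split => x /= h i; [move=> _; exact: h|exact: (h i I)].
Qed.

Lemma lebesgue_rV_box (R : realType) n (A : 'I_n -> set (measurableTypeR R)) :
  (forall i, measurable (A i)) ->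
  lebesgue_rV R n [set x | forall i, A i (x ord0 i)] =
  (\prod_(i < n) lebesgue_measure (A i))%E.
Proof.
elim: n A => [|n IHn] A mA.
  rewrite big_ord0 /= diracE mem_set//; by case.
rewrite big_ord_recl /= /lebesgue_cons /pushforward /=.
set B := (X in (_ \x _)%E X).
rewrite (_ : B =
    A ord0 `*` [set x : 'rV[R]_n | forall i : 'I_n, A (lift ord0 i) (x ord0 i)]); last first.
  apply/seteqP; split => -[a x] /= => [h|[h0 h] i].
    split => [|i]; first by have := h ord0; rewrite mxE unlift_none.
    by have := h (lift ord0 i); rewrite mxE liftK.
  by rewrite mxE; case: unliftP => [j ->|->] //=.
rewrite product_measure1E//.
  congr (_ * _)%E.
  by apply: (IHn (fun i => A (lift ord0 i))) => i; exact: mA.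
apply: (@measurable_box R n (fun i => A (lift ord0 i))) => i; exact: mA.
Qed.

Section domains.
Context {R : realType} {d : nat}.

Definition dotrV (x y : 'rV[R]_d) : R := \sum_i x ord0 i * y ord0 i.

(* Near each boundary point the domain is, in suitable orthonormal coordinates,
   the strict epigraph of a Lipschitz function: [nu] is the unit vector of the
   vertical axis, and [x - dotrV x nu *: nu] is the horizontal part of [x].
   The function [g] only matters on the hyperplane orthogonal to [nu]; letting
   it be defined on the whole of R^d avoids choosing coordinates there. *)
Definition lipschitz_boundary (Omega : set 'rV[R]_d) : Prop :=
  forall x0, closure Omega x0 -> ~ interior Omega x0 ->
  exists (nu : 'rV[R]_d) (g : 'rV[R]_d -> R),
    [/\ dotrV nu nu = 1, lipschitz g &
        \forall x \near x0,
          Omega x <-> g (x - dotrV x nu *: nu) < dotrV x nu].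

Definition bounded_lipschitz_domain (Omega : set 'rV[R]_d) : Prop :=
  [/\ open Omega, connected Omega, Omega !=set0, bounded_set Omega &
      lipschitz_boundary Omega].

End domains.

Section test_functions.
Context {R : realType} {V : normedModType R}.

Definition smooth (phi : V -> R) : Prop :=
  forall vs : seq V, let psi := foldr (fun v h => 'D_v h) phi vs in
    continuous psi /\ forall x v, derivable psi x v.

Definition tsupp (phi : V -> R) : set V := closure [set x | phi x != 0].

Definition test_function (U : set V) (phi : V -> R) : Prop :=
  [/\ smooth phi, compact (tsupp phi) & tsupp phi `<=` U].

End test_functions.

Section L2.
Context {dT} {T : measurableType dT} {R : realType}.
Variables (m : {measure set T -> \bar R}) (D : set T).

Definition L2 (w : T -> R) : Prop :=
  measurable_fun D w /\ (\int[m]_(x in D) (w x ^+ 2)%:E < +oo)%E.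

Definition L2norm (w : T -> R) : R :=
  Num.sqrt (\int[m]_(x in D) (w x ^+ 2)).

Definition L2vec n (y : T -> 'rV[R]_n) : Prop :=
  forall i, L2 (fun x => y x ord0 i).

Definition L2norm_vec n (y : T -> 'rV[R]_n) : R :=
  Num.sqrt (\int[m]_(x in D) \sum_i y x ord0 i ^+ 2).

End L2.

(* Functions on Q are represented by functions on the whole of R^d * R whose
   values outside Q are irrelevant. *)
Section space_time.
Context {R : realType} {d : nat}.
Variables (Omega : set 'rV[R]_d) (T : R).

Local Notation X := 'rV[R]_d.
Local Notation S := ('rV[R]_d * measurableTypeR R)%type.
Implicit Types (w g : S -> R) (y : S -> 'rV[R]_d) (a : S) (i : 'I_d).

Definition cylinder : set S := Omega `*` `]0, T[.
Local Notation Q := cylinder.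

Definition lebesgue_ST : {measure set S -> \bar R} :=
  [the {measure set S -> \bar R} of
    (lebesgue_rV R d \x @lebesgue_measure R)%E].
Local Notation mu := lebesgue_ST.

Definition L2Q w := L2 mu Q w.
Definition normQ w := L2norm mu Q w.
Definition L2Q_vec y := L2vec mu Q y.
Definition normQ_vec y := L2norm_vec mu Q y.

Definition dir_x i : S := (delta_mx ord0 i, 0).
Definition dir_t : S := (0, 1).

(* [g] is the distributional derivative of [w] along [a] in Q, and is in L^2 *)
Definition is_weak_partial a w g : Prop :=
  L2Q g /\ forall phi, test_function Q phi ->
    \int[mu]_(z in Q) (w z * 'D_a phi z) = - \int[mu]_(z in Q) (g z * phi z).

Definition has_weak_partial a w : Prop := exists g, is_weak_partial a w g.

(* a representative of the derivative, which is unique almost everywhere in Q *)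
Definition weak_partial a w : S -> R := xget (fun=> 0) (is_weak_partial a w).

Definition dt w : S -> R := weak_partial dir_t w.
Definition has_dt w : Prop := has_weak_partial dir_t w.

Definition grad_x w : S -> 'rV[R]_d :=
  fun z => \row_i weak_partial (dir_x i) w z.
Definition has_grad_x w : Prop := forall i, has_weak_partial (dir_x i) w.

Definition dt_vec y : S -> 'rV[R]_d :=
  fun z => \row_i dt (fun z' => y z' ord0 i) z.
Definition has_dt_vec y : Prop := forall i, has_dt (fun z => y z ord0 i).

Definition is_weak_div y g : Prop :=
  L2Q g /\ forall phi, test_function Q phi ->
    \int[mu]_(z in Q) (\sum_i y z ord0 i * 'D_(dir_x i) phi z) =
    - \int[mu]_(z in Q) (g z * phi z).

Definition has_div_x y : Prop := exists g, is_weak_div y g.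
Definition div_x y : S -> R := xget (fun=> 0) (is_weak_div y).

Definition laplace_x w : S -> R := div_x (grad_x w).
Definition has_laplace_x w : Prop := has_div_x (grad_x w).

(* w = 0 on Sigma, for w and its weak spatial gradient in L^2(Q): [w] is a limit,
   for the norm |w|_Q + |grad_x w|_Q, of smooth functions supported away from
   the lateral boundary. Nothing is required of them at the times 0 and T. *)
Definition zero_on_Sigma w : Prop :=
  exists phi : nat -> S -> R,
    [/\ forall n, test_function (Omega `*` setT) (phi n),
        normQ (w \- phi n) @[n --> \oo] --> (0 : R) &
        forall i, normQ (weak_partial (dir_x i) w \- 'D_(dir_x i) (phi n))
          @[n --> \oo] --> (0 : R)].

(* [W] is the representative of [w] which is continuous from [0, T] to
   L^2(Omega); W t is then determined almost everywhere in Omega for every t,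
   the end points included, and W 0, W T are the traces of [w] on Omega x {0}
   and Omega x {T}. *)
Definition time_continuous_rep w (W : R -> X -> R) : Prop :=
  [/\ forall t, t \in `[0, T] -> L2 (lebesgue_rV R d) Omega (W t),
      forall t, t \in `[0, T] ->
        L2norm (lebesgue_rV R d) Omega (W s \- W t)
          @[s --> within `[0, T]%classic (nbhs t)] --> (0 : R) &
      {ae mu, forall z, Q z -> w z = W z.2 z.1}].

Definition time_trace w (t : R) : X -> R :=
  xget (fun _ _ => 0) (time_continuous_rep w) t.

Definition time_trace_vec y (t : R) : X -> 'rV[R]_d :=
  fun x => \row_i time_trace (fun z => y z ord0 i) t x.

Definition norm_SigmaT w : R :=
  L2norm (lebesgue_rV R d) Omega (time_trace w T).
Definition norm_SigmaT_vec y : R :=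
  L2norm_vec (lebesgue_rV R d) Omega (time_trace_vec y T).

Definition zero_on_Sigma0 w : Prop :=
  exists W, time_continuous_rep w W /\
    {ae lebesgue_rV R d, forall x, Omega x -> W 0 x = 0}.

Definition H1 w : Prop := [/\ L2Q w, has_grad_x w & has_dt w].

Definition H10 w : Prop := H1 w /\ zero_on_Sigma w.

Definition VDelta w : Prop := [/\ H10 w, has_laplace_x w & zero_on_Sigma0 w].

Definition Vgraddt w : Prop := VDelta w /\ has_grad_x (dt w).

Definition Hdiv1 y : Prop := [/\ L2Q_vec y, has_div_x y & has_dt_vec y].

Definition friedrichs (C : R) : Prop :=
  forall w, L2Q w -> has_grad_x w -> zero_on_Sigma w ->
    normQ w <= C * normQ_vec (grad_x w).

End space_time.

(* Main.v *)
Require Import Defs.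
From mathcomp Require Import all_boot all_order all_algebra.
From mathcomp Require Import all_classical all_reals all_analysis.
From mathcomp Require Import measurable_realfun ring lra.
Import Order.TTheory GRing.Theory Num.Theory.
Import numFieldNormedType.Exports.
Set Implicit Arguments.
Unset Strict Implicit.
Unset Printing Implicit Defensive.
Local Open Scope classical_set_scope.
Local Open Scope ring_scope.

(** Write r = y - grad v and q = f - v_t + div y for the two residuals, e = u - v for
    the error and F = grad u - y. Then F = grad e - r and div F = e_t - q, so Green's
    formula in the space variables gives (F, grad w) = - (e_t - q, w) for every w
    vanishing on the lateral boundary. The theorem combines the choices w = e and
    w = e_t. The first one is [energy_error]:
      |e(T)|^2 / 2 + |grad e|^2 <= (r, grad e) + (q, e).
    The second one formally leads to
      |e_t|^2 + |grad e(T)|^2 / 2 = (q, e_t) + (r(T), grad e(T)) - (r_t, grad e),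
    and Young's inequality with weight eps on the pairing at time T gives
    [energy_derivative]. Adding lambda times the first inequality and mu times the
    second one, the right-hand side is a sum of products with |grad e| or |e_t| as a
    factor, by the inequalities of Cauchy--Schwarz and Friedrichs; Young's inequality
    with the weights zeta, beta1 and beta2 turns them into the majorant
    ([majorant_of_energy]).

    The second choice is not legitimate as it stands, because grad e_t need not be
    in L2 (only grad v_t is). So e_t is replaced by the backward difference quotient
    of e, and Green's formula is applied to e and to a delayed copy of e
    ([green_back]). A discrete integration by parts in time leaves terms over the
    slab Omega x (T-h, T), whose averages tend to traces at time T
    ([slab_average]), and difference quotients of e and of r, which converge weakly
    in L2 to e_t and r_t ([back_quotient_cvg], [cut_quotient_cvg]). Both weak limits
    rest on the representation of a function with a weak time derivative g as a function
    of space plus the primitive of g in time ([weak_dt_primitive]).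

    The trace of a function without time-continuous representative is 0 by
    convention. This is harmless: such a trace can only come from a component of
    grad e, where it enters a nonnegative term on the small side of the inequality
    ([trace_sqr_minorant]), whereas e and r have weak time derivatives, r because
    mixed weak derivatives commute ([weak_partial_comm]), and therefore have traces
    ([weak_dt_continuous_rep]).

    The analytic tool behind all this is the density of smooth bumps in L2(Q), in
    the form of an induction principle ([L2_bump_ind]): it gives the uniqueness of
    weak derivatives, the continuity of delays and the passage from test functions
    to L2 in weak limits. *)

(** * Square-integrable functions *)

Lemma trinomial_discriminant (K : realFieldType) (a b c : K) : 0 <= c ->
  (forall t, 0 <= a + 2 * t * b + t ^+ 2 * c) -> b ^+ 2 <= a * c.
Proof.
rewrite le_eqVlt => /predU1P[<-|c0] quad; last first.
  have := quad (- (b / c)).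
  have -> : a + 2 * - (b / c) * b + (- (b / c)) ^+ 2 * c = (a * c - b ^+ 2) / c.
    by field; rewrite gt_eqF.
  by rewrite pmulr_lge0 ?invr_gt0// subr_ge0.
rewrite mulr0; have [->|b0] := eqVneq b 0; first by rewrite expr0n.
have := quad (- (a + 1) / (2 * b)); rewrite mulr0 addr0.
have -> : 2 * (- (a + 1) / (2 * b)) * b = - (a + 1) by field.
by rewrite opprD addrA subrr sub0r oppr_ge0 ler10.
Qed.

Section L2_theory.
Context {dT : measure_display} {T : measurableType dT} {R : realType}.
Variables (m : {measure set T -> \bar R}) (D : set T).
Hypothesis mD : measurable D.
Implicit Types (w g : T -> R).

Definition ip w g : R := \int[m]_(x in D) (w x * g x).

Lemma L2_meas w : L2 m D w -> measurable_fun D w.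
Proof. by case. Qed.

Lemma L2_sqr_integrable w : L2 m D w -> m.-integrable D (fun x => (w x ^+ 2)%:E).
Proof.
move=> [mw w2]; apply/integrableP; split.
  by apply/measurable_EFinP; exact: measurable_funX.
rewrite (eq_integral (fun x => (w x ^+ 2)%:E))// => x _.
by rewrite /= ger0_norm// sqr_ge0.
Qed.

Lemma L2P w : measurable_fun D w ->
  m.-integrable D (fun x => (w x ^+ 2)%:E) -> L2 m D w.
Proof.
move=> mw /integrableP[_ w2]; split => //.
rewrite (eq_integral (fun x => `|(w x ^+ 2)%:E|%E)) // => x _.
by rewrite /= ger0_norm// sqr_ge0.
Qed.

Lemma L2_dom w g : measurable_fun D w -> L2 m D g ->
  (forall x, D x -> `|w x| <= `|g x|) -> L2 m D w.
Proof.
move=> mw Lg wg; apply: L2P => //.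
apply: (le_integrable mD _ _ (L2_sqr_integrable Lg)).
  by apply/measurable_EFinP; exact: measurable_funX.
move=> x Dx; rewrite /= lee_fin !ger0_norm ?sqr_ge0//.
by rewrite -(real_normK (num_real (w x))) -(real_normK (num_real (g x))) lerXn2r ?nnegrE ?wg.
Qed.

Lemma L2_bounded w (M : R) : (m D < +oo)%E -> measurable_fun D w ->
  (forall x, D x -> `|w x| <= M) -> L2 m D w.
Proof.
move=> mDoo mw wM.
have LM : L2 m D (fun=> M).
  split; first exact: measurable_cst.
  by rewrite integral_cst// lte_mul_pinfty// lee_fin sqr_ge0.
by apply: (L2_dom mw LM) => x Dx; rewrite (le_trans (wM _ Dx))// ler_norm.
Qed.

Lemma L2_cst (c : R) : (m D < +oo)%E -> L2 m D (fun=> c).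
Proof. by move=> Doo; exact: (@L2_bounded _ `|c|). Qed.

Lemma L2M_integrable w g : L2 m D w -> L2 m D g ->
  m.-integrable D (fun x => (w x * g x)%:E).
Proof.
move=> Lw Lg.
have I := integrableD mD (L2_sqr_integrable Lw) (L2_sqr_integrable Lg).
apply: (le_integrable mD _ _ I).
  by apply/measurable_EFinP/measurable_funM; [exact: L2_meas Lw|exact: L2_meas Lg].
move=> x Dx; rewrite /= lee_fin normrM (@ger0_norm _ (_ + _)) ?addr_ge0 ?sqr_ge0//.
rewrite -(real_normK (num_real (w x))) -(real_normK (num_real (g x))).
have := normr_ge0 (w x); have := normr_ge0 (g x).
by move: `|_| `|_| => a b a0 b0; nra.
Qed.

Lemma L2D w g : L2 m D w -> L2 m D g -> L2 m D (fun x => w x + g x).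
Proof.
move=> Lw Lg; apply: L2P.
  by apply: measurable_funD; [exact: L2_meas Lw|exact: L2_meas Lg].
have I1 := L2_sqr_integrable Lw; have I2 := L2_sqr_integrable Lg.
have I3 := integrableZl mD 2 (L2M_integrable Lw Lg).
have I := integrableD mD (integrableD mD I1 I3) I2.
apply: eq_integrable I => // x _; rewrite /= -EFinM -!EFinD; congr EFin.
by ring.
Qed.

Lemma L2Z (a : R) w : L2 m D w -> L2 m D (fun x => a * w x).
Proof.
move=> Lw; apply: L2P; first by apply: measurable_funM => //; exact: L2_meas Lw.
have I := integrableZl mD (a ^+ 2) (L2_sqr_integrable Lw).
by apply: eq_integrable I => // x _; rewrite /= -EFinM exprMn.
Qed.

Lemma L2N w : L2 m D w -> L2 m D (fun x => - w x).
Proof.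
move=> /(L2Z (-1)); congr (L2 m D); apply/funext => x; by rewrite mulN1r.
Qed.

Lemma L2B w g : L2 m D w -> L2 m D g -> L2 m D (fun x => w x - g x).
Proof. by move=> Lw Lg; apply: L2D => //; exact: L2N. Qed.

Lemma L2_0 : L2 m D (fun=> 0).
Proof.
apply: L2P; first exact: measurable_cst.
by apply: eq_integrable (integrable0 m D) => // x _; rewrite expr0n.
Qed.

Lemma ipC w g : ip w g = ip g w.
Proof. by apply: eq_Rintegral => x _; rewrite mulrC. Qed.

Lemma eq_ip w w' g g' : (forall x, D x -> w x * g x = w' x * g' x) ->
  ip w g = ip w' g'.
Proof. by move=> e; apply: eq_Rintegral => x /set_mem /e. Qed.

Lemma ipDl w w' g : L2 m D w -> L2 m D w' -> L2 m D g ->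
  ip (fun x => w x + w' x) g = ip w g + ip w' g.
Proof.
move=> Lw Lw' Lg; rewrite -RintegralD//; last 2 first.
- exact: L2M_integrable.
- exact: L2M_integrable.
by apply: eq_Rintegral => x _; rewrite mulrDl.
Qed.

Lemma ipZl a w g : L2 m D w -> L2 m D g -> ip (fun x => a * w x) g = a * ip w g.
Proof.
move=> Lw Lg; rewrite -RintegralZl//; last exact: L2M_integrable.
by apply: eq_Rintegral => x _; rewrite mulrA.
Qed.

Lemma ipNl w g : L2 m D w -> L2 m D g -> ip (fun x => - w x) g = - ip w g.
Proof.
move=> Lw Lg; rewrite -mulN1r -ipZl//.
by apply: eq_ip => x _; rewrite mulN1r.
Qed.

Lemma ipBl w w' g : L2 m D w -> L2 m D w' -> L2 m D g ->
  ip (fun x => w x - w' x) g = ip w g - ip w' g.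
Proof. by move=> Lw Lw' Lg; rewrite ipDl ?ipNl//; exact: L2N. Qed.

Lemma ipDr w g g' : L2 m D w -> L2 m D g -> L2 m D g' ->
  ip w (fun x => g x + g' x) = ip w g + ip w g'.
Proof. by move=> ? ? ?; rewrite ipC ipDl// !(ipC w). Qed.

Lemma ipZr a w g : L2 m D w -> L2 m D g -> ip w (fun x => a * g x) = a * ip w g.
Proof. by move=> ? ?; rewrite ipC ipZl// (ipC w). Qed.

Lemma ipBr w g g' : L2 m D w -> L2 m D g -> L2 m D g' ->
  ip w (fun x => g x - g' x) = ip w g - ip w g'.
Proof. by move=> ? ? ?; rewrite ipC ipBl// !(ipC w). Qed.

Lemma ip0l g : ip (fun=> 0) g = 0.
Proof.
by rewrite /ip (@eq_Rintegral _ _ _ _ _ (cst 0)) ?Rintegral_cst ?mul0r// => x _; rewrite mul0r.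
Qed.

Lemma ip_ge0 w : 0 <= ip w w.
Proof. by apply: Rintegral_ge0 => x _; rewrite -expr2 sqr_ge0. Qed.

Lemma ae_eq_ip w w' g : L2 m D w -> L2 m D w' -> L2 m D g ->
  {ae m, forall x, D x -> w x = w' x} -> ip w g = ip w' g.
Proof.
move=> Lw Lw' Lg ww'; congr fine; apply: ae_eq_integral => //.
- by apply/measurable_EFinP/measurable_funM; [exact: L2_meas Lw|exact: L2_meas Lg].
- by apply/measurable_EFinP/measurable_funM; [exact: L2_meas Lw'|exact: L2_meas Lg].
- by apply: filterS ww' => x ww' /ww' ->.
Qed.

Lemma ipDD w g (a : R) : L2 m D w -> L2 m D g ->
  ip (fun x => w x + a * g x) (fun x => w x + a * g x) =
  ip w w + 2 * a * ip w g + a ^+ 2 * ip g g.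
Proof.
move=> Lw Lg; have Lag := L2Z a Lg.
rewrite ipDl ?ipDr ?ipZl ?ipZr//; last exact: L2D.
by rewrite (ipC g w); ring.
Qed.

(** Cauchy--Schwarz for vector fields: the discriminant of the nonnegative
    trinomial t |-> sum_i |w_i + t g_i|^2. *)
Lemma ip_CS_sum n (w g : 'I_n -> T -> R) :
  (forall i, L2 m D (w i)) -> (forall i, L2 m D (g i)) ->
  (\sum_i ip (w i) (g i)) ^+ 2 <=
  (\sum_i ip (w i) (w i)) * \sum_i ip (g i) (g i).
Proof.
move=> Lw Lg; apply: trinomial_discriminant => [|t]; first by rewrite sumr_ge0// => i _; exact: ip_ge0.
rewrite !mulr_sumr -!big_split sumr_ge0// => i _.
by rewrite /= -ipDD// ip_ge0.
Qed.

Lemma ip_CS w g : L2 m D w -> L2 m D g -> ip w g ^+ 2 <= ip w w * ip g g.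
Proof.
move=> Lw Lg; have := @ip_CS_sum 1 (fun=> w) (fun=> g) (fun=> Lw) (fun=> Lg).
by rewrite !big_ord1.
Qed.

Lemma ip_CS_sqrt w g : L2 m D w -> L2 m D g ->
  `|ip w g| <= Num.sqrt (ip w w) * Num.sqrt (ip g g).
Proof.
move=> Lw Lg; rewrite -sqrtrM ?ip_ge0// -sqrtr_sqr ler_wsqrtr//.
exact: ip_CS.
Qed.

Lemma ip_sqrD_le w g : L2 m D w -> L2 m D g ->
  ip (fun x => w x + g x) (fun x => w x + g x) <= 2 * ip w w + 2 * ip g g.
Proof.
move=> Lw Lg.
have := ipDD 1 Lw Lg; have := ipDD (-1) Lw Lg.
have -> : (fun x => w x + 1 * g x) = (fun x => w x + g x).
  by apply/funext => x; rewrite mul1r.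
have := ip_ge0 (fun x => w x + -1 * g x).
by move: (ip _ _) => a; nra.
Qed.

Lemma ip_sqrB_le w g : L2 m D w -> L2 m D g ->
  ip (fun x => w x - g x) (fun x => w x - g x) <= 2 * ip w w + 2 * ip g g.
Proof.
move=> Lw Lg; apply: le_trans (ip_sqrD_le Lw (L2N Lg)) _.
rewrite lerD2l (_ : ip (fun x => - g x) _ = ip g g)//.
by apply: eq_ip => x _; rewrite mulrNN.
Qed.

Lemma L2normE w : L2norm m D w ^+ 2 = ip w w.
Proof.
rewrite /L2norm sqr_sqrtr; last by apply: Rintegral_ge0 => x _; exact: sqr_ge0.
by apply: eq_Rintegral => x _; rewrite expr2.
Qed.

Lemma L2norm_ge0 w : 0 <= L2norm m D w.
Proof. exact: sqrtr_ge0. Qed.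

Lemma L2norm_vecE n (y : T -> 'rV[R]_n) : L2vec m D y ->
  L2norm_vec m D y ^+ 2 =
  \sum_i ip (fun x => y x ord0 i) (fun x => y x ord0 i).
Proof.
move=> Ly; rewrite /L2norm_vec sqr_sqrtr; last first.
  by apply: Rintegral_ge0 => x _; apply: sumr_ge0 => i _; exact: sqr_ge0.
rewrite /Rintegral; under eq_integral do rewrite -sumEFin.
have -> : (\int[m]_(x in D) (\sum_(i < n) (y x ord0 i ^+ 2)%:E) =
          \sum_(i < n) \int[m]_(x in D) (y x ord0 i ^+ 2)%:E)%E.
  by rewrite integral_sum// => i; exact: L2_sqr_integrable.
rewrite -sum_fine; last first.
  move=> i _; apply: integrable_fin_num => //; exact: L2_sqr_integrable.
by apply: eq_bigr => i _; apply: eq_Rintegral => x _; rewrite expr2.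
Qed.

Lemma Rdominated_cvg (f_ : (T -> R)^nat) (f g : T -> R) :
  (forall n, measurable_fun D (f_ n)) ->
  (forall x, D x -> f_ n x @[n --> \oo] --> f x) ->
  m.-integrable D (EFin \o g) ->
  (forall n x, D x -> `|f_ n x| <= g x) ->
  \int[m]_(x in D) f_ n x @[n --> \oo] --> \int[m]_(x in D) f x.
Proof.
move=> mf ff ig fg.
have mff : measurable_fun D f by exact: measurable_fun_cvg mf ff.
have [] := @dominated_convergence _ _ _ m D mD (fun n => EFin \o f_ n) (EFin \o f) (EFin \o g).
- by move=> n; exact/measurable_EFinP.
- exact/measurable_EFinP.
- by apply/aeW => x Dx; apply/fine_cvgP; split; [exact: nearW|exact: ff].
- exact: ig.
- by apply/aeW => x n Dx; rewrite /= lee_fin fg.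
move=> iF _ cF; apply: fine_cvg; rewrite fineK//.
exact: integrable_fin_num.
Qed.

Lemma L2_dominated_cvg (w_ : (T -> R)^nat) (w g : T -> R) :
  (forall n, measurable_fun D (w_ n)) ->
  (forall x, D x -> w_ n x @[n --> \oo] --> w x) ->
  L2 m D g -> (forall n x, D x -> `|w_ n x| <= g x) ->
  [/\ L2 m D w, forall n, L2 m D (w_ n) &
    ip (fun x => w_ n x - w x) (fun x => w_ n x - w x) @[n --> \oo] --> (0 : R)].
Proof.
move=> mw ww Lg wg.
have mww : measurable_fun D w by exact: measurable_fun_cvg mw ww.
have wlg x : D x -> `|w x| <= g x.
  move=> Dx; rewrite -(cvg_lim (@Rhausdorff R) (cvg_norm (ww _ Dx))).
  apply: limr_le; first by apply/cvg_ex; eexists; exact: cvg_norm (ww _ Dx).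
  by apply: nearW => n; exact: wg.
have gn x : D x -> g x <= `|g x| by rewrite ler_norm.
have Lw : L2 m D w.
  by apply: (L2_dom mww Lg) => x Dx; rewrite (le_trans (wlg _ Dx))// gn.
have Lwn n : L2 m D (w_ n).
  by apply: (L2_dom (mw n) Lg) => x Dx; rewrite (le_trans (wg _ _ Dx))// gn.
split => //.
rewrite (_ : 0 = \int[m]_(x in D) 0)%R; last by rewrite Rintegral_cst ?mul0r.
apply: (@Rdominated_cvg _ _ (fun x => 4 * g x ^+ 2)).
- by move=> n; apply: measurable_funM; apply: measurable_funB => //; exact: mw.
- move=> x Dx; rewrite -[X in _ --> X](mulr0 0).
  have h : (w_ n x - w x) @[n --> \oo] --> (0 : R).
    by rewrite -(subrr (w x)); apply: cvgB; [exact: ww|exact: cvg_cst].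
  exact: cvgM.
- exact: (integrableZl mD 4 (L2_sqr_integrable Lg)).
- move=> n x Dx; rewrite -expr2 normrX.
  have h : `|w_ n x - w x| <= 2 * g x.
    rewrite (le_trans (ler_normB _ _))//; have := wg n x Dx; have := wlg x Dx; lra.
  have := normr_ge0 (w_ n x - w x); move: h; move: `|_| => a; nra.
Qed.

Lemma ip_cvgl (w_ : (T -> R)^nat) w g : (forall n, L2 m D (w_ n)) -> L2 m D w ->
  L2 m D g ->
  ip (fun x => w_ n x - w x) (fun x => w_ n x - w x) @[n --> \oo] --> (0 : R) ->
  ip (w_ n) g @[n --> \oo] --> ip w g.
Proof.
move=> Lwn Lw Lg c0; apply/subr_cvg0.
rewrite (_ : (fun n => _) = (fun n => ip (fun x => w_ n x - w x) g)); last first.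
  by apply/funext => n; rewrite ipBl.
apply/norm_cvg0P; apply: (@squeeze_cvgr _ _ _ _ (fun=> 0) (fun n =>
   Num.sqrt (ip (fun x => w_ n x - w x) (fun x => w_ n x - w x)) *
   Num.sqrt (ip g g))) => //.
- by apply: nearW => n; rewrite normr_ge0 ip_CS_sqrt//; exact: L2B.
- exact: cvg_cst.
- rewrite -[X in _ --> X](mul0r (Num.sqrt (ip g g))).
  apply: cvgM; last exact: cvg_cst.
  have := @sqrt_continuous R 0; rewrite /continuous_at sqrtr0 => c.
  exact: (cvg_comp _ _ c0 c).
Qed.

Lemma ip_eq0 w : L2 m D w -> ip w w = 0 -> {ae m, forall x, D x -> w x = 0}.
Proof.
move=> Lw w0.
have I := L2M_integrable Lw Lw.
have : (\int[m]_(x in D) `|(w x * w x)%:E| = 0)%E.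
  rewrite (eq_integral (fun x => (w x * w x)%:E)); last first.
    by move=> x _; rewrite /= ger0_norm// -expr2 sqr_ge0.
  by rewrite -[LHS]fineK ?integrable_fin_num//; congr EFin.
have mww : measurable_fun D (EFin \o (fun x => w x * w x)).
  by apply/measurable_EFinP/measurable_funM; exact: L2_meas Lw.
move/(ae_eq_integral_abs m mD mww) => ae0.
apply: filterS ae0 => x h Dx; have /eqP := h Dx.
by rewrite /= eqe mulf_eq0 orbb => /eqP.
Qed.

End L2_theory.

(** * Boxes in space-time *)

Section boxes.
Context {R : realType} {d : nat}.
Local Notation X := 'rV[R]_d.
Local Notation S := (X * measurableTypeR R)%type.
Implicit Types (a b : X) (s t : R).

Definition box a b s t : set S :=
  [set z : S | (forall i, z.1 ord0 i \in `]a ord0 i, b ord0 i[) /\ z.2 \in `]s, t[].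

Definition cbox a b s t : set S :=
  [set z : S | (forall i, z.1 ord0 i \in `[a ord0 i, b ord0 i]) /\ z.2 \in `[s, t]].

Lemma box_sub_cbox a b s t : box a b s t `<=` cbox a b s t.
Proof. by move=> z [h1 h2]; split=> [i|]; exact: subset_itv_oo_cc. Qed.

Lemma box_setX a b s t : box a b s t =
  [set x : X | forall i, `]a ord0 i, b ord0 i[%classic (x ord0 i)] `*` `]s, t[%classic.
Proof. by apply/seteqP; split => -[x r]. Qed.

Lemma cbox_setX a b s t : cbox a b s t =
  [set x : X | forall i, `[a ord0 i, b ord0 i]%classic (x ord0 i)] `*` `[s, t]%classic.
Proof. by apply/seteqP; split => -[x r]. Qed.

Lemma measurable_box_ST a b s t : measurable (box a b s t).
Proof.
rewrite box_setX; apply: measurableX => //.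
by apply: (@measurable_box R d (fun i => `]a ord0 i, b ord0 i[%classic)) => i.
Qed.

Lemma compact_cbox a b s t : compact (cbox a b s t).
Proof.
rewrite cbox_setX; apply: compact_setX; last exact: segment_compact.
by apply: (@rV_compact R d (fun i => `[a ord0 i, b ord0 i]%classic)) => i; exact: segment_compact.
Qed.

Lemma box_setI a b s t a' b' s' t' : box a b s t `&` box a' b' s' t' =
  box (\row_i Num.max (a ord0 i) (a' ord0 i)) (\row_i Num.min (b ord0 i) (b' ord0 i))
      (Num.max s s') (Num.min t t').
Proof.
have e (p q p' q' r : R) : (r \in `]p, q[) && (r \in `]p', q'[) =
    (r \in `]Num.max p p', Num.min q q'[).
  by rewrite !in_itv /= gt_max lt_min; case: (p < r); case: (r < q);
    case: (p' < r); case: (r < q').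
apply/seteqP; split => z.
  move=> [[h1 h2] [h3 h4]]; split=> [i|]; last by rewrite -e h2 h4.
  by rewrite !mxE -e h1 h3.
move=> [h1]; rewrite -e => /andP[h2 h3]; split; split=> // i; move: (h1 i);
  by rewrite !mxE -e => /andP[].
Qed.

(** Rational boxes form a countable base, each of whose members comes with its
    closed box: this is what makes open sets measurable and lets compactly
    contained boxes exhaust an open set. *)
Lemma open_rat_box (U : set S) z : open U -> U z ->
  exists p : 'rV[rat]_d * 'rV[rat]_d * rat * rat,
    box (map_mx ratr p.1.1.1) (map_mx ratr p.1.1.2) (ratr p.1.2) (ratr p.2) z /\
    cbox (map_mx ratr p.1.1.1) (map_mx ratr p.1.1.2) (ratr p.1.2) (ratr p.2) `<=` U.
Proof.
move=> oU Uz; have /nbhs_ballP[e /= e0 eU] : nbhs z U by exact: open_nbhs_nbhs.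
have l (r : R) : {q : rat | ratr q \in `]r - e, r[}.
  by apply/cid/rat_in_itvoo; rewrite ltrBlDr ltrDl.
have u (r : R) : {q : rat | ratr q \in `]r, r + e[}.
  by apply/cid/rat_in_itvoo; rewrite ltrDl.
exists (\row_i sval (l (z.1 ord0 i)), \row_i sval (u (z.1 ord0 i)),
  sval (l z.2), sval (u z.2)) => /=.
have lu (r : R) : r \in `]ratr (sval (l r)), ratr (sval (u r))[.
  case: (l r) => p; case: (u r) => q /=; rewrite !in_itv /=.
  by move=> /andP[-> _] /andP[_ ->].
have luB (r r' : R) : r' \in `[ratr (sval (l r)), ratr (sval (u r))] -> ball r e r'.
  case: (l r) => p; case: (u r) => q /=; rewrite !in_itv /=.
  move=> /andP[h1 h2] /andP[h3 h4] /andP[h5 h6]; rewrite -ball_normE /=.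
  rewrite ltr_distlC; apply/andP; split; lra.
split; first by split=> [i|] /=; rewrite ?mxE.
move=> w [h1 h2]; apply: eU; split; last exact: luB.
by split=> // i j; rewrite (ord1 i); apply: luB; have := h1 j; rewrite !mxE.
Qed.

Lemma open_measurable_ST (U : set S) : open U -> measurable U.
Proof.
move=> oU.
pose F (p : 'rV[rat]_d * 'rV[rat]_d * rat * rat) : set S :=
  let B f := f (map_mx ratr p.1.1.1) (map_mx ratr p.1.1.2) (ratr p.1.2) (ratr p.2) in
  if `[< B cbox `<=` U >] then B box else set0.
rewrite (_ : U = \bigcup_p F p).
  apply: countable_bigcupT_measurable; first exact: countableP.
  by move=> p; rewrite /F; case: ifP => // _; exact: measurable_box_ST.
apply/seteqP; split => z.
  move=> /(open_rat_box oU)[p [bz cU]]; exists p => //.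
  by rewrite /F; case: asboolP.
by move=> [p _]; rewrite /F; case: asboolP => // h /box_sub_cbox /h.
Qed.

Lemma continuous_measurable_ST (f : S -> R) : continuous f -> measurable_fun setT f.
Proof.
move=> cf; apply: (measurability _ (RGenOInfty.measurableE R)) => //.
move=> /= _ [_ [a ->] <-]; rewrite setTI; apply: open_measurable_ST.
by apply: open_comp => [? _|]; [exact: cf|exact: interval_open].
Qed.

Definition box_system : set (set S) :=
  [set A | exists a b s t, A = box a b s t].

Lemma box_system_setI : setI_closed box_system.
Proof.
move=> _ _ [a [b [s [t ->]]]] [a' [b' [s' [t' ->]]]].
by rewrite box_setI; do 4 eexists.
Qed.

Let bigcup_itv (x : R) : exists n : nat, x \in `]- n%:R, n%:R[.
Proof.
exists (`|Num.floor `|x| |.+1).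
rewrite in_itv /= -ltr_norml (lt_le_trans (truncnS_gt _))// ler_nat.
by rewrite truncn_floor normr_ge0.
Qed.

(** The coordinates are measurable for the sigma-algebra generated by boxes, hence
    so is the identity. *)
Lemma measurable_box_system (A : set S) : measurable A -> <<s box_system >> A.
Proof.
pose G := g_sigma_algebraType box_system.
have mG (B : set S) : box_system B -> measurable (B : set G).
  by move=> h; exact: sub_sigma_algebra.
have cover (f : G -> R) : (forall (p q : R),
    exists F : nat -> set S, (forall n, box_system (F n)) /\
      f @^-1` `]p, q[ = \bigcup_n F n) -> measurable_fun setT (f : G -> R).
  move=> h; apply: (measurability _ (RGenOInfty.measurableE R)) => //.
  move=> /= _ [_ [a ->] <-]; rewrite setTI.
  rewrite (_ : f @^-1` _ = \bigcup_n (f @^-1` `]a, n%:R[)).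
    apply: bigcupT_measurable => n; have [F [mF ->]] := h a n%:R.
    by apply: bigcupT_measurable => k; exact: mG.
  apply/seteqP; split => z /=; rewrite in_itv /= andbT.
    move=> az; have [n] := bigcup_itv (f z); rewrite in_itv /= => /andP[_ zn].
    by exists n => //=; rewrite in_itv /= az.
  by move=> [n _] /=; rewrite in_itv /= => /andP[].
have box_n (z : S) : exists n : nat,
    (forall i, z.1 ord0 i \in `]- n%:R, n%:R[) /\ z.2 \in `]- n%:R, n%:R[.
  have [n hn] := bigcup_itv z.2.
  have /choice[k hk] : forall i, exists n : nat, z.1 ord0 i \in `]- n%:R, n%:R[.
    by move=> i; exact: bigcup_itv.
  have mono (r : R) (p q : nat) : (p <= q)%N -> r \in `]- p%:R, p%:R[ -> r \in `]- q%:R, q%:R[.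
    move=> pq; rewrite !in_itv /= -!ltr_norml => /lt_le_trans; apply.
    by rewrite ler_nat.
  exists (maxn n (\max_i k i)); split => [i|].
    by apply: mono (hk i); rewrite leq_max (leq_bigmax i) orbT.
  by apply: mono hn; rewrite leq_max leqnn.
have mid : measurable_fun (setT : set G) (id : G -> S).
  apply/measurable_fun_pairP; split.
    apply: measurable_fun_rV => i; apply: cover => p q.
    pose F n := box (\row_j if j == i then p else - n%:R)
      (\row_j if j == i then q else n%:R) (- n%:R) n%:R.
    exists F; split; first by move=> n; do 4 eexists.
    apply/seteqP; split => z /=.
      move=> h; have [n [h1 h2]] := box_n z; exists n => //; split => // j.
      by rewrite !mxE; case: eqP => [->|].
    by move=> [n _ [/(_ i) + _]]; rewrite !mxE eqxx.
  apply: cover => p q.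
  pose F n := box (\row_j - n%:R) (\row_j n%:R) p q.
  exists F; split; first by move=> n; do 4 eexists.
  apply/seteqP; split => z /=.
    move=> h; have [n [h1 h2]] := box_n z; exists n => //; split => // j.
    by rewrite !mxE.
  by move=> [n _ []].
by move=> mA; have := mid measurableT A mA; rewrite setTI.
Qed.

End boxes.

(** * Smooth functions *)

Section directional.
Context {R : realType} {V : normedModType R}.
Implicit Types (f g : V -> R) (x v : V).

Lemma is_derive_lineE f x v df :
  is_derive x v f df <-> is_derive (0 : R) 1 (fun t : R => f (t *: v + x)) df.
Proof.
have e : (fun h : R => h^-1 *: ((f \o shift x) (h *: v) - f x)) =
    (fun h : R => h^-1 *: (((fun t : R => f (t *: v + x)) \o shift 0) (h *: 1) -
                   f (0 *: v + x))).
  apply/funext => h; congr (_ *: (f _ - f _)) => /=.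
  - by rewrite addr0 scaler1.
  - by rewrite scale0r add0r.
split=> -[h1 h2]; split.
- by rewrite /derivable /= -e.
- by rewrite /derive /= -e.
- by rewrite /derivable e.
- by rewrite /derive e.
Qed.

Lemma is_derive_comp1 (h : R -> R) f x v dh df :
  is_derive (f x) 1 h dh -> is_derive x v f df -> is_derive x v (h \o f) (dh * df).
Proof.
move=> dh_ /is_derive_lineE df_; apply/is_derive_lineE.
apply: (@is_derive1_comp _ h (fun t => f (t *: v + x)) 0) => //.
by rewrite scale0r add0r.
Qed.

Lemma is_derive_shift f (c x v : V) df :
  is_derive (x + c) v f df -> is_derive x v (fun z => f (z + c)) df.
Proof.
move=> /is_derive_lineE h; apply/is_derive_lineE.
by move: h; congr is_derive; apply/funext => t; rewrite addrA.
Qed.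

End directional.

Section smooth_theory.
Context {R : realType} {V : normedModType R}.
Implicit Types (f g : V -> R) (x v : V).

(** Smoothness quantifies over all iterated derivatives, which are not computed:
    it is enough to exhibit a class stable under one differentiation. Products
    and composites are not literally stable, but the class they generate is. *)
Lemma smooth_coind (P : (V -> R) -> Prop) :
  (forall f, P f -> continuous f) ->
  (forall f, P f -> forall v, exists2 g, P g & forall x, is_derive x v f (g x)) ->
  forall f, P f -> smooth f.
Proof.
move=> Pc Pd f Pf vs /=.
have Pvs : P (foldr (fun v h => 'D_v h) f vs).
  elim: vs => //= v vs IH; have [g Pg dg] := Pd _ IH v.
  by rewrite (_ : 'D_v _ = g)//; apply/funext => x; have [] := dg x.
split; first exact: Pc.
by move=> x v; have [g _ dg] := Pd _ Pvs v; have [] := dg x.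
Qed.

Lemma smooth_continuous f : smooth f -> continuous f.
Proof. by move=> /(_ [::])[]. Qed.

Lemma smooth_is_derive f x v : smooth f -> is_derive x v f ('D_v f x).
Proof. by move=> /(_ [::])[_ h]; split. Qed.

Lemma smooth_derive f v : smooth f -> smooth ('D_v f).
Proof. by move=> sf vs; have := sf (rcons vs v); rewrite /= foldr_rcons. Qed.

End smooth_theory.

Section smooth_closure.
Context {R : realType} {V : normedModType R}.
Implicit Types (f g : V -> R) (x v : V).

(** The smallest class to which [smooth_coind] can be applied for products and
    composites: the derivative of a product or of a composite is a combination
    of products and composites again. *)
Inductive smooth_gen : (V -> R) -> Prop :=
| smooth_gen_base f : smooth f -> smooth_gen f
| smooth_gen_add f g : smooth_gen f -> smooth_gen g -> smooth_gen (f + g)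
| smooth_gen_mul f g : smooth_gen f -> smooth_gen g -> smooth_gen (f * g)
| smooth_gen_comp (h : R -> R) f : smooth h -> smooth_gen f -> smooth_gen (h \o f).

Lemma smooth_gen_smooth f : smooth_gen f -> smooth f.
Proof.
move: f; apply: smooth_coind.
  move=> f; elim=> {f} [f /smooth_continuous//|f g _ cf _ cg|f g _ cf _ cg|h f sh _ cf] x.
  - exact: cvgD (cf x) (cg x).
  - exact: cvgM (cf x) (cg x).
  - by apply: continuous_comp; [exact: cf|exact: smooth_continuous].
move=> f; elim=> {f} [f sf|f g _ IHf _ IHg|f g gf IHf gg IHg|h f sh gf IHf] v.
- exists ('D_v f); first exact/smooth_gen_base/smooth_derive.
  by move=> x; exact: smooth_is_derive.
- have [df gdf ddf] := IHf v; have [dg gdg ddg] := IHg v.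
  exists (df + dg); first exact: smooth_gen_add.
  by move=> x; exact: is_deriveD.
- have [df gdf ddf] := IHf v; have [dg gdg ddg] := IHg v.
  exists (f * dg + g * df); first by apply: smooth_gen_add; exact: smooth_gen_mul.
  by move=> x; exact: is_deriveM.
- have [df gdf ddf] := IHf v.
  exists (('D_1 h \o f) * df).
    by apply: smooth_gen_mul => //; apply: smooth_gen_comp => //; exact: smooth_derive.
  by move=> x; apply: is_derive_comp1 => //; exact: smooth_is_derive.
Qed.

Lemma smoothD f g : smooth f -> smooth g -> smooth (fun x => f x + g x).
Proof. by move=> sf sg; apply/smooth_gen_smooth/smooth_gen_add; exact: smooth_gen_base. Qed.

Lemma smoothM f g : smooth f -> smooth g -> smooth (fun x => f x * g x).
Proof. by move=> sf sg; apply/smooth_gen_smooth/smooth_gen_mul; exact: smooth_gen_base. Qed.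

Lemma smooth_comp (h : R -> R) f : smooth h -> smooth f -> smooth (fun x => h (f x)).
Proof.
by move=> sh sf; apply: (@smooth_gen_smooth (h \o f)); apply/smooth_gen_comp/smooth_gen_base.
Qed.

Lemma smooth_cst (c : R) : smooth (fun _ : V => c).
Proof.
apply: (@smooth_coind _ _ (fun f => exists c, f = fun=> c)); last by exists c.
- by move=> _ [a ->] x; exact: cvg_cst.
- move=> _ [a ->] v; exists (fun=> 0); first by exists 0.
  by move=> x; exact: is_derive_cst.
Qed.

Lemma smoothZ (c : R) f : smooth f -> smooth (fun x => c * f x).
Proof. by move=> sf; apply: smoothM => //; exact: smooth_cst. Qed.

Lemma smoothB f g : smooth f -> smooth g -> smooth (fun x => f x - g x).
Proof.
move=> sf sg.
have := smoothD sf (smoothZ (-1) sg); congr smooth; apply/funext => x.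
by rewrite mulN1r.
Qed.

Lemma smooth_prod n (f : 'I_n -> V -> R) : (forall i, smooth (f i)) ->
  smooth (fun x => \prod_i f i x).
Proof.
move=> sf; rewrite (_ : (fun x => _) = \prod_i f i).
  apply: (big_ind (@smooth R V)) => [|p q|//]; [exact: smooth_cst|exact: smoothM].
by apply/funext => x; rewrite fct_prodE.
Qed.

Lemma smooth_shift (c : V) f : smooth f -> smooth (fun x => f (x + c)).
Proof.
move=> sf.
apply: (@smooth_coind _ _ (fun g => exists2 f, smooth f & g = fun x => f (x + c))).
- move=> _ [g sg ->] x.
  apply: (continuous_comp (f := fun x => x + c)); last exact: smooth_continuous.
  by apply: cvgD; [exact: cvg_id|exact: cvg_cst].
- move=> _ [g sg ->] v; exists (fun x => 'D_v g (x + c)).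
    by exists ('D_v g) => //; exact: smooth_derive.
  by move=> x; apply: is_derive_shift; exact: smooth_is_derive.
- by exists f.
Qed.

Lemma smooth_linear (f : V -> R) : (forall (t : R) u v, f (t *: u + v) = t * f u + f v) ->
  continuous f -> smooth f.
Proof.
move=> lf cf.
apply: (@smooth_coind _ _ (fun g => g = f \/ exists c, g = fun=> c)); last by left.
- by move=> _ [->//|[c ->]] x; exact: cvg_cst.
- move=> _ [->|[c ->]] v.
    exists (fun=> f v); first by right; exists (f v).
    move=> x; apply/is_derive_lineE.
    rewrite (_ : (fun t => _) = (fun t => t * f v + f x)); last exact/funext.
    rewrite -[X in is_derive _ _ _ X]addr0; apply: is_deriveD.
    have := is_deriveM (is_derive_id (0 : R) 1) (is_derive_cst (f v) (0 : R) 1).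
    by rewrite scaler0 add0r scaler1.
  exists (fun=> 0); first by right; exists 0.
  by move=> x; exact: is_derive_cst.
Qed.

End smooth_closure.

Section smooth_real.
Context {R : realType}.
Implicit Types (h : R -> R).

Lemma smooth_real_coind (P : (R -> R) -> Prop) :
  (forall h, P h -> exists2 h', P h' & forall x : R, is_derive x 1 h (h' x)) ->
  forall h, P h -> smooth h.
Proof.
move=> Pd h Ph.
apply: (@smooth_coind _ _ (fun f => exists c g, P g /\ f = fun x => c * g x)).
- move=> _ [c [g [Pg ->]]] x.
  apply: cvgM; first exact: cvg_cst.
  have [g' _ dg] := Pd _ Pg; apply: differentiable_continuous.
  by apply/derivable1_diffP; have [] := dg x.
- move=> _ [c [g [Pg ->]]] v; have [g' Pg' dg] := Pd _ Pg.
  exists (fun x => (v * c) * g' x); first by exists (v * c), g'.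
  move=> x; have -> : v * c * g' x = (c * g' x) * v by ring.
  have dcg : is_derive x 1 (fun x => c * g x) (c * g' x).
    by have := @is_deriveZ _ _ _ g c x 1 _ (dg x).
  apply: (@is_derive_comp1 _ _ (fun x => c * g x) id) => //.
- by exists 1, h; split=> //; apply/funext => x; rewrite mul1r.
Qed.

Lemma smooth_expR : smooth (@expR R).
Proof.
apply: (@smooth_real_coind (fun h => h = @expR R)) => // _ ->.
by exists expR => // x; exact: is_derive_expR.
Qed.

Lemma smooth_id : smooth (@id R).
Proof. by apply: smooth_linear => // x; exact: cvg_id. Qed.

Lemma smooth_primitive h h' : smooth h' -> (forall x : R, is_derive x 1 h (h' x)) -> smooth h.
Proof.
move=> sh' dh_.
apply: (@smooth_real_coind (fun f => f = h \/ smooth f)); last by left.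
move=> f [->|sf]; first by exists h' => //; right.
 exists ('D_1 f); first by right; exact: smooth_derive.
by move=> x; exact: smooth_is_derive.
Qed.

End smooth_real.

Section flat_function.
Context {R : realType}.
Implicit Types (p : {poly R}) (x : R).

(** With p = 1 this is the standard flat function exp(-1/x); the polynomial p is
    there so that the family is stable under differentiation. *)
Definition flat p x : R := if 0 < x then p.[x^-1] * expR (- x^-1) else 0.

(** Exponential decay in y = 1/x: the case n = 2 makes [flat p] o(x) at 0,
    hence differentiable there. *)
Lemma poly_expR_bounded p n : exists2 C, 0 <= C &
  forall y, 1 <= y -> `|p.[y]| * y ^+ n * expR (- y) <= C.
Proof.
elim/poly_ind: p n => [|p c IH] n.
  by exists 0 => // y _; rewrite horner0 normr0 !mul0r.
have [C C0 hC] := IH n.+1; exists (C + `|c| * n.+1`!%:R) => [|y y1].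
  by rewrite addr_ge0// mulr_ge0// ler0n.
have y0 : 0 <= y by rewrite (le_trans _ y1).
rewrite hornerMXaddC.
apply: (@le_trans _ _ ((`|p.[y]| * y + `|c|) * y ^+ n * expR (- y))).
  rewrite ler_wpM2r ?expR_ge0// ler_wpM2r ?exprn_ge0//.
  by rewrite (le_trans (ler_normD _ _))// normrM (ger0_norm y0).
rewrite mulrDl mulrDl; apply: lerD.
  by have := hC y y1; rewrite exprS mulrA.
rewrite -mulrA ler_wpM2l// expRN ler_pdivrMr ?expR_gt0//.
have h := expR_ge1Dxn n y0.
have h2 : y ^+ n.+1 / n.+1`!%:R <= expR y by rewrite (le_trans _ h)// lerDr.
move: h2; rewrite ler_pdivrMr ?ltr0n ?fact_gt0// mulrC; apply: le_trans.
by rewrite ler_weXn2l.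
Qed.

Lemma is_derive_flat p x :
  is_derive x 1 (flat p) (flat ((p - p^`()) * 'X^2) x).
Proof.
have [x0|x0|<-] := ltgtP 0 x.
- rewrite {2}/flat x0.
  apply: (@near_eq_is_derive R R R (fun y : R => p.[y^-1] * expR (- y^-1)) (flat p)).
    by near=> y; rewrite /flat ifT//; near: y; exact: lt_nbhsr.
  have xn0 : x != 0 by rewrite gt_eqF.
  have dV : is_derive x 1 (fun y : R => y^-1) (- x ^- 2).
    have := @is_deriveV R id x 1 1 xn0 (is_derive_id _ _).
    by rewrite scaler1.
  have dp : is_derive x 1 (fun y : R => p.[y^-1]) (p^`().[x^-1] * - x ^- 2).
    by apply: (@is_derive1_comp _ (horner p) (fun y => y^-1)).
  have dE : is_derive x 1 (fun y : R => expR (- y^-1)) (expR (- x^-1) * x ^- 2).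
    apply: (@is_derive1_comp _ expR (fun y => - y^-1)).
    by rewrite -[X in is_derive _ _ _ X]opprK; exact: is_deriveN.
  have := is_deriveM dp dE; congr is_derive.
  rewrite hornerM hornerXn hornerD hornerN /GRing.scale /=.
  by rewrite exprVn; ring.
- have -> : flat ((p - p^`()) * 'X^2) x = 0.
    by rewrite /flat ifF//; apply/negbTE; rewrite -leNgt ltW.
  apply: (@near_eq_is_derive R R R (cst 0) (flat p)).
  near=> y; rewrite /flat ifF//; apply/negbTE; rewrite -leNgt ltW//.
  by near: y; exact: lt_nbhsl.
- rewrite {2}/flat ltxx.
  suff c : h^-1 *: ((flat p \o shift 0) (h *: 1) - flat p 0) @[h --> 0^'] --> (0 : R).
    by split; [apply/cvg_ex; exists 0|exact: cvg_lim c].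
  have [C C0 hC] := poly_expR_bounded p 2.
  apply/norm_cvg0P.
  apply: (@squeeze_cvgr _ _ _ _ (fun=> 0) (fun h => C * `|h|)).
  + near=> h; rewrite normr_ge0 /=.
    have hn0 : h != 0 by near: h; exact: nbhs_dnbhs_neq.
    rewrite addr0 scaler1 {2}/flat ltxx subr0 /GRing.scale /= /flat.
    case: ifPn => h0; last by rewrite mulr0 normr0 mulr_ge0.
    have h1 : h <= 1.
      have : `|h| <= 1.
        by near: h; apply: dnbhs0_le.
      by rewrite (ger0_norm (ltW h0)).
    have y1 : 1 <= h^-1 by rewrite invf_ge1.
    have := hC _ y1.
    rewrite !normrM (ger0_norm (expR_ge0 _)) (gtr0_norm h0) ger0_norm ?invr_ge0 ?(ltW h0)//.
    set A := `|_|; set E := expR _ => hh.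
    have -> : h^-1 * (A * E) = (A * h^-1 ^+ 2 * E) * h by field.
    by rewrite ler_wpM2r// (ltW h0).
  + exact: cvg_cst.
  + rewrite -[X in _ --> X](mulr0 C); apply: cvgM; first exact: cvg_cst.
    apply: cvg_within_filter.
    by have := @norm_continuous R R 0; rewrite /continuous_at normr0.
Unshelve. all: by end_near.
Qed.

Lemma smooth_flat p : smooth (flat p).
Proof.
apply: (@smooth_real_coind _ (fun h => exists p, h = flat p)); last by exists p.
move=> _ [q ->]; exists (flat ((q - q^`()) * 'X^2)); first by eexists.
by move=> x; exact: is_derive_flat.
Qed.

Lemma flat1_gt0 x : 0 < x -> 0 < flat 1 x.
Proof. by move=> x0; rewrite /flat x0 hornerC mul1r expR_gt0. Qed.

Lemma flat1_ge0 x : 0 <= flat 1 x.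
Proof. by rewrite /flat; case: ifP => // x0; rewrite hornerC mul1r expR_ge0. Qed.

Lemma flat1_le0 x : x <= 0 -> flat 1 x = 0.
Proof. by rewrite /flat leNgt => /negbTE ->. Qed.

(** The product of the two flat factors is positive exactly on ]a, b[; passing to
    1 - exp(-k _) keeps the values in [0, 1) and makes them tend to 1 there as k
    grows, so that plateaus approximate indicators of intervals. *)
Definition plateau (k : nat) (a b x : R) : R :=
  1 - expR (- (k%:R * (flat 1 (x - a) * flat 1 (b - x)))).

Lemma smooth_plateau k a b : smooth (plateau k a b).
Proof.
apply: smoothB; first exact: smooth_cst.
apply: (smooth_comp smooth_expR).
have := @smoothZ _ _ (- k%:R) (fun x => flat 1 (x - a) * flat 1 (b - x)).
rewrite (_ : (fun x => - (k%:R * _)) =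
  (fun x : R => - k%:R * (flat 1 (x - a) * flat 1 (b - x)))); last first.
  by apply/funext => x; rewrite mulNr.
apply; apply: smoothM; apply: (smooth_comp (smooth_flat 1)).
- by apply: smoothB; [exact: smooth_id|exact: smooth_cst].
- by apply: smoothB; [exact: smooth_cst|exact: smooth_id].
Qed.

Lemma plateau_ge0 k a b x : 0 <= plateau k a b x.
Proof.
by rewrite subr_ge0 -[X in _ <= X]expR0 ler_expR oppr_le0 !mulr_ge0 ?flat1_ge0.
Qed.

Lemma plateau_le1 k a b x : plateau k a b x <= 1.
Proof. by rewrite gerBl expR_ge0. Qed.

Lemma plateau_out k a b x : x \notin `]a, b[ -> plateau k a b x = 0.
Proof.
rewrite in_itv /= negb_and -!leNgt => /orP[h|h].
  by rewrite /plateau (@flat1_le0 (x - a)) ?subr_le0// mul0r mulr0 oppr0 expR0 subrr.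
by rewrite /plateau (@flat1_le0 (b - x)) ?subr_le0// !mulr0 oppr0 expR0 subrr.
Qed.

Lemma plateau_cvg a b x : x \in `]a, b[ -> plateau k a b x @[k --> \oo] --> (1 : R).
Proof.
rewrite in_itv /= => /andP[ax xb]; rewrite /plateau.
set c := flat 1 (x - a) * flat 1 (b - x).
have c0 : 0 < c by rewrite mulr_gt0// flat1_gt0 ?subr_gt0.
rewrite -[X in _ --> X](subr0 (1 : R)); apply: cvgB; first exact: cvg_cst.
have e k : expR (- (k%:R * c)) = (expR (- c)) ^+ k.
  by rewrite -expRM_natl mulrN.
under eq_fun do rewrite e.
apply: cvg_expr; rewrite ger0_norm ?expR_ge0//.
by rewrite -[X in _ < X]expR0 ltr_expR oppr_lt0.
Qed.

End flat_function.

(** * Symmetry of second derivatives, and test functions *)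

Section schwarz.
Context {R : realType} {V : normedModType R}.
Implicit Types (f : V -> R) (x u v : V).

Let is_derive_line f x v (t : R) : smooth f ->
  is_derive t 1 (fun t : R => f (t *: v + x)) ('D_v f (t *: v + x)).
Proof.
move=> sf.
have /is_derive_lineE := smooth_is_derive (t *: v + x) v sf.
move=> h; apply/is_derive_lineE; move: h; congr is_derive; apply/funext => s.
by rewrite scaler1 scalerDl addrA.
Qed.

Lemma mean_value_line f x v (h : R) : smooth f -> 0 < h ->
  exists2 t, t \in `]0, h[ & f (h *: v + x) - f x = 'D_v f (t *: v + x) * h.
Proof.
move=> sf h0.
have [||t th e] := @MVT R (fun t => f (t *: v + x)) (fun t => 'D_v f (t *: v + x)) 0 h h0.
- by move=> t _; exact: is_derive_line.
- apply: derivable_within_continuous => t _.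
  by have [] := is_derive_line x v t sf.
- by exists t => //; move: e; rewrite scale0r add0r subr0.
Qed.

Let second_difference f x u v (h : R) : smooth f -> 0 < h ->
  exists s t, [/\ s \in `]0, h[, t \in `]0, h[ &
    f (h *: u + (h *: v + x)) - f (h *: u + x) - f (h *: v + x) + f x =
    'D_v ('D_u f) (s *: u + (t *: v + x)) * h ^+ 2].
Proof.
move=> sf h0.
pose g z := f (z + h *: v) - f z.
have sg : smooth g := smoothB (smooth_shift (h *: v) sf) sf.
have [s sh es] := mean_value_line x u sg h0.
have [t th et] := mean_value_line (s *: u + x) v (smooth_derive u sf) h0.
exists s, t; split=> //.
have -> : s *: u + (t *: v + x) = t *: v + (s *: u + x) by rewrite addrCA.
transitivity (g (h *: u + x) - g x).
  rewrite /g -!addrA (addrC x (h *: v)) [RHS]addrA.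
  by rewrite opprB; ring.
rewrite es expr2 mulrA; congr (_ * h); rewrite -et.
rewrite (addrC (h *: v)); move: (s *: u + x) => z.
have d1 := smooth_is_derive z u sf.
have /is_derive_shift d2 := smooth_is_derive (z + h *: v) u sf.
by have [] := is_deriveB d2 d1.
Qed.

Let increment_eq (p q r w a b : R) : p - q - r + w = a -> p - r - q + w = b -> a = b.
Proof. by lra. Qed.

Let dist_lt_of_close (A B C1 C2 r : R) :
  C1 = C2 -> `|B - C1| < r / 2 -> `|A - C2| < r / 2 -> `|A - B| < r.
Proof.
by move=> <-; rewrite !ltr_norml => /andP[? ?] /andP[? ?]; apply/andP; split; lra.
Qed.

(** Schwarz: by the mean value theorem both mixed derivatives are attained, up to
    the factor h^2, by the same second difference. *)
Lemma derive_comm f u v : smooth f -> 'D_u ('D_v f) = 'D_v ('D_u f).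
Proof.
move=> sf; apply/funext => x; apply/eqP; rewrite -subr_eq0; apply/negPn/negP => n0.
set e := `|'D_u ('D_v f) x - 'D_v ('D_u f) x|.
have e0 : 0 < e / 2 by rewrite divr_gt0// normr_gt0.
have cont (g : V -> R) a b : continuous g -> \forall h \near (0 : R)^'+,
    forall s t, s \in `]0, h[ -> t \in `]0, h[ ->
    `|g x - g (s *: a + (t *: b + x))| < e / 2.
  move=> cg; have /cvgrPdist_lt/(_ _ e0)/nbhs_ballP[r /= r0 hr] := cg x.
  near=> h => s t; rewrite !in_itv /= => /andP[s0 sh] /andP[t0 th].
  apply: hr; rewrite -ball_normE /= addrA opprD addrCA subrr addr0 normrN.
  rewrite (le_lt_trans (ler_normD _ _))// !normrZ !gtr0_norm//.
  apply: (@le_lt_trans _ _ (h * `|a| + h * `|b|)).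
    by apply: lerD; rewrite ler_wpM2r// ltW.
  rewrite -mulrDr.
  have ab : 0 < `|a| + `|b| + 1 by rewrite ltr_wpDl.
  apply: (@le_lt_trans _ _ (h * (`|a| + `|b| + 1))).
    by rewrite ler_wpM2l ?lerDl//; near: h; exact: nbhs_right_ge.
  rewrite -ltr_pdivlMr//; near: h; apply: nbhs_right_lt.
  by rewrite divr_gt0.
have H1 := cont _ v u (smooth_continuous (smooth_derive u (smooth_derive v sf))).
have H2 := cont _ u v (smooth_continuous (smooth_derive v (smooth_derive u sf))).
near (0 : R)^'+ => h.
have h0 : 0 < h by near: h; exact: nbhs_right_gt.
have [s [t [sh th e1]]] := second_difference x u v sf h0.
have [s' [t' [sh' th' e2]]] := second_difference x v u sf h0.
have K1 : `|'D_v ('D_u f) x - 'D_v ('D_u f) (s *: u + (t *: v + x))| < e / 2.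
  by apply: (near H2 h).
have K2 : `|'D_u ('D_v f) x - 'D_u ('D_v f) (s' *: v + (t' *: u + x))| < e / 2.
  by apply: (near H1 h).
have E : 'D_v ('D_u f) (s *: u + (t *: v + x)) =
         'D_u ('D_v f) (s' *: v + (t' *: u + x)).
  apply: (@mulIf _ (h ^+ 2)); first by rewrite expf_neq0// gt_eqF.
  by rewrite addrCA in e1; exact: increment_eq e1 e2.
by have := dist_lt_of_close E K1 K2; rewrite -/e ltxx.
Unshelve. all: by end_near.
Qed.

End schwarz.

Section test_functions_theory.
Context {R : realType} {V : normedModType R}.
Implicit Types (phi psi : V -> R) (U K : set V).

(** The way to recognise a test function without computing its support. *)
Lemma test_function_support phi K U : smooth phi -> compact K ->
  (forall z, phi z != 0 -> K z) -> K `<=` U -> test_function U phi.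
Proof.
move=> sphi cK phiK KU.
have clK : closed K by apply: compact_closed => //; exact: norm_hausdorff.
have sub : tsupp phi `<=` K by rewrite [K](closure_id K).1//; apply: closureS.
split => //; last exact: subset_trans sub KU.
by apply: (subclosed_compact _ cK sub); exact: closed_closure.
Qed.

Lemma tsupp_neq0 phi z : phi z != 0 -> tsupp phi z.
Proof. by move=> h; exact: (@subset_closure _ [set x | phi x != 0] z h). Qed.

Lemma derive_tsupp phi v z : 'D_v phi z != 0 -> tsupp phi z.
Proof.
apply: contra_neqP => nz.
have oC : open (~` tsupp phi) by apply: closed_openC; exact: closed_closure.
have : \near z, phi z = cst 0 z.
  near=> y; have : (~` tsupp phi) y by near: y; exact: open_nbhs_nbhs.
  by move=> h; apply/eqP/negPn/negP => /tsupp_neq0.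
by move=> /(@near_eq_derive _ _ _ _ _ _ v) ->; exact: derive_cst.
Unshelve. all: by end_near.
Qed.

Lemma test_function_derive U phi v : test_function U phi -> test_function U ('D_v phi).
Proof.
move=> [sphi cphi phiU]; apply: (@test_function_support _ (tsupp phi)) => //.
- exact: smooth_derive.
- by move=> z; exact: derive_tsupp.
Qed.

Lemma test_functionB U phi psi : test_function U phi -> test_function U psi ->
  test_function U (fun x => phi x - psi x).
Proof.
move=> [s1 c1 U1] [s2 c2 U2].
apply: (@test_function_support _ (tsupp phi `|` tsupp psi)).
- exact: smoothB.
- exact: compactU.
- move=> z n0; have [p0|p0] := eqVneq (phi z) 0; last by left; exact: tsupp_neq0.
  right; apply: tsupp_neq0; apply: contra n0 => /eqP ->.
  by rewrite p0 subrr.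
- by move=> z [/U1|/U2].
Qed.

Lemma test_function_bounded U phi : test_function U phi -> exists M, forall z, `|phi z| <= M.
Proof.
move=> [sphi cphi _].
have [K0|/set0P K0] := eqVneq (tsupp phi) set0.
  exists 0 => z; rewrite normr_le0; apply/negPn/negP => /tsupp_neq0.
  by rewrite K0.
have cont : {within tsupp phi, continuous (fun z => `|phi z|)}.
  apply: continuous_subspaceT => z.
  by apply: cvg_norm; exact: smooth_continuous.
have [c _ hc] := compact_EVT_max K0 cphi cont.
exists `|phi c| => z.
have [->|/tsupp_neq0/mem_set/hc//] := eqVneq (phi z) 0.
by rewrite normr0.
Qed.

End test_functions_theory.

(** * The space-time cylinder *)

Section cylinder_theory.
Context {R : realType} {d : nat}.
Local Notation X := 'rV[R]_d.
Local Notation S := (X * measurableTypeR R)%type.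
Variables (Omega : set X) (T : R).
Hypotheses (oO : open Omega) (bO : bounded_set Omega).
Local Notation mu := (@lebesgue_ST R d).
Local Notation Q := (cylinder Omega T).

Lemma open_setX_ST (A : set X) (B : set R) : open A -> open B ->
  open (A `*` B : set S).
Proof.
move=> oA oB.
rewrite (_ : A `*` B = (fst : S -> X) @^-1` A `&` (snd : S -> measurableTypeR R) @^-1` B)//.
apply: openI; apply: open_comp => //.
- by move=> z _; exact: cvg_fst.
- by move=> z _; exact: cvg_snd.
Qed.

Lemma open_cylinder : open Q.
Proof. by apply: open_setX_ST => //; exact: interval_open. Qed.

Lemma measurable_cylinder : measurable Q.
Proof. by apply: open_measurable_ST; exact: open_cylinder. Qed.

Lemma measurable_base : measurable Omega.
Proof.
have : measurable (Omega `*` [set: measurableTypeR R]).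
  by apply: open_measurable_ST; apply: (@open_setX_ST Omega setT) => //; exact: (@openT R).
move=> /(measurable_ysection (0 : measurableTypeR R)).
congr measurable; apply/seteqP; split => x; rewrite /ysection /= inE.
- by case.
- by move=> Ox; split.
Qed.

Lemma lebesgue_ST_box (a b : X) s t : (mu (box a b s t) < +oo)%E.
Proof.
rewrite box_setX /lebesgue_ST /= product_measure1E//; last first.
  by apply: (@measurable_box R d (fun i => `]a ord0 i, b ord0 i[%classic)) => i.
apply: lte_mul_pinfty; first exact: measure_ge0.
  have := @lebesgue_rV_box R d (fun i => `]a ord0 i, b ord0 i[%classic)
    (fun i => measurable_itv _).
  rewrite /= => ->; apply: prode_fin_num => i _; rewrite lebesgue_measure_itv /=.
  by case: ifP.
have := @lebesgue_measure_itv R `]s, t[; rewrite /= => ->; case: ifP => _; rewrite ?ltry// -EFinB ltry.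
Qed.

Lemma cylinder_sub_box : exists a b, Q `<=` box a b 0 T.
Proof.
have [M [Mr hM]] := bO.
exists (\row_i - (M + 2)), (\row_i (M + 2)) => -[x t] [/= Ox tT]; split=> // i.
have xM : `|x| <= M + 1 by apply: hM => //; rewrite ltrDl.
rewrite !mxE in_itv /= -ltr_norml.
apply: (@le_lt_trans _ _ `|x|); last by rewrite (le_lt_trans xM)//; lra.
rewrite [X in _ <= X]mx_normrE.
exact: (le_bigmax _ (fun ij : 'I_1 * 'I_d => `|x ij.1 ij.2|) (ord0, i)).
Qed.

Lemma cylinder_fin : (mu Q < +oo)%E.
Proof.
have [a [b Qab]] := cylinder_sub_box.
apply: le_lt_trans (lebesgue_ST_box a b 0 T); apply: le_measure => //.
- by rewrite inE; exact: measurable_cylinder.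
- by rewrite inE; exact: measurable_box_ST.
Qed.

Lemma L2Q_test U phi : test_function U phi -> L2 mu Q phi.
Proof.
move=> tphi; have [M hM] := test_function_bounded tphi.
have [sphi _ _] := tphi.
apply: (L2_bounded measurable_cylinder cylinder_fin (M := M)) => //.
by apply: measurable_funTS; apply: continuous_measurable_ST; exact: smooth_continuous.
Qed.

End cylinder_theory.

(** * Density of smooth bumps in L2(Q) *)

Section density.
Context {R : realType} {d : nat}.
Local Notation X := 'rV[R]_d.
Local Notation S := (X * measurableTypeR R)%type.
Variables (Omega : set X) (T : R).
Hypotheses (oO : open Omega) (bO : bounded_set Omega).
Local Notation mu := (@lebesgue_ST R d).
Local Notation Q := (cylinder Omega T).
Local Notation ip := (ip mu Q).
Local Notation L2 := (L2 mu Q).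
Let mQ : measurable Q := measurable_cylinder T oO.

Definition prodfun (k : nat) (a b : X) (eta : R -> R) : S -> R :=
  fun z => (\prod_i plateau k (a ord0 i) (b ord0 i) (z.1 ord0 i)) * eta z.2.

Lemma smooth_coord (i : 'I_d) : smooth (fun z : S => z.1 ord0 i).
Proof.
apply: smooth_linear; first by move=> t u v; rewrite /= !mxE.
move=> z; apply: (continuous_comp (f := fst) (g := fun x : X => x ord0 i)).
  exact: cvg_fst.
exact: coord_continuous.
Qed.

Lemma smooth_time : smooth (fun z : S => z.2 : R).
Proof. by apply: smooth_linear => // z; exact: cvg_snd. Qed.

Lemma smooth_prodfun k (a b : X) (eta : R -> R) : smooth eta -> smooth (prodfun k a b eta).
Proof.
move=> seta; apply: smoothM.
  apply: (@smooth_prod _ _ d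
    (fun i (z : S) => plateau k (a ord0 i) (b ord0 i) (z.1 ord0 i))) => i.
  exact: (smooth_comp (smooth_plateau k (a ord0 i) (b ord0 i)) (smooth_coord i)).
exact: (smooth_comp seta smooth_time).
Qed.

Lemma prodfun_out k (a b : X) (eta : R -> R) (z : S) i : z.1 ord0 i \notin `]a ord0 i, b ord0 i[ ->
  prodfun k a b eta z = 0.
Proof. by move=> h; rewrite /prodfun (bigD1 i)//= plateau_out// !mul0r. Qed.

Lemma test_function_prodfun k (a b : X) (eta : R -> R) s t : smooth eta ->
  (forall r, r \notin `[s, t] -> eta r = 0) -> cbox a b s t `<=` Q ->
  test_function Q (prodfun k a b eta).
Proof.
move=> seta eta0 bQ; apply: (@test_function_support _ _ _ (cbox a b s t)) => //.
- exact: smooth_prodfun.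
- exact: compact_cbox.
move=> z n0; split.
  move=> i; apply: subset_itv_oo_cc; apply/negPn/negP => /(prodfun_out k eta) h.
  by rewrite h eqxx in n0.
by apply/negPn/negP => /eta0 h; move: n0; rewrite /prodfun h mulr0 eqxx.
Qed.

Lemma test_function_bump k (a b : X) s t : cbox a b s t `<=` Q ->
  test_function Q (prodfun k a b (plateau k s t)).
Proof.
apply: test_function_prodfun; first exact: smooth_plateau.
by move=> r h; apply: plateau_out; apply: contra h; exact: subset_itv_oo_cc.
Qed.

Let bump k (a b : X) s t := prodfun k a b (plateau k s t).

Let cvg_prodr n (f : nat -> 'I_n -> R) : (forall i, f k i @[k --> \oo] --> (1 : R)) ->
  \prod_i f k i @[k --> \oo] --> (1 : R).
Proof.
elim: n f => [|n IH] f h.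
  by under eq_fun do rewrite big_ord0; exact: cvg_cst.
under eq_fun do rewrite big_ord_recl.
have := cvgM (h ord0) (IH (fun k i => f k (lift ord0 i)) (fun i => h (lift ord0 i))).
rewrite mulr1; exact.
Qed.

Let bump_cvg (a b : X) s t (z : S) :
  bump k a b s t z @[k --> \oo] --> (\1_(box a b s t) z : R).
Proof.
have [zb|zb] := pselect (box a b s t z).
  rewrite indicE mem_set// -[X in _ --> X](mulr1 (1 : R)); case: zb => z1 z2.
  apply: cvgM; last exact: plateau_cvg.
  by apply: cvg_prodr => i; exact: plateau_cvg.
rewrite indicE memNset//=.
rewrite (_ : (fun k => _) = fun=> 0); first exact: cvg_cst.
apply/funext => k; apply/eqP/negPn/negP => n0; apply: zb; split.
  move=> i; apply/negPn/negP => /(prodfun_out k (plateau k s t)) h.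
  by rewrite /bump h eqxx in n0.
by apply/negPn/negP => h; move: n0; rewrite /bump /prodfun plateau_out// mulr0 eqxx.
Qed.

Let bump_le1 k (a b : X) s t (z : S) : `|bump k a b s t z| <= 1.
Proof.
rewrite /bump /prodfun normrM ger0_norm; last first.
  by apply: prodr_ge0 => i _; exact: plateau_ge0.
rewrite ger0_norm ?plateau_ge0// mulr_ile1 ?plateau_ge0 ?plateau_le1//.
  by apply: prodr_ge0 => i _; exact: plateau_ge0.
elim/big_rec: _ => // i x _ x1.
have := plateau_ge0 k (a ord0 i) (b ord0 i) (z.1 ord0 i).
have := plateau_le1 k (a ord0 i) (b ord0 i) (z.1 ord0 i).
move: (plateau _ _ _ _) => p p1 p0; apply: (@le_trans _ _ (p * 1)).
  by rewrite ler_wpM2l.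
rewrite mulr1; exact.
Qed.

Section induction.
Variable P : (S -> R) -> Prop.
Hypothesis Pbump : forall k a b s t, cbox a b s t `<=` Q ->
  P (prodfun k a b (plateau k s t)).
Hypothesis Plin : forall (a : R) w g, L2 w -> L2 g -> P w -> P g ->
  P (fun z => w z + a * g z).
Hypothesis Plim : forall (w_ : (S -> R)^nat) w, (forall n, L2 (w_ n)) ->
  (forall n, P (w_ n)) -> L2 w ->
  ip (fun z => w_ n z - w z) (fun z => w_ n z - w z) @[n --> \oo] --> (0 : R) ->
  P w.

Let L2_indic A : measurable A -> L2 (\1_A).
Proof.
move=> mA; apply: (@L2_bounded _ _ _ _ _ mQ _ 1 (cylinder_fin T oO bO)) => //.
by move=> z _; rewrite indicE ger0_norm ?ler0n// lern1 leq_b1.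
Qed.

Let Plim1 (w_ : (S -> R)^nat) w : (forall n, L2 (w_ n)) ->
  (forall n, P (w_ n)) -> (forall z, Q z -> w_ n z @[n --> \oo] --> w z) ->
  (forall n z, `|w_ n z| <= 1) -> P w.
Proof.
move=> Lw Pw ww w1.
have [|//|||Lww _ c] := @L2_dominated_cvg _ _ _ mu Q mQ w_ w (fun=> 1).
- by move=> n; exact: L2_meas (Lw n).
- exact: L2_cst mQ _ (cylinder_fin T oO bO).
- by move=> n x _; exact: w1.
- exact: (Plim Lw).
Qed.

Let P_ext w g : P w -> L2 w -> (forall z, Q z -> w z = g z) -> P g.
Proof.
move=> Pw Lw wg; have Lg : L2 g.
  have mg : measurable_fun Q g.
    by apply: eq_measurable_fun (L2_meas Lw) => z; rewrite inE => /wg.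
  by apply: (L2_dom mQ mg Lw) => z /wg ->.
apply: (Plim (fun _ : nat => Lw)) => //.
rewrite (_ : (fun n => _) = fun=> 0); first exact: cvg_cst.
apply/funext => n; rewrite -[RHS](ip0l mu mQ (fun=> 0)); apply: eq_ip => z /wg ->.
by rewrite subrr mul0r.
Qed.

Let indic_le1 (A : set S) z : `|\1_A z : R| <= 1.
Proof. by rewrite indicE ger0_norm ?ler0n// lern1 leq_b1. Qed.

Let P_box a b s t : cbox a b s t `<=` Q -> P (\1_(box a b s t)).
Proof.
move=> bQ; apply: (@Plim1 (fun k => bump k a b s t)).
- by move=> n; exact: (L2Q_test T oO bO (test_function_bump n bQ)).
- by move=> n; exact: Pbump.
- by move=> z _; exact: bump_cvg.
- by move=> n z; exact: bump_le1.
Qed.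

Let indic_cvg (F : (set S)^nat) z : nondecreasing_seq F ->
  (\1_(F n) z : R) @[n --> \oo] --> (\1_(\bigcup_n F n) z : R).
Proof.
move=> ndF; have [[n _ Fn]|nF] := pselect ((\bigcup_n F n) z).
  rewrite [X in _ --> X]indicE mem_set/=; last by exists n.
  apply: cvg_near_cst; exists n => // m /= nm; rewrite indicE mem_set//.
  by have /subsetPset := ndF _ _ nm; exact.
rewrite [X in _ --> X]indicE memNset//=.
rewrite (_ : (fun n => _) = fun=> 0); first exact: cvg_cst.
by apply/funext => n; rewrite indicE memNset// => Fn; apply: nF; exists n.
Qed.

Let P_indicI_box A a b s t : cbox a b s t `<=` Q -> measurable A ->
  P (\1_(A `&` box a b s t)).
Proof.
move=> bQ mA; set B := box a b s t.
have mB : measurable B by exact: measurable_box_ST.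
suff : <<s [set: S], box_system >> `<=` [set A | measurable A /\ P (\1_(A `&` B))].
  by move=> /(_ A (measurable_box_system mA))[].
apply: lambda_system_subset => //.
- exact: box_system_setI.
- split=> //.
  + by split=> //; rewrite setTI; exact: P_box.
  + move=> A1 A2 A21 [mA1 P1] [mA2 P2]; split; first exact: measurableD.
    have := Plin (-1) (L2_indic (measurableI _ _ mA1 mB)) (L2_indic (measurableI _ _ mA2 mB)) P1 P2.
    move=> /P_ext; apply; first by apply: L2D => //; [|apply: L2Z => //]; apply: L2_indic; exact: measurableI.
    move=> z _; rewrite !indicE (in_setI z A1) (in_setI z A2) (in_setI z (A1 `\` A2)) in_setD.
    have : (z \in A2) ==> (z \in A1) by apply/implyP => /set_mem/A21/mem_set.
    by case: (z \in A1); case: (z \in A2); case: (z \in B) => //= _; ring.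
  + move=> F ndF hF; split.
      by apply: bigcupT_measurable => n; case: (hF n).
    rewrite setI_bigcupl; apply: (@Plim1 (fun n => \1_(F n `&` B))).
    * by move=> n; apply/L2_indic/measurableI => //; case: (hF n).
    * by move=> n; case: (hF n).
    * move=> z _; apply: indic_cvg => n m nm; apply/subsetPset.
      by apply: setSI; apply/subsetPset; exact: ndF.
    * by move=> n z; exact: indic_le1.
- move=> _ [a' [b' [s' [t' ->]]]]; split; first exact: measurable_box_ST.
  rewrite /B box_setI; apply: P_box => z [h1 h2]; apply: bQ; split.
    move=> i; move: (h1 i); rewrite !mxE !in_itv /= ge_max le_min.
    by move=> /andP[/andP[_ ->] /andP[_ ->]].
  by move: h2; rewrite !in_itv /= ge_max le_min => /andP[/andP[_ ->] /andP[_ ->]].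
Qed.

Let P_indic A : measurable A -> P (\1_A).
Proof.
pose F (p : 'rV[rat]_d * 'rV[rat]_d * rat * rat) : set S :=
  let B f := f (map_mx ratr p.1.1.1) (map_mx ratr p.1.1.2) (ratr p.1.2) (ratr p.2) in
  if `[< B cbox `<=` Q >] then B box else set0.
pose G (n : nat) := if unpickle n is Some p then F p else set0.
have mG n : measurable (G n).
  rewrite /G; case: unpickle => // p; rewrite /F; case: ifP => // _.
  exact: measurable_box_ST.
have PG A' n : measurable A' -> P (\1_(A' `&` G n)).
  have P0 : P (\1_(set0 : set S)).
    have := @P_indicI_box set0 0 0 1 0.
    rewrite set0I; apply => // z [_]; rewrite /= in_itv /= => /andP[h1 h2].
    by have := le_trans h1 h2; rewrite ler10.
  move=> mA'; rewrite /G; case: unpickle => [p|]; last by rewrite setI0.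
  rewrite /F; case: asboolP; last by rewrite setI0.
  by move=> h; exact: P_indicI_box.
pose U n := \big[setU/set0]_(k < n) G k.
have mU n : measurable (U n) by apply: bigsetU_measurable.
have PU n A' : measurable A' -> P (\1_(A' `&` U n)).
  elim: n A' => [|n IH] A' mA'.
    rewrite /U big_ord0 setI0; have := PG set0 0%N measurable0.
    by rewrite set0I.
  have mD : measurable (A' `\` U n) by exact: measurableD.
  have := Plin 1 (L2_indic (measurableI _ _ mA' (mU n))) (L2_indic (measurableI _ _ mD (mG n)))
    (IH _ mA') (PG _ n mD).
  move=> /P_ext; apply.
    apply: L2D => //; first by apply/L2_indic/measurableI.
    by apply: L2Z => //; apply/L2_indic/measurableI.
  move=> z _; rewrite /U big_ord_recr /= -/(U n) !indicE (in_setI z A') (in_setI z (A' `\` U n)) in_setI in_setD in_setU.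
  by case: (z \in A'); case: (z \in U n); case: (z \in G n) => /=; ring.
have QU : Q `<=` \bigcup_n U n.
  move=> z /(open_rat_box (open_cylinder oO))[p [bz cQ]].
  exists (pickle p).+1 => //; rewrite /U big_ord_recr /=; right.
  by rewrite /G pickleK /F; case: asboolP.
move=> mA.
have PAU : P (\1_(\bigcup_n (A `&` U n))).
  apply: (@Plim1 (fun n => \1_(A `&` U n))).
  - by move=> n; apply/L2_indic/measurableI.
  - by move=> n; exact: PU.
  - move=> z _; apply: indic_cvg => n m nm; apply/subsetPset; apply: setIS.
    by apply: subset_bigsetU.
  - by move=> n z; exact: indic_le1.
apply: (P_ext PAU).
  by apply: L2_indic; apply: bigcupT_measurable => n; exact: measurableI.
move=> z Qz; rewrite -setI_bigcupr !indicE in_setI [z \in \bigcup_n _]mem_set ?andbT//.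
exact: QU.
Qed.

Import HBNNSimple.

Let P_nnsfun (h : {nnsfun S >-> R}) : P h /\ L2 h.
Proof.
have e : (h : S -> R) = fun z => \sum_(y <- finmap.enum_fset (fset_set (range h))) y * \1_(h @^-1` [set y]) z.
  by apply/funext => z; rewrite fimfunE fsbig_finite.
have mh y : measurable (h @^-1` [set y]) by exact: measurable_funPTI.
rewrite e; elim: (finmap.enum_fset (fset_set (range h))) => [|y s [IH1 IH2]].
  under eq_fun do rewrite big_nil.
  split; last exact: L2_0.
  apply: (P_ext (P_indic (measurable0))); first exact: L2_indic.
  by move=> z _; rewrite indicE in_set0.
under eq_fun do rewrite big_cons addrC.
split; first by apply: Plin => //; [exact: L2_indic|exact: P_indic].
by apply: L2D => //; apply: L2Z => //; exact: L2_indic.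
Qed.

Let P_ge0 w : L2 w -> (forall z, 0 <= w z) -> P w.
Proof.
move=> Lw w0.
have mw : measurable_fun setT (EFin \o (w \_ Q)).
  by apply/measurable_EFinP; apply/(measurable_restrictT _ mQ); exact: L2_meas Lw.
pose h := nnsfun_approx measurableT mw.
have wQ0 z : (0 <= (EFin \o (w \_ Q)) z)%E.
  by rewrite /= lee_fin patchE; case: ifP.
have hc z : Q z -> h n z @[n --> \oo] --> w z.
  move=> Qz; have := @cvg_nnsfun_approx _ _ _ _ measurableT _ mw (fun x _ => wQ0 x) z I.
  rewrite /= patchE mem_set// => /fine_cvgP[_].
  exact.
have hw n z : Q z -> `|h n z| <= w z.
  move=> Qz; rewrite ger0_norm//.
  have nd : nondecreasing_seq (h ^~ z).
    by move=> p q pq; have /lefP := nd_nnsfun_approx measurableT mw pq; exact.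
  have := nondecreasing_cvgn_le nd (cvgP _ (hc z Qz)) n.
  by rewrite (cvg_lim (@Rhausdorff R) (hc z Qz)).
have [|//|//|//|_ Lh c] := @L2_dominated_cvg _ _ _ mu Q mQ h w w.
  by move=> n; apply: measurable_funTS; exact: measurable_funP.
by apply: (Plim Lh) => // n; have [] := P_nnsfun (h n).
Qed.

(** From bumps one gets indicators of boxes by monotone limits, then indicators of
    all measurable sets by Dynkin's theorem inside a box and by exhausting Q with
    rational boxes, then simple functions, nonnegative functions and differences. *)
Lemma L2_bump_ind w : L2 w -> P w.
Proof.
move=> Lw.
have La : L2 (fun z => `|w z|).
  apply: (L2_dom mQ _ Lw) => [|z _]; last by rewrite normr_id.
  by apply: measurableT_comp => //; exact: L2_meas Lw.
have Lp : L2 (fun z => `|w z| + w z) by exact: L2D.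
have Ln : L2 (fun z => `|w z| - w z) by exact: L2B.
have p0 z : 0 <= `|w z| + w z by rewrite -lerBlDr sub0r -normrN ler_norm.
have n0 z : 0 <= `|w z| - w z by rewrite subr_ge0 ler_norm.
have L0 : L2 (fun=> 0) by exact: L2_0.
have := Plin (-1) Lp Ln (P_ge0 Lp p0) (P_ge0 Ln n0) => P2.
have := Plin 2^-1 L0 _ (P_ge0 L0 (fun=> lexx _)) P2.
have L2w : L2 (fun z => (`|w z| + w z) + -1 * (`|w z| - w z)).
  by apply: L2D => //; exact: L2Z.
move=> /(_ L2w)/P_ext; apply; first by apply: L2D => //; exact: L2Z.
by move=> z _; field.
Qed.

End induction.

End density.

(** * Weak derivatives *)

Section weak_derivatives.
Context {R : realType} {d : nat}.
Local Notation X := 'rV[R]_d.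
Local Notation S := (X * measurableTypeR R)%type.
Variables (Omega : set X) (T : R).
Hypotheses (oO : open Omega) (bO : bounded_set Omega).
Local Notation mu := (@lebesgue_ST R d).
Local Notation Q := (cylinder Omega T).
Local Notation ip := (ip mu Q).
Local Notation L2 := (L2 mu Q).
Local Notation is_weak_partial := (is_weak_partial Omega T).
Local Notation weak_partial := (weak_partial Omega T).
Local Notation is_weak_div := (is_weak_div Omega T).
Let mQ : measurable Q := measurable_cylinder T oO.
Implicit Types (w g : S -> R).

(** The fundamental lemma of the calculus of variations: the functions orthogonal
    to w form a class to which [L2_bump_ind] applies, so it contains w. *)
Lemma L2_orth_bump w : L2 w ->
  (forall k a b s t, cbox a b s t `<=` Q ->
    ip w (prodfun k a b (plateau k s t)) = 0) ->
  {ae mu, forall z, Q z -> w z = 0}.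
Proof.
move=> Lw w0; apply: (ip_eq0 mQ Lw).
pose P g := ip g w = 0.
apply: (@L2_bump_ind _ _ _ _ oO bO P _ _ _ w Lw) => [k a b s t bQ|a g g' Lg Lg'|w_ g Lw_ Pw Lg c].
- by rewrite /P ipC w0.
- rewrite /P => Pg Pg'; rewrite (ipDl mQ Lg (L2Z mQ a Lg') Lw) (ipZl mQ)//.
  by rewrite Pg Pg' mulr0 addr0.
- have := ip_cvgl mQ Lw_ Lg Lw c.
  rewrite (_ : (fun n => _) = fun=> 0); last exact/funext.
  by move=> /(cvg_unique (@Rhausdorff R) (cvg_cst 0)).
Qed.

Lemma L2_orth_test w g : L2 w -> L2 g ->
  (forall phi, test_function Q phi -> ip w phi = ip g phi) ->
  {ae mu, forall z, Q z -> w z = g z}.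
Proof.
move=> Lw Lg h.
have : {ae mu, forall z, Q z -> w z - g z = 0}.
  apply: L2_orth_bump; first exact: L2B.
  move=> k a b s t bQ.
  have tb := test_function_bump k bQ.
  by rewrite ipBl// ?h ?subrr//; exact: (L2Q_test T oO bO tb).
by apply: filterS => z zz /zz /eqP; rewrite subr_eq0 => /eqP.
Qed.

Lemma weak_partial_unique a w g g' :
  is_weak_partial a w g -> is_weak_partial a w g' ->
  {ae mu, forall z, Q z -> g z = g' z}.
Proof.
move=> [Lg h] [Lg' h']; apply: L2_orth_test => // phi tphi.
by apply: oppr_inj; rewrite -[LHS](h phi tphi) -[RHS](h' phi tphi).
Qed.

Lemma weak_partialP a w : has_weak_partial Omega T a w ->
  is_weak_partial a w (weak_partial a w).
Proof. by move=> h; exact: (@xgetPex _ (fun=> 0) (is_weak_partial a w) h). Qed.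

Lemma weak_partialB a w w' g g' : L2 w -> L2 w' ->
  is_weak_partial a w g -> is_weak_partial a w' g' ->
  is_weak_partial a (fun z => w z - w' z) (fun z => g z - g' z).
Proof.
move=> Lw Lw' [Lg h] [Lg' h']; split; first exact: L2B.
move=> phi tphi.
have Lphi := L2Q_test T oO bO tphi.
have Ld := L2Q_test T oO bO (test_function_derive a tphi).
rewrite [LHS](ipBl mQ Lw Lw' Ld).
apply: etrans (congr1 -%R (esym (ipBl mQ Lg Lg' Lphi))).
have e1 : ip w ('D_a phi) = - ip g phi := h phi tphi.
have e2 : ip w' ('D_a phi) = - ip g' phi := h' phi tphi.
by rewrite e1 e2 opprB opprK addrC.
Qed.

Lemma div_xP (y : S -> X) : has_div_x Omega T y ->
  is_weak_div y (div_x Omega T y).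
Proof. by move=> h; exact: (@xgetPex _ (fun=> 0) (is_weak_div y) h). Qed.

Lemma weak_div_pairing (y : S -> X) phi : L2vec mu Q y -> test_function Q phi ->
  \int[mu]_(z in Q) (\sum_i y z ord0 i * 'D_(dir_x i) phi z) =
  \sum_i ip (fun z => y z ord0 i) ('D_(dir_x i) phi).
Proof.
move=> Ly tphi.
have Ld i := L2Q_test T oO bO (test_function_derive (@dir_x R d i) tphi).
have iM i := L2M_integrable mQ (Ly i) (Ld i).
rewrite /Rintegral; under [in LHS]eq_integral do rewrite -sumEFin.
by rewrite integral_sum// -sum_fine// => i _; exact: integrable_fin_num.
Qed.

Lemma weak_divE (y : S -> X) g phi : L2vec mu Q y -> is_weak_div y g ->
  test_function Q phi ->
  \sum_i ip (fun z => y z ord0 i) ('D_(dir_x i) phi) = - ip g phi.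
Proof. by move=> Ly [Lg h] tphi; rewrite -weak_div_pairing//; exact: h. Qed.

(** Mixed weak derivatives commute, because those of test functions do. *)
Lemma weak_partial_comm a b w g h k : 
  is_weak_partial a w g -> is_weak_partial b w h -> is_weak_partial a h k ->
  is_weak_partial b g k.
Proof.
move=> [Lg wg] [Lh wh] [Lk hk]; split; first exact: Lk.
move=> phi tphi; have [sphi _ _] := tphi.
have e1 : ip w ('D_a ('D_b phi)) = - ip g ('D_b phi) :=
  wg _ (test_function_derive b tphi).
have e2 : ip w ('D_b ('D_a phi)) = - ip h ('D_a phi) :=
  wh _ (test_function_derive a tphi).
have e3 : ip h ('D_a phi) = - ip k phi := hk _ tphi.
suff : ip g ('D_b phi) = - ip k phi by [].
rewrite -e3; apply: oppr_inj.
exact: etrans (esym e1) (etrans (congr1 (ip w) (derive_comm a b sphi)) e2).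
Qed.

End weak_derivatives.

(** * Fubini's theorem on a product of two sets *)

Lemma ae_eq_integrable d (T : measurableType d) (R : realType)
    (mu : {measure set T -> \bar R}) (D : set T) (f g : T -> \bar R) :
  measurable D -> measurable_fun D g -> ae_eq mu D f g ->
  mu.-integrable D f -> mu.-integrable D g.
Proof.
move=> mD mg fg /integrableP[mf foo]; apply/integrableP; split => //.
rewrite (ae_eq_integral (fun x => `|f x|)%E)//.
- exact: measurableT_comp.
- exact: measurableT_comp.
- by apply: filterS fg => x h Dx; rewrite h.
Qed.

(* The general theorems are stated on the whole product space; extending the
   integrand by zero outside A x B gives the versions used for the cylinder. *)
Section slices.
Context {d1 d2 : measure_display} {T1 : measurableType d1} {T2 : measurableType d2}
  {R : realType}.
Variables (m1 : {sigma_finite_measure set T1 -> \bar R})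
          (m2 : {sigma_finite_measure set T2 -> \bar R}).
Variables (A : set T1) (B : set T2).
Hypotheses (mA : measurable A) (mB : measurable B).
Let mAB : measurable (A `*` B) := measurableX mA mB.
Implicit Types (f : T1 * T2 -> R) (F : T1 * T2 -> \bar R).

Let patchX F x : fubini_F m2 (F \_ (A `*` B)) x =
  ((fun x => \int[m2]_(y in B) F (x, y))%E \_ A) x.
Proof.
rewrite patchE /fubini_F; case: ifPn => xA.
  rewrite [RHS]integral_mkcond; apply: eq_integral => y _.
  by rewrite !patchE in_setX /= xA.
by apply: integral0_eq => y _; rewrite patchE in_setX /= (negbTE xA).
Qed.

Let patchY F y : fubini_G m1 (F \_ (A `*` B)) y =
  ((fun y => \int[m1]_(x in A) F (x, y))%E \_ B) y.
Proof.
rewrite patchE /fubini_G; case: ifPn => yB.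
  rewrite [RHS]integral_mkcond; apply: eq_integral => x _.
  by rewrite !patchE in_setX /= yB andbT.
by apply: integral0_eq => x _; rewrite patchE in_setX /= (negbTE yB) andbF.
Qed.

Section nonnegative.
Variable F : T1 * T2 -> \bar R.
Hypotheses (mF : measurable_fun (A `*` B) F) (F0 : forall z, (0 <= F z)%E).
Let mF' : measurable_fun setT (F \_ (A `*` B)).
Proof. by apply/(measurable_restrictT _ mAB). Qed.
Let F0' z : (0 <= (F \_ (A `*` B)) z)%E.
Proof. by rewrite patchE; case: ifP. Qed.

Lemma tonelli_measurable : measurable_fun A (fun x => \int[m2]_(y in B) F (x, y))%E.
Proof.
apply/(measurable_restrictT _ mA).
have := measurable_fun_fubini_tonelli_F (m2 := m2) _ mF' F0'.
have e : fubini_F m2 (F \_ (A `*` B)) = (fun x => \int[m2]_(y in B) F (x, y))%E \_ A.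
  by apply/funext => x; exact: patchX.
by rewrite e.
Qed.

Lemma tonelli_setX : (\int[m1 \x m2]_(z in A `*` B) F z =
  \int[m1]_(x in A) \int[m2]_(y in B) F (x, y))%E.
Proof.
rewrite integral_mkcond (fubini_tonelli1 _ mF' F0') [RHS]integral_mkcond.
by apply: eq_integral => x _; exact: patchX.
Qed.

Lemma tonelli_setX2 : (\int[m1 \x m2]_(z in A `*` B) F z =
  \int[m2]_(y in B) \int[m1]_(x in A) F (x, y))%E.
Proof.
rewrite integral_mkcond (fubini_tonelli2 _ mF' F0') [RHS]integral_mkcond.
by apply: eq_integral => x _; exact: patchY.
Qed.

End nonnegative.

Section integrable.
Variable f : T1 * T2 -> R.
Hypothesis If : (m1 \x m2)%E.-integrable (A `*` B) (EFin \o f).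
Let If' : (m1 \x m2)%E.-integrable setT ((EFin \o f) \_ (A `*` B)).
Proof. by apply/(integrable_mkcond _ mAB). Qed.

Lemma fubini_ae_integrable :
  {ae m1, forall x, A x -> m2.-integrable B (fun y => (f (x, y))%:E)}.
Proof.
have := ae_integrable1 If'; apply: filterS => x + Ax.
move=> I; apply/(integrable_mkcond _ mB).
apply: eq_integrable I => // y _.
by rewrite !patchE in_setX /= [x \in A]mem_set.
Qed.

Let iF : m1.-integrable A (fun x => \int[m2]_(y in B) (f (x, y))%:E)%E.
Proof.
apply/(integrable_mkcond _ mA).
have := integrable_fubini_F If'.
by apply: eq_integrable => // x _; exact: patchX.
Qed.

Let mI : measurable_fun A (fun x => (\int[m2]_(y in B) f (x, y))%:E).
Proof.
have [+ _] := integrableP _ _ _ iF => h.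
by apply/measurable_EFinP; apply: measurableT_comp h.
Qed.

Let eI : ae_eq m1 A (fun x => (\int[m2]_(y in B) (f (x, y))%:E)%E)
                  (fun x => (\int[m2]_(y in B) f (x, y))%:E).
Proof.
have := fubini_ae_integrable; apply: filterS => x h Ax; rewrite fineK//.
by apply: integrable_fin_num => //; exact: h.
Qed.

Lemma fubini_integrable :
  m1.-integrable A (fun x => (\int[m2]_(y in B) f (x, y))%:E).
Proof. exact: (ae_eq_integrable mA mI eI iF). Qed.

Lemma fubini_setX : \int[(m1 \x m2)%E]_(z in A `*` B) f z =
  \int[m1]_(x in A) \int[m2]_(y in B) f (x, y).
Proof.
congr fine; rewrite integral_mkcond -(integral12_prod_meas1 If').
rewrite -[RHS](ae_eq_integral _ _ mA _ mI eI); last by case/integrableP: iF.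
rewrite [RHS]integral_mkcond.
by apply: eq_integral => x _; exact: patchX.
Qed.

Let mG : measurable_fun B (fun y => \int[m1]_(x in A) (f (x, y))%:E)%E.
Proof.
apply/(measurable_restrictT _ mB).
have := measurable_fubini_G If'.
have -> // : fubini_G m1 ((EFin \o f) \_ (A `*` B)) =
  (fun y => \int[m1]_(x in A) (f (x, y))%:E)%E \_ B.
by apply/funext => y; exact: patchY.
Qed.

Let eJ : ae_eq m2 B (fun y => (\int[m1]_(x in A) (f (x, y))%:E)%E)
                  (fun y => (\int[m1]_(x in A) f (x, y))%:E).
Proof.
have := ae_integrable2 If'; apply: filterS => y I By; rewrite fineK//.
apply: integrable_fin_num => //; apply/(integrable_mkcond _ mA).
apply: eq_integrable I => // x _.
by rewrite !patchE in_setX /= [y \in B]mem_set// andbT.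
Qed.

Lemma fubini_integrable2 : (forall z, 0 <= f z) ->
  m2.-integrable B (fun y => (\int[m1]_(x in A) f (x, y))%:E).
Proof.
move=> f0; have mJ : measurable_fun B (fun y => (\int[m1]_(x in A) f (x, y))%:E).
  by apply/measurable_EFinP; apply: measurableT_comp mG.
apply: (ae_eq_integrable mB mJ eJ); apply/integrableP; split; first exact: mG.
have [mf foo] := integrableP _ _ _ If.
rewrite (eq_integral (fun y => \int[m1]_(x in A) (f (x, y))%:E)%E); last first.
  by move=> y _; rewrite gee0_abs// integral_ge0// => x _; rewrite lee_fin.
rewrite -(tonelli_setX2 mf); last by move=> z; rewrite lee_fin.
by move: foo; under eq_integral do rewrite /= ger0_norm//.
Qed.

Lemma fubini_setX2 : \int[(m1 \x m2)%E]_(z in A `*` B) f z =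
  \int[m2]_(y in B) \int[m1]_(x in A) f (x, y).
Proof.
have mJ : measurable_fun B (fun y => (\int[m1]_(x in A) f (x, y))%:E).
  by apply/measurable_EFinP; apply: measurableT_comp mG.
congr fine; rewrite integral_mkcond -(integral21_prod_meas1 If').
rewrite -[RHS](ae_eq_integral _ _ mB mG mJ eJ).
rewrite [RHS]integral_mkcond.
by apply: eq_integral => x _; exact: patchY.
Qed.

End integrable.

Lemma measurable_Rintegral (k : T1 * T2 -> R) : measurable_fun (A `*` B) k ->
  measurable_fun A (fun x => \int[m2]_(y in B) k (x, y)).
Proof.
move=> mk; apply: (measurableT_comp (f := fine)) => //.
have mk' : measurable_fun (A `*` B) (EFin \o k) by exact/measurable_EFinP.
have mp := tonelli_measurable (measurable_funepos mk') (fun z => funepos_ge0 _ z).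
have mn := tonelli_measurable (measurable_funeneg mk') (fun z => funeneg_ge0 _ z).
apply: eq_measurable_fun (emeasurable_funB mp mn) => x _.
by rewrite [RHS]integralE; congr (_ - _)%E; apply: eq_integral => y _; rewrite ?funeposE ?funenegE.
Qed.

Lemma L2_snd (phi : T2 -> R) : (m1 A < +oo)%E -> L2 m2 B phi ->
  L2 (m1 \x m2)%E (A `*` B) (phi \o snd).
Proof.
move=> A1 [mphi phi2].
have mp : measurable_fun (A `*` B) (phi \o snd).
  apply: (measurable_comp mB) mphi _; first by move=> _ [z [_ Bz] <-].
  exact: measurable_funTS.
split=> //; rewrite (@tonelli_setX (fun z => (phi z.2 ^+ 2)%:E)).
- rewrite /= integral_cst// lte_mul_pinfty//.
    by apply: integral_ge0 => y _; rewrite lee_fin sqr_ge0.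
  by rewrite ge0_fin_numE// integral_ge0// => y _; rewrite lee_fin sqr_ge0.
- by apply/measurable_EFinP; exact: measurable_funX.
- by move=> z; rewrite lee_fin sqr_ge0.
Qed.

Lemma L2_fst (phi : T1 -> R) : (m2 B < +oo)%E -> L2 m1 A phi ->
  L2 (m1 \x m2)%E (A `*` B) (phi \o fst).
Proof.
move=> B1 [mphi phi2].
have mp : measurable_fun (A `*` B) (phi \o fst).
  apply: (measurable_comp mA) mphi _; first by move=> _ [z [Az _] <-].
  exact: measurable_funTS.
split=> //; rewrite (@tonelli_setX2 (fun z => (phi z.1 ^+ 2)%:E)).
- rewrite /= integral_cst// lte_mul_pinfty//.
    by apply: integral_ge0 => y _; rewrite lee_fin sqr_ge0.
  by rewrite ge0_fin_numE// integral_ge0// => y _; rewrite lee_fin sqr_ge0.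
- by apply/measurable_EFinP; exact: measurable_funX.
- by move=> z; rewrite lee_fin sqr_ge0.
Qed.

Lemma ae_slice (P : T1 * T2 -> Prop) :
  {ae (m1 \x m2)%E, forall z, (A `*` B) z -> P z} ->
  {ae m2, forall y, B y -> {ae m1, forall x, A x -> P (x, y)}}.
Proof.
move=> [N [mN N0 PN]].
have my : measurable_fun setT (m1 \o ysection N) by exact: measurable_fun_ysection.
have : (\int[m2]_y `|(m1 \o ysection N) y| = 0)%E.
  have e := @product_measure_unique _ _ _ _ _ m1 m2
    (m1 \x^ m2)%E (fun A B mA mB => product_measure2E m1 m2 mA mB) N mN.
  rewrite -[RHS]N0 e /product_measure2; apply: eq_integral => y _.
  by rewrite gee0_abs.
move=> /(ae_eq_integral_abs m2 measurableT my); apply: filterS => y /(_ I) /= h By.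
exists (ysection N y); split => //; first exact: measurable_ysection.
move=> x /= nP; rewrite /ysection /= inE; apply: PN => /= h'.
by apply: nP => Ax; exact: h'.
Qed.

End slices.

(** * Functions of one real variable *)

Section L2_subset.
Context {dT : measure_display} {T : measurableType dT} {R : realType}.
Variables (m : {measure set T -> \bar R}) (D E : set T).
Hypotheses (mD : measurable D) (mE : measurable E) (ED : E `<=` D).

Lemma L2S w : L2 m D w -> L2 m E w.
Proof.
move=> Lw; apply: L2P; first exact: measurable_funS mD ED (L2_meas Lw).
exact: (integrableS mD mE ED (L2_sqr_integrable Lw)).
Qed.

Lemma ipS_le w : L2 m D w -> ip m E w w <= ip m D w w.
Proof.
move=> Lw; have Le := L2S Lw.
have I := L2M_integrable mD Lw Lw; have J := L2M_integrable mE Le Le.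
rewrite -lee_fin fineK ?integrable_fin_num// fineK ?integrable_fin_num//.
apply: ge0_subset_integral => //; first by case/integrableP: I.
by move=> x _; rewrite lee_fin -expr2 sqr_ge0.
Qed.

End L2_subset.

Section one_dimensional.
Context {R : realType}.
Local Notation leb := (@lebesgue_measure R).
Implicit Types (f phi eta : R -> R) (s t T : R).

Lemma itv_lebesgue_fin s t : (leb `]s, t[%classic < +oo)%E.
Proof. by rewrite lebesgue_measure_itv /=; case: ifP => _; rewrite ?ltry// -EFinB ltry. Qed.

Lemma fine_lebesgue_itvoo s t : s <= t -> fine (leb `]s, t[%classic) = t - s.
Proof.
rewrite le_eqVlt lebesgue_measure_itv /= lte_fin => /predU1P[->|->//].
by rewrite ltxx subrr.
Qed.

(** When the mean of f vanishes, the primitive has compact support as well. *)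
Lemma compact_support_primitive f s t : smooth f ->
  (forall r, r \notin `[s, t] -> f r = 0) ->
  exists F : R -> R, [/\ smooth F, forall x : R, is_derive x 1 F (f x),
    forall x, x < s -> F x = 0 &
    forall x, t < x -> F x = \int[leb]_(r in `[s, t]) f r].
Proof.
move=> sf f0.
have e : EFin \o f = (EFin \o f) \_ `[s, t].
  apply/funext => x; rewrite patchE; case: ifPn => // /negP h.
  by rewrite /= f0//; apply/negP => h'; apply: h; rewrite inE.
have If : leb.-integrable setT (EFin \o f).
  have mst : measurable (`[s, t]%classic : set (measurableTypeR R)).
    exact: measurable_itv.
  have J : leb.-integrable `[s, t] (EFin \o f).
    apply: continuous_compact_integrable; first exact: segment_compact.
    by apply: continuous_subspaceT => x; exact: smooth_continuous.
  have := (@integrable_mkcond _ (measurableTypeR R) R leb _ (EFin \o f) mst).1 J.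
  by rewrite -e.
pose F x := \int[leb]_(r in `]-oo, x]) f r.
have dF (x : R) : is_derive x 1 F (f x).
  have [|||h1 h2] := @continuous_FTC1 R f -oo%O x (x + 1) (ltr_pwDr ltr01 (lexx x)).
  - by apply: integrableS If.
  - by rewrite ltNyr.
  - exact: smooth_continuous.
  by split; [exact: h1|rewrite -derive1E; exact: h2].
exists F; split; [exact: smooth_primitive sf dF|exact: dF| |].
- move=> x xs; rewrite /F (@eq_Rintegral _ _ _ _ _ (cst 0)).
    by rewrite Rintegral_cst// mul0r.
  move=> r; rewrite inE /= in_itv /= => rx; apply: f0.
  by rewrite in_itv /= negb_and -ltNge (le_lt_trans rx xs).
- move=> x tx; rewrite /F Rintegral_mkcond [RHS]Rintegral_mkcond.
  apply: eq_Rintegral => r _; rewrite !patchE.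
  have [rst|rst] := boolP (r \in `[s, t]).
    rewrite [r \in [set` `[s, t]]]mem_set//= ifT// inE /= in_itv /=.
    by move: rst; rewrite in_itv /= => /andP[_ rt]; rewrite (le_trans rt (ltW tx)).
  by rewrite (f0 _ rst) !if_same.
Qed.

Lemma Rintegral_sqr_le phi s t : s <= t -> L2 leb `]s, t[ phi ->
  (\int[leb]_(r in `]s, t[) phi r) ^+ 2 <= (t - s) * ip leb `]s, t[ phi phi.
Proof.
move=> st Lphi; have mI : measurable (`]s, t[%classic : set (measurableTypeR R)).
  exact: measurable_itv.
have L1 : L2 leb `]s, t[ (fun=> 1).
  exact: (L2_cst mI 1 (itv_lebesgue_fin s t)).
have := ip_CS mI Lphi L1.
have -> : ip leb `]s, t[ phi (fun=> 1) = \int[leb]_(r in `]s, t[) phi r.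
  by apply: eq_Rintegral => x _; rewrite mulr1.
have -> : ip leb `]s, t[ (fun=> 1) (fun=> 1) = t - s.
  by rewrite /ip mulr1 Rintegral_cst// mul1r; exact: fine_lebesgue_itvoo.
by rewrite mulrC.
Qed.

Lemma FTC_itvoo eta s t : smooth eta -> s < t ->
  \int[leb]_(r in `]s, t[) 'D_1 eta r = eta t - eta s.
Proof.
move=> seta st.
have cD : continuous ('D_(1 : R) eta) := smooth_continuous (smooth_derive (1 : R) seta).
have I : leb.-integrable `[s, t] (EFin \o ('D_(1 : R) eta)).
  apply: continuous_compact_integrable; first exact: segment_compact.
  by apply: continuous_subspaceT => x; exact: cD.
rewrite Rintegral_itv_bndo_bndc; last first.
  by apply: integrableS I => // x; rewrite /= !in_itv /= => /andP[/ltW -> /ltW ->].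
rewrite Rintegral_itv_obnd_cbnd; last first.
  by apply: integrableS I => // x; rewrite /= !in_itv /= => /andP[/ltW -> ->].
rewrite /Rintegral (@continuous_FTC2 R ('D_(1 : R) eta) eta s t st)//.
- by apply: continuous_subspaceT => x; exact: cD.
- split.
  + by move=> x _; have [] := smooth_is_derive x 1 seta.
  + by apply: cvg_at_right_filter; exact: smooth_continuous.
  + by apply: cvg_at_left_filter; exact: smooth_continuous.
- by move=> x _; rewrite derive1E.
Qed.

Lemma L2_compact_continuous f s t : continuous f -> L2 leb `]s, t[ f.
Proof.
move=> cf; apply: L2P.
  by apply: measurable_funTS; exact: continuous_measurable_fun.
have mI : measurable (`[s, t]%classic : set (measurableTypeR R)).
  exact: measurable_itv.
have : leb.-integrable `[s, t] (EFin \o (fun x => f x ^+ 2)).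
  apply: continuous_compact_integrable; first exact: segment_compact.
  apply: continuous_subspaceT => x; exact: (continuousM (cf x) (cf x)).
move=> h; apply: (integrableS mI _ _ h) => [|x]; first exact: measurable_itv.
exact: subset_itv_oo_cc.
Qed.

Local Notation TR := (measurableTypeR R).

Definition triangle : set (TR * TR) := [set z | (z.2 : R) < z.1].

Lemma measurable_triangle : measurable triangle.
Proof.
have m : measurable_fun setT (fun z : TR * TR => (z.1 : R) - z.2).
  by apply: measurable_funB; [exact: measurable_fst|exact: measurable_snd].
have := m measurableT _ (measurable_itv `]0, +oo[); rewrite setTI.
congr measurable; apply/seteqP; split => z /=;
  by rewrite in_itv /= andbT subr_gt0.
Qed.

(** By Fubini on the triangle s < t. *)
Lemma primitive_by_parts phi eta T M : smooth eta -> eta T = 0 ->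
  (forall t, `|'D_1 eta t| <= M) -> L2 leb `]0, T[ phi ->
  \int[leb]_(t in `]0, T[) ((\int[leb]_(s in `]0, t[) phi s) * 'D_1 eta t) =
  - \int[leb]_(t in `]0, T[) (phi t * eta t).
Proof.
move=> seta etaT Mb Lphi; set I := [set` _].
have mI : measurable (I : set (measurableTypeR R)) by exact: measurable_itv.
have Ioo : (leb I < +oo)%E by exact: itv_lebesgue_fin.
have mII : measurable (I `*` I : set (TR * TR)) by exact: measurableX.
pose k (z : TR * TR) : R := \1_triangle z * 'D_1 eta z.1.
have mk : measurable_fun setT k.
  apply: measurable_funM; first by apply: measurable_indic; exact: measurable_triangle.
  apply: (measurableT_comp (f := 'D_(1 : R) eta : TR -> R) (g := fst)); last exact: measurable_fst.
  exact: continuous_measurable_fun (smooth_continuous (smooth_derive (1 : R) seta)).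
have IIoo : ((leb \x leb) (I `*` I) < +oo)%E.
  by rewrite product_measure1E// lte_mul_pinfty// ge0_fin_numE.
have Lk : L2 (leb \x leb)%E (I `*` I) k.
  have := (@L2_bounded _ _ _ _ _ mII k M IIoo); apply; first exact: measurable_funTS.
  move=> z _; rewrite /k indicE; case: (_ \in _); rewrite ?mul1r ?mul0r ?normr0//.
  exact: le_trans (Mb 0).
have LP : L2 (leb \x leb)%E (I `*` I) (phi \o snd) by exact: L2_snd.
have H := L2M_integrable mII LP Lk.
have mem_lt s t : ((t, s) \in triangle) = (s \in `]-oo, t[%classic).
  by apply/idP/idP => /set_mem h; apply/mem_set; move: h; rewrite /triangle /= in_itv.
have mem_lt' s t : ((t, s) \in triangle) = (t \in `]s, +oo[%classic).
  by apply/idP/idP => /set_mem h; apply/mem_set; move: h;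
    rewrite /triangle /= in_itv /= andbT.
have Leta : L2 leb I eta.
  apply: (L2_compact_continuous); exact: smooth_continuous.
have Ldeta : L2 leb I ('D_(1 : R) eta).
  by apply: L2_compact_continuous; exact: smooth_continuous (smooth_derive (1 : R) seta).
have Iphi : leb.-integrable I (EFin \o phi).
  have := L2M_integrable mI Lphi (L2_cst mI 1 Ioo).
  by apply: eq_integrable => // x _; rewrite mulr1.
have Ieta : leb.-integrable I (EFin \o 'D_(1 : R) eta).
  have := L2M_integrable mI Ldeta (L2_cst mI 1 Ioo).
  by apply: eq_integrable => // x _; rewrite mulr1.
have itv t : I t -> I `&` `]-oo, t[ = `]0, t[%classic.
  rewrite /I /= in_itv /= => /andP[t0 tT]; apply/seteqP; split => x /=.
    by rewrite !in_itv /= => -[/andP[-> _] ->].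
  by rewrite !in_itv /= => /andP[-> xt]; rewrite xt (lt_trans xt tT).
transitivity (\int[leb]_(t in I) \int[leb]_(s in I) (phi s * k (t, s))).
  apply: eq_Rintegral => t /set_mem It; symmetry.
  rewrite -(itv _ It) -RintegralZr; last 2 first.
  - by apply: measurableI.
  - by apply: (integrableS mI) (Iphi) => //; exact: measurableI.
  rewrite Rintegral_mkcondr; apply: eq_Rintegral => s _.
  by rewrite /k indicE patchE mem_lt; case: (_ \in _); rewrite ?mul1r// !mul0r mulr0.
apply: (etrans (etrans (esym (fubini_setX mI mI H)) (fubini_setX2 mI mI H))).
rewrite -mulN1r -RintegralZl//; last by apply: L2M_integrable => //; exact: Leta.
apply: eq_Rintegral => s /set_mem Is; rewrite mulN1r -mulrN.
have [s0 sT] : 0 < s /\ s < T by move: Is; rewrite /I /= in_itv /= => /andP[].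
have -> : - eta s = \int[leb]_(t in `]s, T[) 'D_1 eta t.
  by rewrite FTC_itvoo// etaT sub0r.
have -> : `]s, T[%classic = I `&` `]s, +oo[.
  rewrite /I; apply/seteqP; split => x /=; rewrite !in_itv /= ?andbT.
    by move=> /andP[sx ->]; rewrite sx (lt_trans s0 sx).
  by move=> [/andP[_ ->] ->].
have mIs : measurable (I `&` `]s, +oo[ : set TR) by apply: measurableI.
rewrite -RintegralZl//; last by apply: (integrableS mI) (Ieta) => //; exact: subIsetl.
rewrite [RHS]Rintegral_mkcondr; apply: eq_Rintegral => t _.
by rewrite /k indicE patchE mem_lt'; case: (_ \in _); rewrite ?mul1r// !mul0r mulr0.
Qed.

End one_dimensional.

(** * Primitives in time *)

Section ae_domination.
Context {dT : measure_display} {T : measurableType dT} {R : realType}.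
Variables (m : {measure set T -> \bar R}) (D : set T).
Hypothesis mD : measurable D.

Lemma L2_ae_dom (w g : T -> R) : measurable_fun D w -> L2 m D g ->
  {ae m, forall x, D x -> `|w x| <= `|g x|} -> L2 m D w.
Proof.
move=> mw Lg wg; have [mg goo] := Lg; split=> //; apply: le_lt_trans goo.
apply: ae_ge0_le_integral => //.
- by move=> x _; rewrite lee_fin sqr_ge0.
- by apply/measurable_EFinP; exact: measurable_funX.
- by move=> x _; rewrite lee_fin sqr_ge0.
- by apply/measurable_EFinP; exact: measurable_funX.
apply: filterS wg => x wg Dx; rewrite lee_fin.
rewrite -(real_normK (num_real (w x))) -(real_normK (num_real (g x))).
by rewrite lerXn2r ?nnegrE ?wg.
Qed.

End ae_domination.

Section time_primitive.
Context {R : realType} {d : nat}.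
Local Notation X := 'rV[R]_d.
Local Notation TR := (measurableTypeR R).
Local Notation S := (X * measurableTypeR R)%type.
Variables (Omega : set X) (T : R).
Hypotheses (oO : open Omega) (bO : bounded_set Omega).
Local Notation mu := (@lebesgue_ST R d).
Local Notation nu := (lebesgue_rV R d).
Local Notation leb := (@lebesgue_measure R).
Local Notation Q := (cylinder Omega T).
Local Notation I := (`]0, T[%classic : set TR).
Let mQ : measurable Q := measurable_cylinder T oO.
Let mO : measurable Omega := measurable_base oO.
Let mI : measurable I. Proof. exact: measurable_itv. Qed.
Let Ioo : (leb I < +oo)%E. Proof. exact: itv_lebesgue_fin. Qed.
Implicit Types (w g : S -> R).

Lemma measurable_slice g x : measurable_fun Q g -> Omega x ->
  measurable_fun I (fun t => g (x, t)).
Proof.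
move=> mg Ox; apply: (measurable_comp mQ) mg _; first by move=> _ [t It <-].
by apply: measurable_funTS; exact: pair1_measurable.
Qed.

Lemma slice_L2 g : L2 mu Q g ->
  {ae nu, forall x, Omega x -> L2 leb I (fun t => g (x, t))}.
Proof.
move=> Lg.
have := @fubini_ae_integrable _ _ _ _ _ nu leb Omega I mO mI _ (L2_sqr_integrable Lg).
apply: filterS => x h Ox; apply: L2P; last exact: h.
by apply: measurable_slice => //; exact: L2_meas Lg.
Qed.

(** The norm of the time slice above a point; by Cauchy--Schwarz it controls the
    increments of the primitive uniformly in time. *)
Definition slice_norm g (x : X) : R :=
  Num.sqrt (ip leb I (fun t => g (x, t)) (fun t => g (x, t))).

Lemma slice_norm_L2 g : L2 mu Q g -> L2 nu Omega (slice_norm g).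
Proof.
move=> Lg.
have J := @fubini_integrable _ _ _ _ _ nu leb Omega I mO mI _ (L2M_integrable mQ Lg Lg).
apply: L2P.
  have ms : measurable_fun setT (Num.sqrt : R -> R).
    by apply: continuous_measurable_fun; exact: sqrt_continuous.
  apply: (measurableT_comp ms).
  by case/integrableP: J => /measurable_EFinP.
apply: eq_integrable J => // x _; rewrite /slice_norm sqr_sqrtr//.
exact: ip_ge0.
Qed.

(** A null set of the base sweeps out a null cylinder. *)
Lemma ae_base_cylinder (P : X -> Prop) : {ae nu, forall x, Omega x -> P x} ->
  {ae mu, forall z, Q z -> P z.1}.
Proof.
move=> [N [mN N0 PN]]; exists (N `*` setT); split.
- exact: measurableX.
- have := product_measure1E nu leb mN (@measurableT _ TR).
  by rewrite [X in (X * _)%E](N0 : nu N = 0%E) mul0e.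
- move=> z /= nP; split => //; apply: PN => /= h; apply: nP => -[Oz _].
  exact: h.
Qed.

Definition prim g : S -> R := fun z => \int[leb]_(s in `]0, z.2[) g (z.1, s).

Let measurable_prim g : measurable_fun Q g -> measurable_fun Q (prim g).
Proof.
move=> mg.
pose k (p : S * TR) := g (p.1.1, p.2) * \1_triangle (p.1.2, p.2).
have mk : measurable_fun (Q `*` I) k.
  apply: measurable_funM.
    apply: (measurable_comp mQ) mg _; first by move=> _ [[[x t] s] [[/= Ox _] Is] <-].
    apply: measurable_funTS; apply: measurable_fun_pair; last exact: measurable_snd.
    by apply: measurableT_comp measurable_fst.
  apply: measurable_funTS.
  have m1 : measurable_fun setT (\1_triangle : TR * TR -> R).
    by apply: measurable_indic; exact: measurable_triangle.
  apply: (measurableT_comp m1 (g := fun p : S * TR => (p.1.2, p.2))).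
  apply: measurable_fun_pair; last exact: measurable_snd.
  by apply: measurableT_comp measurable_fst.
apply: eq_measurable_fun (measurable_Rintegral leb mQ mI mk) => -[x t] /set_mem [_ /= It].
rewrite /prim /= (_ : `]0, t[%classic = I `&` `]-oo, t[).
  rewrite Rintegral_mkcondr; apply: eq_Rintegral => s _.
  rewrite /k patchE indicE /=.
  rewrite (_ : ((t, s) \in triangle) = (s \in `]-oo, t[%classic)).
    by case: (_ \in _); rewrite ?mulr1 ?mulr0.
  by apply/idP/idP => /set_mem h; apply/mem_set; move: h; rewrite /triangle /= in_itv.
apply/seteqP; split => r /=; rewrite !in_itv /=.
  move=> /andP[-> rt]; split => //; move: It; rewrite /= in_itv /= => /andP[_ tT].
  exact: lt_trans rt tT.
by move=> [/andP[-> _] ->].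
Qed.

Lemma prim_sqr_le g x s t : L2 leb I (fun t => g (x, t)) -> 0 <= s -> s <= t -> t <= T ->
  (\int[leb]_(r in `]s, t[) g (x, r)) ^+ 2 <= (t - s) * slice_norm g x ^+ 2.
Proof.
move=> Lg s0 st tT.
have mst : measurable (`]s, t[%classic : set TR) by exact: measurable_itv.
have sub : `]s, t[%classic `<=` I.
  move=> r /=; rewrite !in_itv /= => /andP[sr rt].
  by rewrite (le_lt_trans s0 sr) (lt_le_trans rt tT).
rewrite /slice_norm sqr_sqrtr ?ip_ge0//.
apply: le_trans (Rintegral_sqr_le st (L2S mI mst sub Lg)) _.
by rewrite ler_wpM2l ?subr_ge0// (ipS_le mI mst sub Lg).
Qed.

Lemma prim_L2 g : L2 mu Q g -> L2 mu Q (prim g).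
Proof.
move=> Lg; have Ln := L2_fst mO mI Ioo (slice_norm_L2 Lg).
apply: (L2_ae_dom mQ (measurable_prim (L2_meas Lg)) (L2Z mQ (Num.sqrt T) Ln)).
have := ae_base_cylinder (slice_L2 Lg).
apply: filterS => -[x t] h [Ox It]; have Lx := h (conj Ox It).
move: It; rewrite /= in_itv /= => /andP[t0 tT].
have := prim_sqr_le Lx (lexx 0) (ltW t0) (ltW tT); rewrite subr0 => H.
have T0 : 0 <= T by rewrite ltW// (lt_trans t0).
rewrite -(@ler_pXn2r _ 2)// ?nnegrE//.
rewrite !real_normK ?num_real//= exprMn sqr_sqrtr//.
apply: le_trans H _; rewrite ler_wpM2r ?sqr_ge0//.
exact: ltW.
Qed.

End time_primitive.

(** * Functions with a weak time derivative *)

Section time_regularity.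
Context {R : realType} {d : nat}.
Local Notation X := 'rV[R]_d.
Local Notation TR := (measurableTypeR R).
Local Notation S := (X * measurableTypeR R)%type.
Variables (Omega : set X) (T : R).
Hypotheses (oO : open Omega) (bO : bounded_set Omega) (T0 : 0 < T).
Local Notation mu := (@lebesgue_ST R d).
Local Notation nu := (lebesgue_rV R d).
Local Notation leb := (@lebesgue_measure R).
Local Notation Q := (cylinder Omega T).
Local Notation I := (`]0, T[%classic : set TR).
Let mQ : measurable Q := measurable_cylinder T oO.
Let mO : measurable Omega := measurable_base oO.
Let mI : measurable I. Proof. exact: measurable_itv. Qed.
Let Ioo : (leb I < +oo)%E. Proof. exact: itv_lebesgue_fin. Qed.
Implicit Types (w g : S -> R).

Lemma ip_cylinder w g : L2 mu Q w -> L2 mu Q g ->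
  ip mu Q w g =
  \int[nu]_(x in Omega) ip leb I (fun t => w (x, t)) (fun t => g (x, t)).
Proof. by move=> Lw Lg; exact: (fubini_setX mO mI (L2M_integrable mQ Lw Lg)). Qed.

Lemma ip_cylinder_integrable w g : L2 mu Q w -> L2 mu Q g ->
  nu.-integrable Omega
    (fun x => (ip leb I (fun t => w (x, t)) (fun t => g (x, t)))%:E).
Proof. by move=> Lw Lg; exact: (fubini_integrable mO mI (L2M_integrable mQ Lw Lg)). Qed.

Let spaceb (k : nat) (a b : X) (x : X) : R :=
  \prod_i plateau k (a ord0 i) (b ord0 i) (x ord0 i).

Let derive_prodfun k (a b : X) (eta eta' : R -> R) z :
  (forall x : R, is_derive x 1 eta (eta' x)) ->
  'D_(@dir_t R d) (prodfun k a b eta) z = prodfun k a b eta' z.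
Proof.
move=> de; suff : is_derive z (@dir_t R d) (prodfun k a b eta) (prodfun k a b eta' z).
  by case.
apply/is_derive_lineE; rewrite /prodfun.
rewrite (_ : (fun t => _) = (fun t => spaceb k a b z.1 * eta (t + z.2))); last first.
  apply/funext => t /=; congr (_ * eta _); last by rewrite /GRing.scale /= mulr1.
  by apply: eq_bigr => i _; rewrite scaler0 add0r.
have d1 : is_derive (0 : R) 1 (fun t => eta (t + z.2)) (eta' z.2).
  by apply: is_derive_shift; rewrite add0r.
exact: (@is_deriveZ _ _ _ (fun t => eta (t + z.2)) (spaceb k a b z.1) 0 1 _ d1).
Qed.

Let bounded_compact_support (f : R -> R) s t : smooth f ->
  (forall r, r \notin `[s, t] -> f r = 0) -> exists M, forall r, `|f r| <= M.
Proof.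
move=> sf f0; apply: (@test_function_bounded _ _ setT).
apply: (@test_function_support _ _ _ `[s, t]) => //; first exact: segment_compact.
by move=> z n0; apply/negPn/negP => /f0 h; rewrite h eqxx in n0.
Qed.

(* Subtracting a multiple of this function makes the mean of a function of time
   vanish without leaving the compactly supported functions. *)
Let time_bump : exists eta0 : R -> R, [/\ smooth eta0,
  forall r, r \notin `[T / 3, 2 * T / 3] -> eta0 r = 0 &
  \int[leb]_(t in I) eta0 t = 1].
Proof.
pose p := plateau 1 (T / 3) (2 * T / 3).
have T3 : T / 3 < 2 * T / 3.
  by rewrite ltr_pM2r ?invr_gt0 ?ltr0n// mulr_natl mulr2n ltrDl.
have sp : smooth p by exact: smooth_plateau.
have p0 r : r \notin `[T / 3, 2 * T / 3] -> p r = 0.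
  by move=> h; apply: plateau_out; apply: contra h; exact: subset_itv_oo_cc.
have Lp : L2 leb I p by apply: L2_compact_continuous; exact: smooth_continuous.
have c0 : ip leb I p p != 0.
  apply/eqP => /(ip_eq0 mI Lp) [N [mN N0 hN]].
  have sub : `]T / 3, 2 * T / 3[%classic `<=` N.
    move=> t /= tT; apply: hN => /= h.
    have It : t \in `]0, T[ by move: tT; rewrite !in_itv /= => /andP[? ?]; apply/andP; split; lra.
    have := h It; rewrite /p /plateau => /eqP; rewrite subr_eq0 => /eqP /esym.
    rewrite -[X in _ = X]expR0 => /expR_inj /eqP; rewrite oppr_eq0 mul1r mulf_eq0.
    move: tT; rewrite in_itv /= => /andP[t1 t2].
    by rewrite !gt_eqF// flat1_gt0// subr_gt0.
  have : (leb `](T / 3)%R, (2 * T / 3)%R[%classic <= leb N)%E.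
    by apply: le_measure; rewrite ?inE//; exact: measurable_itv.
  rewrite [X in (_ <= X)%E]N0 lebesgue_measure_itv /= lte_fin ifT; last exact: T3.
  by rewrite -EFinB lee_fin subr_le0 leNgt T3.
exists (fun r => (ip leb I p p)^-1 * (p r * p r)); split.
- by apply: smoothZ; exact: smoothM.
- by move=> r /p0 ->; rewrite !mulr0.
- by rewrite RintegralZl ?mulVf//; exact: (L2M_integrable mI Lp Lp).
Qed.

Let ae_eq_Rintegral_base (h1 h2 : X -> R) :
  nu.-integrable Omega (EFin \o h1) -> nu.-integrable Omega (EFin \o h2) ->
  {ae nu, forall x, Omega x -> h1 x = h2 x} ->
  \int[nu]_(x in Omega) h1 x = \int[nu]_(x in Omega) h2 x.
Proof.
move=> /integrableP[m1 _] /integrableP[m2 _] h; congr fine; apply: ae_eq_integral => //.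
by apply: filterS h => x h Ox; rewrite /= h.
Qed.

(** The difference p of w and [prim g] is orthogonal to every product Psi(x) f(t)
    with f of mean zero, since such an f is the derivative of a test function of
    time; hence p does not depend on time. *)
Lemma weak_dt_primitive w g : L2 mu Q w -> is_weak_partial Omega T (@dir_t R d) w g ->
  exists c : X -> R, L2 nu Omega c /\
    {ae mu, forall z, Q z -> w z = c z.1 + prim g z}.
Proof.
move=> Lw [Lg wg]; have [eta0 [seta0 eta00 meta0]] := time_bump.
pose p z := w z - prim g z.
have LG : L2 mu Q (prim g) := prim_L2 oO Lg.
have Lp : L2 mu Q p := L2B mQ Lw LG.
have Leta0 : L2 leb I eta0 by apply: L2_compact_continuous; exact: smooth_continuous.
(* the constant of integration is the mean of w - prim g weighted by eta0 *)
pose c x := ip leb I (fun t => p (x, t)) eta0.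
have Lc : L2 nu Omega c.
  have mc : measurable_fun Omega c.
    apply: (@measurable_Rintegral _ _ _ _ _ leb Omega I mO mI (fun z => p z * eta0 z.2)).
    apply: measurable_funM; first exact: L2_meas Lp.
    apply: measurable_funTS; apply: (measurableT_comp (f := eta0 : TR -> R) (g := snd)).
      by apply: continuous_measurable_fun; exact: smooth_continuous.
    exact: measurable_snd.
  apply: (L2_ae_dom mO mc (L2Z mO (Num.sqrt (ip leb I eta0 eta0)) (slice_norm_L2 oO Lp))).
  apply: filterS (slice_L2 oO Lp) => x Lx Ox.
  have := ip_CS_sqrt mI (Lx Ox) Leta0; rewrite mulrC => /le_trans; apply.
  by rewrite ler_norm.
exists c; split=> //.
have Lcz : L2 mu Q (c \o fst) := L2_fst mO mI Ioo Lc.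
suff : {ae mu, forall z, Q z -> p z - c z.1 = 0}.
  apply: filterS => z h Qz; have := h Qz; rewrite /p => /eqP.
  by rewrite subr_eq0 => /eqP <-; rewrite subrK.
apply: (L2_orth_bump oO bO) => [|k a b s t bQ]; first exact: (L2B mQ Lp Lcz).
have Lb : L2 mu Q (prodfun k a b (plateau k s t)).
  exact: (L2Q_test T oO bO (test_function_bump k bQ)).
have [ne|emp] := pselect (cbox a b s t !=set0); last first.
  rewrite (_ : prodfun _ _ _ _ = fun=> 0); first by rewrite ipC ip0l.
  apply/funext => z; apply/eqP/negPn/negP => n0; apply: emp; exists z; split.
    move=> i; apply: subset_itv_oo_cc; apply/negPn/negP => /(prodfun_out k (plateau k s t)) h.
    by rewrite h eqxx in n0.
  apply: subset_itv_oo_cc; apply/negPn/negP => h; move: n0.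
  by rewrite /prodfun plateau_out// mulr0 eqxx.
have [z0 [z01 z02]] := ne; move: (z02); rewrite in_itv /= => /andP[sz zt].
have st : s <= t := le_trans sz zt.
have s0 : 0 < s.
  have [] : Q (z0.1, s) by apply: bQ; split => //=; rewrite in_itv /= lexx.
  by move=> _; rewrite /= in_itv /= => /andP[].
have tT : t < T.
  have [] : Q (z0.1, t) by apply: bQ; split => //=; rewrite in_itv /= lexx andbT.
  by move=> _; rewrite /= in_itv /= => /andP[].
pose chi := plateau k s t.
have schi : smooth chi by exact: smooth_plateau.
have chi0 r : r \notin `[s, t] -> chi r = 0.
  by move=> h; apply: plateau_out; apply: contra h; exact: subset_itv_oo_cc.
pose X0 := \int[leb]_(r in I) chi r.
(* f has mean zero, and eta, its primitive, is an admissible function of time *)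
pose f r := chi r - X0 * eta0 r.
have sf : smooth f by apply: smoothB => //; exact: smoothZ.
pose s' := Num.min s (T / 3); pose t' := Num.max t (2 * T / 3).
have s'0 : 0 < s' by rewrite lt_min s0 divr_gt0.
have t'T : t' < T by rewrite gt_max tT /=; lra.
have f0 r : r \notin `[s', t'] -> f r = 0.
  move=> h; rewrite /f chi0 ?eta00 ?mulr0 ?subrr//.
    apply: contra h; rewrite !in_itv /= ge_min le_max => /andP[-> ->].
    by rewrite !orbT.
  by apply: contra h; rewrite !in_itv /= ge_min le_max => /andP[-> ->].
have Lchi : L2 leb I chi by apply: L2_compact_continuous; exact: smooth_continuous.
have L1 : L2 leb I (fun=> 1) := L2_cst mI 1 Ioo.
have ip1 (h : R -> R) : ip leb I h (fun=> 1) = \int[leb]_(r in I) h r.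
  by apply: eq_Rintegral => r _; rewrite mulr1.
have f_mean : \int[leb]_(r in I) f r = 0.
  rewrite -ip1 (ipBl mI Lchi (L2Z mI X0 Leta0) L1) (ipZl mI X0 Leta0 L1) !ip1.
  by rewrite meta0 mulr1 subrr.
have sub_st : `[s', t']%classic `<=` I.
  move=> r /=; rewrite !in_itv /= => /andP[h1 h2].
  by rewrite (lt_le_trans s'0 h1) (le_lt_trans h2 t'T).
have f_mean' : \int[leb]_(r in `[s', t']) f r = 0.
  rewrite -f_mean Rintegral_mkcond [RHS]Rintegral_mkcond; apply: eq_Rintegral => r _.
  rewrite !patchE; have [rst|rst] := boolP (r \in `[s', t']%classic).
    by rewrite [r \in I]mem_set//; apply: sub_st; exact: set_mem.
  rewrite f0 ?if_same//; apply: contra rst => rst; exact: mem_set.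
have [eta [seta deta etal etar]] := compact_support_primitive sf f0.
have eta_out r : r \notin `[s', t'] -> eta r = 0.
  rewrite in_itv /= negb_and -!ltNge => /orP[/etal//|/etar ->].
  exact: f_mean'.
have bQ' : cbox a b s' t' `<=` Q.
  move=> z [h1 h2]; split; last exact: sub_st.
  by have [] : Q (z.1, s) by apply: bQ; split => //=; rewrite in_itv /= lexx.
have tphi : test_function Q (prodfun k a b eta) := test_function_prodfun k seta eta_out bQ'.
have Lphi := L2Q_test T oO bO tphi.
have Lf : L2 mu Q (prodfun k a b f).
  exact: (L2Q_test T oO bO (test_function_prodfun k sf f0 bQ')).
have Le0 : L2 mu Q (prodfun k a b eta0).
  have e0_out r : r \notin `[s', t'] -> eta0 r = 0.
    move=> h; apply: eta00; apply: contra h.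
    by rewrite !in_itv /= ge_min le_max => /andP[-> ->]; rewrite !orbT.
  exact: (L2Q_test T oO bO (test_function_prodfun k seta0 e0_out bQ')).
have E1 : ip mu Q w (prodfun k a b f) = - ip mu Q g (prodfun k a b eta).
  have e : ip mu Q w ('D_(@dir_t R d) (prodfun k a b eta)) = - ip mu Q g (prodfun k a b eta) := wg _ tphi.
  by rewrite -e; apply: eq_ip => z _; rewrite (derive_prodfun k a b z deta).
have [M hM] := bounded_compact_support sf f0.
have dE r : 'D_1 eta r = f r by have [] := deta r.
have E2 : ip mu Q (prim g) (prodfun k a b f) = - ip mu Q g (prodfun k a b eta).
  rewrite (ip_cylinder LG Lf) (ip_cylinder Lg Lphi) -mulN1r.
  rewrite -RintegralZl//; last exact: (ip_cylinder_integrable Lg Lphi).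
  apply: ae_eq_Rintegral_base; first exact: ip_cylinder_integrable.
    exact: (integrableZl mO (-1) (ip_cylinder_integrable Lg Lphi)).
  have [etaT dM Leta Lf1] : [/\ eta T = 0, forall r, `|'D_1 eta r| <= M,
      L2 leb I eta & L2 leb I f].
    split; [|by move=> r; rewrite dE| |].
    - by apply: eta_out; rewrite in_itv /= negb_and -!ltNge t'T orbT.
    - by apply: L2_compact_continuous; exact: smooth_continuous.
    - by apply: L2_compact_continuous; exact: smooth_continuous.
  apply: filterS2 (slice_L2 oO Lg) (slice_L2 oO LG) => x Lx LGx Ox.
  have {}Lx := Lx Ox; have {}LGx := LGx Ox.
  have PP : ip leb I (fun t => prim g (x, t)) f = - ip leb I (fun t => g (x, t)) eta.
    apply: etrans (primitive_by_parts seta etaT dM Lx).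
    by apply: eq_Rintegral => r _; rewrite dE.
  rewrite /= (ipZr mI (spaceb k a b x) LGx Lf1) (ipZr mI (spaceb k a b x) Lx Leta).
  by rewrite PP mulN1r mulrN.
have E3 : ip mu Q p (prodfun k a b f) = 0.
  by rewrite /p (ipBl mQ Lw LG Lf) E1 E2 subrr.
have E4 : ip mu Q p (prodfun k a b chi) = X0 * ip mu Q p (prodfun k a b eta0).
  rewrite -(ipZr mQ X0 Lp Le0); apply/eqP; rewrite -subr_eq0.
  rewrite -(ipBr mQ Lp Lb (L2Z mQ X0 Le0)) -E3; apply/eqP; apply: eq_ip => z _.
  by rewrite /prodfun /f -/chi; ring.
rewrite (ipBl mQ Lp Lcz Lb) [X in X - _]E4; apply/eqP; rewrite subr_eq0; apply/eqP.
rewrite -(ipZr mQ X0 Lp Le0) (ip_cylinder Lp (L2Z mQ X0 Le0)) (ip_cylinder Lcz Lb).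
apply: ae_eq_Rintegral_base.
- exact: (ip_cylinder_integrable Lp (L2Z mQ X0 Le0)).
- exact: (ip_cylinder_integrable Lcz Lb).
apply: filterS (slice_L2 oO Lp) => x Lx Ox; have {}Lx := Lx Ox.
transitivity (X0 * (spaceb k a b x * c x)).
  rewrite /c -(ipZr mI (spaceb k a b x) Lx Leta0).
  by rewrite -(ipZr mI X0 Lx (L2Z mI (spaceb k a b x) Leta0)).
transitivity (ip leb I (fun=> c x) (fun t => spaceb k a b x * chi t)) => //.
rewrite (ipZr mI (spaceb k a b x) (L2_cst mI (c x) Ioo) Lchi) ipC.
have -> : ip leb I chi (fun=> c x) = c x * X0.
  rewrite /X0 -ip1 -(ipZr mI (c x) Lchi L1); apply: eq_ip => r _.
  by rewrite mulr1.
by ring.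
Qed.

End time_regularity.

(** * Traces at fixed times *)

Section traces.
Context {R : realType} {d : nat}.
Local Notation X := 'rV[R]_d.
Local Notation TR := (measurableTypeR R).
Local Notation S := (X * measurableTypeR R)%type.
Variables (Omega : set X) (T : R).
Hypotheses (oO : open Omega) (bO : bounded_set Omega) (T0 : 0 < T).
Local Notation mu := (@lebesgue_ST R d).
Local Notation nu := (lebesgue_rV R d).
Local Notation leb := (@lebesgue_measure R).
Local Notation Q := (cylinder Omega T).
Local Notation I := (`]0, T[%classic : set TR).
Let mQ : measurable Q := measurable_cylinder T oO.
Let mO : measurable Omega := measurable_base oO.
Let mI : measurable I. Proof. exact: measurable_itv. Qed.
Implicit Types (w g : S -> R).

Lemma prim_diff g x s t : L2 leb I (fun t => g (x, t)) -> 0 <= s -> s <= t -> t <= T ->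
  prim g (x, t) - prim g (x, s) = \int[leb]_(r in `]s, t[) g (x, r).
Proof.
move=> Lg s0; rewrite le_eqVlt => /predU1P[<- _|st tT].
  by rewrite subrr set_itvoo0 ?Rintegral_set0.
have Ig : leb.-integrable `]0, t[ (fun r => (g (x, r))%:E).
  have := L2M_integrable mI Lg (L2_cst mI 1 (itv_lebesgue_fin 0 T)).
  move=> J; have {}J : leb.-integrable I (fun r => (g (x, r))%:E).
    by apply: eq_integrable J => // r _; rewrite mulr1.
  apply: (integrableS mI _ _ J); first exact: measurable_itv.
  by move=> r /=; rewrite !in_itv /= => /andP[-> /lt_le_trans]; apply.
rewrite /prim /= -(@Rintegral_itvB _ _ (BRight 0) (BLeft t) s) ?bnd_simp//.
congr (_ - _); apply: Rintegral_itv_bndo_bndc.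
apply: (integrableS _ _ _ Ig); [exact: measurable_itv|exact: measurable_itv|].
by move=> r /=; rewrite !in_itv /= => /andP[-> rs]; rewrite (lt_trans rs st).
Qed.

Let prim_slice_L2 g t : L2 mu Q g -> t \in `[0, T] ->
  L2 nu Omega (fun x => prim g (x, t)).
Proof.
rewrite in_itv /= => Lg /andP[t0 tT].
have sub : Omega `*` `]0, t[ `<=` Q.
  move=> [x r] [/= Ox]; rewrite !in_itv /= => /andP[r0 rt]; split => //=.
  by rewrite in_itv /= r0 (lt_le_trans rt tT).
have mt : measurable (`]0, t[%classic : set TR) by exact: measurable_itv.
have mp : measurable_fun Omega (fun x => prim g (x, t)).
  apply: (@measurable_Rintegral _ _ _ _ _ leb Omega `]0, t[ mO mt g).
  exact: measurable_funS mQ sub (L2_meas Lg).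
apply: (L2_ae_dom mO mp (L2Z mO (Num.sqrt T) (slice_norm_L2 oO Lg))).
apply: filterS (slice_L2 oO Lg) => x Lx Ox; have {}Lx := Lx Ox.
have := prim_sqr_le Lx (lexx 0) t0 tT; rewrite subr0 => H.
rewrite -(@ler_pXn2r _ 2)// ?nnegrE//.
rewrite !real_normK ?num_real//= exprMn sqr_sqrtr ?(ltW T0)//.
by apply: le_trans H _; rewrite ler_wpM2r ?sqr_ge0.
Qed.

Let prim_slice_diff_le g s t : L2 mu Q g -> s \in `[0, T] -> t \in `[0, T] ->
  ip nu Omega (fun x => prim g (x, s) - prim g (x, t)) (fun x => prim g (x, s) - prim g (x, t))
  <= `|s - t| * ip nu Omega (slice_norm T g) (slice_norm T g).
Proof.
move=> Lg; wlog st : s t / s <= t.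
  move=> H sI tI; have [st|/ltW ts] := leP s t; first exact: H.
  rewrite distrC; have := H _ _ ts tI sI.
  rewrite (@eq_ip _ _ _ nu Omega _ (fun x => prim g (x, s) - prim g (x, t)) _
    (fun x => prim g (x, s) - prim g (x, t)))//.
  by move=> x _; rewrite -mulrNN !opprB.
move=> sI tI; have Ls := prim_slice_L2 Lg sI; have Lt := prim_slice_L2 Lg tI.
have Ln := slice_norm_L2 oO Lg; have Ld := L2B mO Ls Lt.
rewrite -(ipZl mO _ Ln Ln); rewrite -lee_fin.
have I1 := L2M_integrable mO Ld Ld; have I2 := L2M_integrable mO (L2Z mO `|s - t| Ln) Ln.
rewrite fineK ?integrable_fin_num// fineK ?integrable_fin_num//.
apply: ae_ge0_le_integral => //.
- by move=> x _; rewrite lee_fin -expr2 sqr_ge0.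
- by case/integrableP: I1.
- by move=> x _; rewrite lee_fin -mulrA mulr_ge0// -expr2 sqr_ge0.
- by case/integrableP: I2.
apply: filterS (slice_L2 oO Lg) => x Lx Ox; have {}Lx := Lx Ox.
move: sI tI; rewrite !in_itv /= => /andP[s0 sT] /andP[t0 tT].
rewrite lee_fin -mulrNN opprB prim_diff// -expr2 distrC ger0_norm ?subr_ge0// -mulrA -expr2.
exact: prim_sqr_le.
Qed.

(** The representative is c(x) + prim g: by Cauchy--Schwarz its slices are
    1/2-Hoelder continuous in time with values in L2(Omega). *)
Lemma weak_dt_continuous_rep w g : L2 mu Q w ->
  is_weak_partial Omega T (@dir_t R d) w g -> exists W, time_continuous_rep Omega T w W.
Proof.
move=> Lw wg; have [c [Lc wc]] := weak_dt_primitive oO bO T0 Lw wg.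
have Lg : L2 mu Q g by case: wg.
exists (fun t x => c x + prim g (x, t)); split.
- by move=> t tI; apply: (L2D mO Lc); exact: prim_slice_L2.
- move=> t tI; pose C := ip nu Omega (slice_norm T g) (slice_norm T g).
  have C0 : 0 <= C by exact: ip_ge0.
  have C1 : 0 < C + 1 by rewrite ltr_wpDl.
  apply/cvgrPdist_le => /= e e0.
  have e2 : 0 < e ^+ 2 / (C + 1) by rewrite divr_gt0// exprn_gt0.
  apply/nbhs_ballP; exists (e ^+ 2 / (C + 1)) => //= s.
  rewrite -ball_normE /= => st sI.
  rewrite sub0r normrN ger0_norm ?L2norm_ge0//.
  rewrite -(@ler_pXn2r _ 2)// ?nnegrE ?L2norm_ge0 ?(ltW e0)// L2normE.
  rewrite (_ : ip _ _ _ _ = ip nu Omega (fun x => prim g (x, s) - prim g (x, t))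
     (fun x => prim g (x, s) - prim g (x, t))); last first.
    by apply: eq_ip => x _ /=; rewrite opprD addrACA subrr add0r.
  apply: le_trans (prim_slice_diff_le Lg sI tI) _; rewrite -/C.
  apply: (@le_trans _ _ (`|s - t| * (C + 1))); first by rewrite ler_wpM2l// lerDl.
  by rewrite -ler_pdivlMr// distrC ltW.
- by apply: filterS wc => -[x t] h Qz; rewrite /= h.
Qed.

Let ae_time_near0 (P : R -> Prop) : {ae leb, forall t, I t -> P t} ->
  forall e, 0 < e -> exists t, [/\ 0 < t, t < e, t < T & P t].
Proof.
move=> [N [mN N0 PN]] e e0; apply: contrapT => nex.
pose m := Num.min e T; have m0 : 0 < m by rewrite lt_min e0 T0.
have sub : `]0, m[%classic `<=` N.
  move=> t /=; rewrite in_itv /= lt_min => /and3P[t0 te tT].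
  apply: PN => /= h; apply: nex; exists t; split=> //; apply: h.
  by rewrite /= in_itv /= t0.
have : (leb `]0%R, m[%classic <= leb N)%E.
  by apply: le_measure; rewrite ?inE//; exact: measurable_itv.
by rewrite [X in (_ <= X)%E]N0 lebesgue_measure_itv /= lte_fin m0 oppr0 adde0 lee_fin leNgt m0.
Qed.

(** The function of space c in [weak_dt_primitive] is the trace at time 0: at
    almost every small time s, c differs from the slice of W at s by the slice of
    prim g, which is small, while W s is close to W 0 = 0. *)
Lemma zero_trace_primitive w g : L2 mu Q w ->
  is_weak_partial Omega T (@dir_t R d) w g -> zero_on_Sigma0 Omega T w ->
  {ae mu, forall z, Q z -> w z = prim g z}.
Proof.
move=> Lw wg [W [[LW cW wW] W0]]; have [c [Lc wc]] := weak_dt_primitive oO bO T0 Lw wg.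
have Lg : L2 mu Q g by case: wg.
suff c0 : {ae nu, forall x, Omega x -> c x = 0}.
  have := ae_base_cylinder T c0; apply: filterS2 wc => z h h' Qz.
  by rewrite h// h'// add0r.
apply: (ip_eq0 mO Lc); apply/eqP; rewrite eq_le ip_ge0 andbT.
have I0 : (0 : R) \in `[0, T] by rewrite in_itv /= lexx ltW.
pose C := ip nu Omega (slice_norm T g) (slice_norm T g).
have C0 : 0 <= C by exact: ip_ge0.
have C1 : 0 < C + 1 by rewrite ltr_wpDl.
apply/ler_addgt0Pr => e e0; rewrite add0r.
have e4 : 0 < Num.sqrt (e / 4) by rewrite sqrtr_gt0 divr_gt0.
have /cvgrPdist_le /(_ _ e4) /nbhs_ballP[r /= r0 hr] := cW 0 I0.
have /ae_slice : {ae (nu \x leb)%E, forall z, (Omega `*` I) z -> W z.2 z.1 = c z.1 + prim g z}.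
  by apply: filterS2 wW wc => z h h' Qz; rewrite -h// h'.
move=> /ae_time_near0 /(_ (Num.min r (e / (4 * (C + 1))))).
rewrite lt_min r0 divr_gt0 ?mulr_gt0// => /(_ isT) [s [s0]].
rewrite lt_min => /andP[sr se] sT Ws.
have sI : s \in `[0, T] by rewrite in_itv /= !ltW.
have LWs := LW _ sI; have LW0 := LW _ I0; have Lp := prim_slice_L2 Lg sI.
have Ld := L2B mO LWs LW0.
have K1 : ip nu Omega (fun x => W s x - W 0 x) (fun x => W s x - W 0 x) <= e / 4.
  have : ball 0 r s by rewrite -ball_normE /= sub0r normrN gtr0_norm.
  move=> /hr /(_ sI); rewrite sub0r normrN ger0_norm ?L2norm_ge0// => h.
  have := L2normE nu Omega (W s \- W 0) => <-.
  have e40 : 0 <= e / 4 by rewrite divr_ge0// ltW.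
  rewrite -(sqr_sqrtr e40).
  by rewrite ler_pXn2r// nnegrE ?L2norm_ge0// (ltW e4).
have K2 : ip nu Omega (fun x => prim g (x, s)) (fun x => prim g (x, s)) <= e / 4.
  have := prim_slice_diff_le Lg sI I0.
  rewrite (_ : ip _ _ _ _ = ip nu Omega (fun x => prim g (x, s)) (fun x => prim g (x, s))); last first.
    apply: eq_ip => x _.
    by rewrite {2 4}/prim /= set_itvoo0 ?Rintegral_set0 ?subr0.
  move=> /le_trans; apply; rewrite subr0 gtr0_norm// -/C.
  apply: (@le_trans _ _ (s * (C + 1))); first by rewrite ler_wpM2l ?lerDl// ltW.
  rewrite -ler_pdivlMr// ltW//; move: se; rewrite invfM mulrA.
  by [].
have := ip_sqrB_le mO Ld Lp.
have -> : ip nu Omega (fun x => W s x - W 0 x - prim g (x, s))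
    (fun x => W s x - W 0 x - prim g (x, s)) = ip nu Omega c c.
  have Ldp := L2B mO Ld Lp.
  have ae_c : {ae nu, forall x, Omega x -> W s x - W 0 x - prim g (x, s) = c x}.
    apply: filterS2 Ws W0 => x h h0 Ox; rewrite h0// subr0.
    have -> := h Ox => /=; ring.
  by rewrite (ae_eq_ip mO Ldp Lc Ldp ae_c) ipC (ae_eq_ip mO Ldp Lc Lc ae_c).
move: K1 K2; move: (ip _ _ _ _) (ip _ _ _ _) (ip _ _ _ _) => p q r'; lra.
Qed.

End traces.

(** * Averages over slabs below the final time *)

Section trace_average.
Context {R : realType} {d : nat}.
Local Notation X := 'rV[R]_d.
Local Notation TR := (measurableTypeR R).
Local Notation S := (X * measurableTypeR R)%type.
Variables (Omega : set X) (T : R).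
Hypotheses (oO : open Omega) (bO : bounded_set Omega) (T0 : 0 < T).
Local Notation mu := (@lebesgue_ST R d).
Local Notation nu := (lebesgue_rV R d).
Local Notation leb := (@lebesgue_measure R).
Local Notation Q := (cylinder Omega T).
Local Notation I := (`]0, T[%classic : set TR).
Let mQ : measurable Q := measurable_cylinder T oO.
Let mO : measurable Omega := measurable_base oO.
Implicit Types (w g : S -> R).

Definition last_slab h : set S := Omega `*` `]T - h, T[.

Lemma ae_le_Rintegral {dU} {U : measurableType dU} (m : {measure set U -> \bar R})
    (D : set U) (f g : U -> R) : measurable D ->
  m.-integrable D (EFin \o f) -> m.-integrable D (EFin \o g) ->
  {ae m, forall x, D x -> f x <= g x} ->
  \int[m]_(x in D) f x <= \int[m]_(x in D) g x.
Proof.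
move=> mD If Ig fg; rewrite -subr_ge0 -RintegralB//.
have J := integrableB mD Ig If.
have -> : \int[m]_(x in D) (g x - f x) = \int[m]_(x in D) `|g x - f x|.
  have mJ : measurable_fun D (fun x => g x - f x).
    by case/integrableP: J => /measurable_EFinP.
  congr fine; apply: ae_eq_integral => //.
  - exact/measurable_EFinP.
  - by apply/measurable_EFinP; exact: measurableT_comp mJ.
  - by apply: filterS fg => x h Dx; rewrite ger0_norm// subr_ge0 h.
exact: Rintegral_ge0.
Qed.

Let ip_close (w v : X -> R) e c : L2 nu Omega w -> L2 nu Omega v -> 0 < e -> e <= 1 ->
  L2norm nu Omega (fun x => w x - v x) <= e -> Num.sqrt (ip nu Omega v v) <= c ->
  `|ip nu Omega w w - ip nu Omega v v| <= e * (1 + 2 * c).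
Proof.
move=> Lw Lv e0 e1 we vc; set D := fun x => w x - v x.
have LD : L2 nu Omega D by exact: L2B.
have -> : ip nu Omega w w - ip nu Omega v v = ip nu Omega D D + 2 * ip nu Omega D v.
  rewrite /D (ipBl mO Lw Lv LD) (ipBr mO Lw Lw Lv) (ipBr mO Lv Lw Lv) (ipBl mO Lw Lv Lv).
  by rewrite (ipC nu Omega v w); ring.
have h1 := ip_CS_sqrt mO LD Lv.
have n2 : ip nu Omega D D = L2norm nu Omega D ^+ 2 by rewrite L2normE.
have n1 : Num.sqrt (ip nu Omega D D) = L2norm nu Omega D.
  by rewrite n2 sqrtr_sqr ger0_norm// L2norm_ge0.
move: h1; rewrite n1 => h1; rewrite n2.
have N0 := L2norm_ge0 nu Omega D.
have v0 : 0 <= Num.sqrt (ip nu Omega v v) by exact: sqrtr_ge0.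
rewrite (le_trans (ler_normD _ _))// ger0_norm ?sqr_ge0// normrM ger0_norm//.
have h2 : `|ip nu Omega D v| <= e * c by rewrite (le_trans h1)// ler_pM.
have h3 : L2norm nu Omega D ^+ 2 <= e.
  by rewrite expr2 (le_trans (ler_pM _ _ we (le_trans we e1)))// mulr1.
by rewrite mulrDr mulr1 mulrCA lerD// ler_wpM2l.
Qed.

(** At almost every time the slice of w is that of the continuous representative,
    whose norm is close to its value at T on a thin slab: averages see the trace
    of a function which is only defined up to null sets. *)
Lemma slab_average w W : L2 mu Q w -> time_continuous_rep Omega T w W ->
  forall e, 0 < e -> exists2 dl, 0 < dl & forall h, 0 < h -> h < dl -> h < T ->
    `|h^-1 * ip mu (last_slab h) w w - ip nu Omega (W T) (W T)| <= e.
Proof.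
move=> Lw [LW cW wW] e e0; set L := ip nu Omega (W T) (W T).
have TI : T \in `[0, T] by rewrite in_itv /= lexx ltW.
pose c := Num.sqrt L; have c0 : 0 <= c by exact: sqrtr_ge0.
have C0 : 0 < 1 + 2 * c by rewrite ltr_pwDl// mulr_ge0.
pose e' := Num.min 1 (e / (1 + 2 * c)).
have e'0 : 0 < e' by rewrite lt_min ltr01 divr_gt0.
have e'1 : e' <= 1 by rewrite ge_min lexx.
have e'e : e' * (1 + 2 * c) <= e by rewrite -ler_pdivlMr// ge_min lexx orbT.
have /cvgrPdist_le /(_ _ e'0) /nbhs_ballP[r /= r0 hr] := cW T TI.
exists r => // h h0 hr' hT; set J := (`]T - h, T[%classic : set TR).
have mJ : measurable J by exact: measurable_itv.
have JI : J `<=` I.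
  move=> s; rewrite /J /= !in_itv /= => /andP[s1 s2].
  by rewrite s2 andbT (le_lt_trans _ s1)// subr_ge0 ltW.
have OJ : last_slab h `<=` Q by move=> [x s] [/= Ox /JI].
have mOJ : measurable (last_slab h) by exact: measurableX.
have LwJ : L2 mu (last_slab h) w := L2S mQ mOJ OJ Lw.
have IJ := L2M_integrable mOJ LwJ LwJ.
pose n s := ip nu Omega (fun x => w (x, s)) (fun x => w (x, s)).
have In : leb.-integrable J (EFin \o n).
  have := fubini_integrable2 mO mJ IJ; apply => z.
  by rewrite -expr2 sqr_ge0.
have ipn : ip mu (last_slab h) w w = \int[leb]_(s in J) n s.
  exact: (fubini_setX2 mO mJ IJ).
have Jcst k : \int[leb]_(s in J) k = k * h.
  rewrite Rintegral_cst//; congr (_ * _).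
  by rewrite /J fine_lebesgue_itvoo ?gerBl ?ltW// opprB addrC subrK.
have Icst k : leb.-integrable J (EFin \o (fun=> k)).
  have := L2M_integrable mJ (L2_cst mJ k (itv_lebesgue_fin _ _)) (L2_cst mJ 1 (itv_lebesgue_fin _ _)).
  by apply: eq_integrable => // s _; rewrite mulr1.
have ae_n : {ae leb, forall s, J s -> `|n s - L| <= e}.
  have : {ae (nu \x leb)%E, forall z, (Omega `*` I) z -> w z = W z.2 z.1} by exact: wW.
  move=> /ae_slice; apply: filterS => s ws Js; have {}ws := ws (JI _ Js).
  have sI : s \in `[0, T].
    by move: (JI _ Js); rewrite /= !in_itv /= => /andP[/ltW -> /ltW ->].
  have LWs := LW _ sI; have LWT := LW _ TI.
  have -> : n s = ip nu Omega (W s) (W s).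
    have mws : measurable_fun Omega (fun x => w (x, s)).
      apply: (measurable_comp mQ) (L2_meas Lw) _.
        by move=> _ [x Ox <-]; split => //=; exact: JI.
      by apply: measurable_funTS; exact: pair2_measurable.
    have Lws : L2 nu Omega (fun x => w (x, s)).
      apply: (L2_ae_dom mO mws LWs); apply: filterS ws => x h' Ox.
      by rewrite h'.
    by rewrite /n (ae_eq_ip mO Lws LWs Lws ws) ipC (ae_eq_ip mO Lws LWs LWs ws).
  apply: le_trans e'e; apply: ip_close => //.
  have : ball T r s.
    move: Js; rewrite /J -ball_normE /= !in_itv /= => /andP[s1 s2].
    by rewrite gtr0_norm ?subr_gt0//; apply: lt_trans hr'; rewrite ltrBlDl -ltrBlDr.
  move=> /hr /(_ sI); rewrite sub0r normrN ger0_norm ?L2norm_ge0//.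
rewrite ler_norml; have hn0 : h != 0 by rewrite gt_eqF.
have hL k : h^-1 * (k * h) = k by rewrite mulrCA mulVf// mulr1.
apply/andP; split.
  rewrite lerBrDl -[X in X <= _](hL (L - e)) ler_pM2l ?invr_gt0// -Jcst ipn.
  apply: ae_le_Rintegral => //; apply: filterS ae_n => s h' Js.
  by have := h' Js; rewrite ler_norml lerBrDl => /andP[].
rewrite lerBlDr -[X in _ <= X](hL (e + L)) ler_pM2l ?invr_gt0// -Jcst ipn.
apply: ae_le_Rintegral => //; apply: filterS ae_n => s h' Js.
by have := h' Js; rewrite ler_norml lerBlDr => /andP[].
Qed.

End trace_average.

(** * Delays in time *)

Section time_shift.
Context {R : realType} {d : nat}.
Local Notation X := 'rV[R]_d.
Local Notation TR := (measurableTypeR R).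
Local Notation S := (X * measurableTypeR R)%type.
Local Notation mu := (@lebesgue_ST R d).
Local Notation nu := (lebesgue_rV R d).
Local Notation leb := (@lebesgue_measure R).
Implicit Types (w g : S -> R) (D : set S).

Definition time_shift (h : R) (z : S) : S := (z.1, (z.2 : R) + h).

Lemma time_shiftE (h : R) (z : S) : time_shift h z = z + h *: dir_t.
Proof.
case: z => x t; rewrite /time_shift /dir_t; congr (_, _) => /=.
  by rewrite scaler0 addr0.
by rewrite [h *: 1]mulr1.
Qed.

Lemma smooth_time_shift phi h : smooth phi -> smooth (phi \o time_shift h).
Proof.
move=> /(smooth_shift (h *: dir_t)); congr (smooth _).
by apply/funext => z /=; rewrite time_shiftE.
Qed.

Let time_shiftK h : cancel (time_shift (- h)) (time_shift h).
Proof. by case=> x t; rewrite /time_shift /= subrK. Qed.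

Let continuous_time_shift h : continuous (time_shift h).
Proof.
move=> z; rewrite (_ : time_shift h = fun z : S => z + h *: dir_t).
  by apply: cvgD; [exact: cvg_id|exact: cvg_cst].
by apply/funext => y; exact: time_shiftE.
Qed.

Lemma test_function_shift U phi h : test_function U phi ->
  test_function (time_shift h @^-1` U) (phi \o time_shift h).
Proof.
move=> [sphi cphi phiU].
apply: (@test_function_support _ _ _ (time_shift (- h) @` tsupp phi)).
- exact: smooth_time_shift.
- apply: continuous_compact cphi; apply: continuous_subspaceT.
  exact: continuous_time_shift.
- move=> z nz; exists (time_shift h z); first exact: (@tsupp_neq0 _ _ phi).
  by have := time_shiftK (- h) z; rewrite opprK.
- by move=> _ [z /phiU + <-]; rewrite /preimage /mkset time_shiftK.
Qed.

Let measurable_addr (h : R) : measurable_fun setT (fun t : TR => ((t : R) + h) : TR).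
Proof.
have : measurable_fun setT (fun t : R => t + h).
  by apply: continuous_measurable_fun => x; apply: cvgD; [exact: cvg_id|exact: cvg_cst].
by [].
Qed.

Lemma measurable_time_shift h : measurable_fun setT (time_shift h).
Proof.
apply/measurable_fun_pairP; split; first exact: measurable_fst.
by apply: (measurableT_comp (measurable_addr h)); exact: measurable_snd.
Qed.

Let lebesgue_shift h (A : set TR) : measurable A ->
  leb ((fun t : TR => ((t : R) + h) : TR) @^-1` A) = leb A.
Proof.
move=> mA.
rewrite [RHS](@lebesgue_measure_unique R (pushforward leb (fun t : TR => ((t : R) + h) : TR)))//.
move=> _ [[a b] _ <-] /=.
rewrite [RHS]/pushforward (_ : _ @^-1` _ = `]a - h, b - h]%classic); last first.
  by apply/seteqP; split => t /=; rewrite !in_itv /= ltrBlDr lerBrDr.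
rewrite !lebesgue_measure_itv /= !lte_fin ltrD2r; case: ifP => // _.
by rewrite -!EFinB; congr EFin; lra.
Qed.

(** By uniqueness of the product measure, from the translation invariance of the
    one-dimensional measure. *)
Lemma time_shift_measure h D : measurable D -> mu (time_shift h @^-1` D) = mu D.
Proof.
move=> mD; rewrite /lebesgue_ST /=.
rewrite [RHS](@product_measure_unique _ _ _ _ _ nu leb
  (measure_function_pushforward__canonical__measure_function_Measure mu
    (@measurable_time_shift h)))// => A B mA mB.
rewrite /= /pushforward.
have -> : time_shift h @^-1` (A `*` B) =
    A `*` ((fun t : TR => ((t : R) + h) : TR) @^-1` B).
  by apply/seteqP; split => -[].
have mB' := @measurable_addr h measurableT _ mB; rewrite setTI in mB'.
have := product_measure1E nu leb mA mB' => /= ->.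
by congr (_ * _)%E; exact: (lebesgue_shift h mB).
Qed.

Let ge0_shift h D (f : S -> \bar R) : measurable D -> measurable_fun D f ->
  (forall z, (0 <= f z)%E) ->
  (\int[mu]_(z in D) f z = \int[mu]_(z in time_shift h @^-1` D) f (time_shift h z))%E.
Proof.
move=> mD mf f0.
have := ge0_integral_pushforward (@measurable_time_shift h) mu mD mf (fun z _ => f0 z).
move=> <-; apply: eq_measure_integral => [|mf' A mA _]; first exact: measurable_time_shift.
exact: (esym (@time_shift_measure h A mA)).
Qed.

Let measurable_shift_set h D : measurable D -> measurable (time_shift h @^-1` D).
Proof. by move=> mD; rewrite -[X in measurable X]setTI; exact: measurable_time_shift. Qed.

Lemma L2_shift h D w : measurable D -> L2 mu D w ->
  L2 mu (time_shift h @^-1` D) (w \o time_shift h).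
Proof.
move=> mD [mw woo]; split.
  apply: (measurable_comp mD) mw _; first by move=> _ [z Dz <-].
  by apply: measurable_funTS; exact: measurable_time_shift.
rewrite -(@ge0_shift h D (fun z => (w z ^+ 2)%:E))//.
- by apply/measurable_EFinP; exact: measurable_funX.
- by move=> z; rewrite lee_fin sqr_ge0.
Qed.

Lemma ip_shift h D w g : measurable D -> L2 mu D w -> L2 mu D g ->
  ip mu D w g = ip mu (time_shift h @^-1` D) (w \o time_shift h) (g \o time_shift h).
Proof.
move=> mD Lw Lg; have mD' := measurable_shift_set h mD.
have sq v : L2 mu D v -> ip mu D v v =
    ip mu (time_shift h @^-1` D) (v \o time_shift h) (v \o time_shift h).
  move=> Lv; congr fine; apply: (@ge0_shift h D (fun z => (v z * v z)%:E)) => //.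
    by apply/measurable_EFinP/measurable_funM; exact: L2_meas Lv.
  by move=> z; rewrite lee_fin -expr2 sqr_ge0.
have p1 := ipDD mD 1 Lw Lg.
have p2 := ipDD mD' 1 (L2_shift h mD Lw) (L2_shift h mD Lg).
have := sq _ (L2D mD Lw (L2Z mD 1 Lg)).
rewrite [LHS]p1 [RHS]p2 -!sq// !mulr1 => /addIr/addrI.
by apply: mulfI.
Qed.

End time_shift.

Section backward_shift.
Context {R : realType} {d : nat}.
Local Notation X := 'rV[R]_d.
Local Notation S := (X * measurableTypeR R)%type.
Variables (Omega : set X) (T : R).
Hypotheses (oO : open Omega).
Local Notation mu := (@lebesgue_ST R d).
Local Notation Q := (cylinder Omega T).
Let mQ : measurable Q := measurable_cylinder T oO.
Let mO : measurable Omega := measurable_base oO.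
Implicit Types (w g : S -> R).

Definition slab s t : set S := Omega `*` `]s, t[.

Lemma measurable_slab s t : measurable (slab s t).
Proof. by apply: measurableX => //; exact: measurable_itv. Qed.

Lemma slab_sub s t s' t' : s' <= s -> t <= t' -> slab s t `<=` slab s' t'.
Proof.
move=> ss tt [x r] [/= Ox]; rewrite in_itv /= => /andP[r1 r2]; split => //=.
by rewrite in_itv /= (le_lt_trans ss r1) (lt_le_trans r2 tt).
Qed.

Definition cut (h : R) w : S -> R := fun z => if h < z.2 then w z else 0.

(** Delayed functions are extended by zero to the times before the delay, so that
    they live on the whole of Q. *)
Definition back (h : R) w : S -> R := cut h (w \o time_shift (- h)).

Lemma ip_sub D E w g : E `<=` D -> (forall z, D z -> ~ E z -> w z = 0) ->
  ip mu D w g = ip mu E w g.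
Proof.
move=> ED w0; rewrite /ip Rintegral_mkcond [RHS]Rintegral_mkcond.
apply: eq_Rintegral => z _; rewrite !patchE.
have [zE|zE] := boolP (z \in E).
  by rewrite mem_set//; apply: ED; exact: set_mem.
case: ifPn => // /set_mem zD; rewrite w0 ?mul0r//.
by move=> /mem_set h; rewrite h in zE.
Qed.

Lemma L2_sub D E w : measurable D -> measurable E -> E `<=` D ->
  (forall z, D z -> ~ E z -> w z = 0) -> L2 mu E w -> L2 mu D w.
Proof.
move=> mD mE ED w0 [mw woo].
have e : w \_ D = w \_ E.
  apply/funext => z; rewrite !patchE.
  have [zE|zE] := boolP (z \in E).
    by rewrite mem_set//; apply: ED; exact: set_mem.
  case: ifPn => // /set_mem zD; rewrite w0//.
  by move=> /mem_set h; rewrite h in zE.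
split; first by apply/(measurable_restrictT _ mD); rewrite e; apply/(measurable_restrictT _ mE).
rewrite (_ : (\int[mu]_(x in D) _ = \int[mu]_(x in E) (w x ^+ 2)%:E)%E)//.
rewrite integral_mkcond [RHS]integral_mkcond; apply: eq_integral => z _.
rewrite !patchE; have [zE|zE] := boolP (z \in E).
  by rewrite mem_set//; apply: ED; exact: set_mem.
case: ifPn => // /set_mem zD; rewrite w0 ?expr0n//.
by move=> /mem_set h; rewrite h in zE.
Qed.

Lemma cut_L2 h w : 0 <= h -> L2 mu Q w -> L2 mu Q (cut h w).
Proof.
move=> h0 Lw; have sub : slab h T `<=` Q by exact: slab_sub.
apply: (L2_sub mQ (measurable_slab h T) sub).
  move=> [x t] [/= Ox]; rewrite /cut /= in_itv /= => /andP[t0 tT]; case: ifP => // ht [].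
  by split => //=; rewrite in_itv /= ht.
have Ls := L2S mQ (measurable_slab h T) sub Lw.
apply: (L2_dom (measurable_slab h T) _ Ls).
  apply: eq_measurable_fun (L2_meas Ls) => -[x t] /set_mem[_]; rewrite /= in_itv /cut /=.
  by move=> /andP[-> _].
by move=> z _; rewrite /cut; case: ifP; rewrite ?normr0.
Qed.

Lemma cut_norm_le h w : 0 <= h -> L2 mu Q w ->
  ip mu Q (cut h w) (cut h w) <= ip mu Q w w.
Proof.
move=> h0 Lw; have Lc := cut_L2 h0 Lw.
apply: le_Rintegral => //; [exact: L2M_integrable|exact: L2M_integrable|].
move=> z _; rewrite /cut; case: ifP => // _; rewrite mul0r -expr2 sqr_ge0//.
Qed.

Let shift_slab h : time_shift (- h) @^-1` (slab 0 (T - h)) = slab h T.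
Proof.
by apply/seteqP; split => -[x t] [/= Ox]; rewrite in_itv /= => /andP[t0 tT]; split => //=;
  rewrite in_itv /=; apply/andP; split; lra.
Qed.

Let back_out h w z : Q z -> ~ slab h T z -> back h w z = 0.
Proof.
case: z => x t [/= Ox]; rewrite in_itv /= => /andP[t0 tT].
rewrite /back /cut /=; case: ifP => // ht []; split => //=.
by rewrite in_itv /= ht.
Qed.

Let back_in h w z : slab h T z -> back h w z = (w \o time_shift (- h)) z.
Proof. by case: z => x t [/= Ox]; rewrite in_itv /= => /andP[ht _]; rewrite /back /cut /= ht. Qed.

Lemma back_L2 h w : 0 <= h -> L2 mu Q w -> L2 mu Q (back h w).
Proof.
move=> h0 Lw; have sub : slab h T `<=` Q by exact: slab_sub.
have sub' : slab 0 (T - h) `<=` Q by apply: slab_sub; rewrite ?gerBl.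
apply: (L2_sub mQ (measurable_slab h T) sub); first exact: back_out.
have := L2_shift (- h) (measurable_slab _ _) (L2S mQ (measurable_slab 0 (T - h)) sub' Lw).
rewrite shift_slab => Ls; apply: (L2_dom (measurable_slab h T) _ Ls).
  by apply: eq_measurable_fun (L2_meas Ls) => z /set_mem hz; rewrite back_in.
by move=> z hz; rewrite back_in.
Qed.

(** Translation invariance moves the delay to the other factor. *)
Lemma ip_back h w g : 0 <= h -> L2 mu Q w -> L2 mu Q g ->
  ip mu Q (back h w) g = ip mu (slab 0 (T - h)) w (g \o time_shift h).
Proof.
move=> h0 Lw Lg; have sub : slab h T `<=` Q by exact: slab_sub.
have sub' : slab 0 (T - h) `<=` Q by apply: slab_sub; rewrite ?gerBl.
have ms := measurable_slab 0 (T - h).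
rewrite (ip_sub _ sub); last exact: back_out.
rewrite (@eq_ip _ _ _ mu (slab h T) _ (w \o time_shift (- h)) _ g); last first.
  by move=> z hz; rewrite back_in.
have Lg' := L2_shift h (measurable_slab h T) (L2S mQ (measurable_slab h T) sub Lg).
have e : time_shift h @^-1` (slab h T) = slab 0 (T - h).
  by apply/seteqP; split => -[x t] [/= Ox]; rewrite in_itv /= => /andP[t0 tT]; split => //=;
    rewrite in_itv /=; apply/andP; split; lra.
rewrite e in Lg'.
rewrite (ip_shift (- h) ms (L2S mQ ms sub' Lw) Lg') shift_slab.
apply: eq_ip => -[x t] _; rewrite /time_shift /=; congr (_ * g (_, _)).
by rewrite subrK.
Qed.

(** The delay loses exactly the mass of the last slab of height h. *)
Lemma back_norm_le h w : 0 <= h -> L2 mu Q w ->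
  ip mu Q (back h w) (back h w) <= ip mu Q w w.
Proof.
move=> h0 Lw; have sub' : slab 0 (T - h) `<=` Q by apply: slab_sub; rewrite ?gerBl.
rewrite (ip_back h0 Lw (back_L2 h0 Lw)).
rewrite (@eq_ip _ _ _ mu _ _ w _ w); first exact: (ipS_le mQ (measurable_slab _ _) sub' Lw).
move=> -[x t] [/= Ox]; rewrite in_itv /= => /andP[t0 tT].
by rewrite /back /cut /time_shift /= ltrDr t0 addrK.
Qed.

Lemma backB h w g z : back h (fun z => w z - g z) z = back h w z - back h g z.
Proof. by rewrite /back /cut; case: ifP => //; rewrite subr0. Qed.

Lemma ae_back h w g : 0 <= h -> L2 mu Q w -> L2 mu Q g ->
  {ae mu, forall z, Q z -> w z = g z} ->
  {ae mu, forall z, Q z -> back h w z = back h g z}.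
Proof.
move=> h0 Lw Lg wg; have Ld := L2B mQ Lw Lg; have Lb := back_L2 h0 Ld.
have d0 : ip mu Q (fun z => w z - g z) (fun z => w z - g z) = 0.
  rewrite (ae_eq_ip mQ Ld (L2_0 mu mQ) Ld) ?ip0l//.
  by apply: filterS wg => z h' Qz; rewrite h'// subrr.
have : ip mu Q (back h (fun z => w z - g z)) (back h (fun z => w z - g z)) = 0.
  by apply/eqP; rewrite eq_le ip_ge0 andbT -[X in _ <= X]d0 back_norm_le.
move=> /(ip_eq0 mQ Lb); apply: filterS => z h' Qz; have := h' Qz.
by rewrite backB => /eqP; rewrite subr_eq0 => /eqP.
Qed.

End backward_shift.

(** * Difference quotients in time *)

Section band.
Context {R : realType}.
Local Notation TR := (measurableTypeR R).
Local Notation leb := (@lebesgue_measure R).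

Definition band (h : R) : set (TR * TR) := [set z | (z.1 : R) - z.2 \in `]0, h[].

Lemma measurable_band h : measurable (band h).
Proof.
have m : measurable_fun setT (fun z : TR * TR => (z.1 : R) - z.2).
  by apply: measurable_funB; [exact: measurable_fst|exact: measurable_snd].
by have := m measurableT _ (measurable_itv `]0, h[); rewrite setTI.
Qed.

Let window_kernel (v : R -> R) (h : R) (z : TR * TR) : \bar R :=
  (v z.2 ^+ 2 * \1_(band h) z)%:E.

Variables (T h : R) (v : R -> R).
Local Notation I := (`]0, T[%classic : set TR).
Hypotheses (h0 : 0 < h) (Lv : L2 leb I v).
Let mI : measurable I. Proof. exact: measurable_itv. Qed.

Let mker : measurable_fun (I `*` I) (window_kernel v h).
Proof.
have [mv _] := L2_snd mI mI (itv_lebesgue_fin 0 T) Lv.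
apply/measurable_EFinP; apply: measurable_funM; first exact: measurable_funX.
by apply: measurable_funTS; apply: measurable_indic; exact: measurable_band.
Qed.

Let ker0 z : (0 <= window_kernel v h z)%E.
Proof. by rewrite lee_fin mulr_ge0 ?sqr_ge0// indicE ler0n. Qed.

Let windowE t : I t -> (\int[leb]_(s in I) window_kernel v h (t, s))%E =
  (ip leb `]Num.max 0 (t - h), t[ v v)%:E.
Proof.
move=> It; have mw : measurable (`]Num.max 0 (t - h), t[%classic : set TR).
  exact: measurable_itv.
have wI : `]Num.max 0 (t - h), t[ `<=` I.
  move=> s /=; move: It; rewrite /= !in_itv /= gt_max => /andP[t0 tT] /andP[/andP[s0 st] ts].
  by rewrite s0 (lt_trans ts tT).
rewrite fineK; last first.
  have Lw := L2S mI mw wI Lv.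
  exact: (integrable_fin_num mw (L2M_integrable mw Lw Lw)).
rewrite [LHS]integral_mkcond [RHS]integral_mkcond; apply: eq_integral => s _.
rewrite !patchE /window_kernel /= indicE.
have -> : (s \in `]Num.max 0 (t - h), t[%classic) = (s \in I) && ((t, s) \in band h).
  apply/idP/andP => [/set_mem|[/set_mem + /set_mem]].
    move=> sw; split; apply/mem_set; first exact: wI.
    move: sw; rewrite /band /= !in_itv /= gt_max => /andP[/andP[s0 st] ts].
    by apply/andP; split; lra.
  rewrite /band /= !in_itv /= => /andP[s0 sT] /andP[ts st]; apply/mem_set.
  by rewrite /= in_itv /= gt_max s0 /=; apply/andP; split; lra.
case: (s \in I) => //=; case: (_ \in _); rewrite ?mulr1 ?expr2//.
by rewrite mulr0.
Qed.

Lemma window_measurable :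
  measurable_fun I (fun t : TR => (ip leb `]Num.max 0 (t - h), t[ v v)%:E).
Proof.
have := tonelli_measurable leb mI mI mker ker0.
by apply: eq_measurable_fun => t /set_mem It; rewrite windowE.
Qed.

(** By Tonelli: a given s lies in windows whose right ends fill at most ]s, s+h[. *)
Lemma window_le : (\int[leb]_(t in I) (ip leb `]Num.max 0 (t - h), t[ v v)%:E <=
  (h * ip leb I v v)%:E)%E.
Proof.
rewrite (eq_integral (fun t => \int[leb]_(s in I) window_kernel v h (t, s)))%E; last first.
  by move=> t /set_mem It; rewrite windowE.
rewrite -(tonelli_setX leb leb mI mI mker ker0) (tonelli_setX2 leb leb mI mI mker ker0).
have Ih := integrableZl mI h (L2M_integrable mI Lv Lv).
have -> : (h * ip leb I v v)%:E = (\int[leb]_(s in I) (h%:E * (v s * v s)%:E))%E.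
  rewrite (integralZl mI (L2M_integrable mI Lv Lv)).
  by rewrite EFinM fineK// (integrable_fin_num mI (L2M_integrable mI Lv Lv)).
have mker' : measurable_fun (I `*` I) (fun z : TR * TR => window_kernel v h (z.2, z.1)).
  apply: (measurable_comp (measurableX mI mI) _ mker).
    by move=> _ [[a b] [/= ? ?] <-].
  apply: measurable_funTS.
  by apply: measurable_fun_pair; [exact: measurable_snd|exact: measurable_fst].
apply: ge0_le_integral => //.
- by move=> s _; exact: integral_ge0.
- exact: (tonelli_measurable leb mI mI mker' (fun z => ker0 (z.2, z.1))).
- by case/integrableP: Ih.
move=> s Is.
have mw : measurable (`]s, s + h[%classic : set TR) by exact: measurable_itv.
apply: (@le_trans _ _ (\int[leb]_(t in I) ((v s * v s)%:E * (\1_`]s, s + h[ t)%:E))%E).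
  apply: ge0_le_integral => //.
  - apply: (measurable_comp (measurableX mI mI) _ mker); first by move=> _ [t It <-].
    by apply: measurable_funTS; exact: pair2_measurable.
  - apply: measurable_funeM; apply/measurable_EFinP; apply: measurable_funTS.
    exact: measurable_indic.
  move=> t It; rewrite /window_kernel /= -EFinM lee_fin !indicE expr2.
  rewrite ler_wpM2l -?expr2 ?sqr_ge0// ler_nat.
  case: (boolP (_ \in band h)) => //= /set_mem ts; rewrite mem_set//.
  by move: ts; rewrite /band /= !in_itv /= => /andP[? ?]; apply/andP; split; lra.
have mi : measurable_fun I (fun t : TR => (\1_`]s, s + h[ t : R)%:E).
  by apply/measurable_EFinP; apply: measurable_funTS; exact: measurable_indic.
have i0 t : I t -> (0 <= (\1_(`]s, s + h[%classic : set TR) t : R)%:E)%E.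
  by rewrite lee_fin indicE ler0n.
have v0 : (0 <= (v s * v s)%:E)%E by rewrite lee_fin -expr2 sqr_ge0.
rewrite ge0_integralZl//.
rewrite muleC lee_wpmul2r ?lee_fin -?expr2 ?sqr_ge0//.
have lw : leb `]s, (s + h)%R[%classic = h%:E.
  by rewrite lebesgue_measure_itv /= lte_fin ltrDl h0 -EFinB addrC addKr.
rewrite integral_indic//; apply: (@le_trans _ _ (leb `]s, (s + h)%R[%classic)).
  by apply: le_measure; rewrite ?inE//; exact: measurableI.
by rewrite [X in (X <= _)%E]lw.
Qed.

End band.

Section difference_quotients.
Context {R : realType} {d : nat}.
Local Notation X := 'rV[R]_d.
Local Notation TR := (measurableTypeR R).
Local Notation S := (X * measurableTypeR R)%type.
Variables (Omega : set X) (T : R).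
Hypotheses (oO : open Omega) (bO : bounded_set Omega) (T0 : 0 < T).
Local Notation mu := (@lebesgue_ST R d).
Local Notation leb := (@lebesgue_measure R).
Local Notation Q := (cylinder Omega T).
Local Notation I := (`]0, T[%classic : set TR).
Local Notation ipL := ip.
Local Notation ip := (ip mu Q).
Local Notation L2 := (L2 mu Q).
Let mQ : measurable Q := measurable_cylinder T oO.
Let mO : measurable Omega := measurable_base oO.
Let mI : measurable I. Proof. exact: measurable_itv. Qed.
Implicit Types (w g : S -> R).

(** Each increment is the integral of g over a window of length at most h, which
    is estimated by Cauchy--Schwarz; [window_le] sums the windows. *)
Lemma prim_back_norm_le g h : 0 < h -> L2 g ->
  ip (fun z => prim g z - back h (prim g) z) (fun z => prim g z - back h (prim g) z)
  <= h ^+ 2 * ip g g.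
Proof.
move=> h0 Lg; have LG := prim_L2 oO Lg.
have LD : L2 (fun z => prim g z - back h (prim g) z).
  by apply: (L2B mQ) => //; apply: back_L2 => //; exact: ltW.
rewrite (ip_cylinder oO LD LD) -(ipZr mQ _ Lg Lg) (ip_cylinder oO Lg (L2Z mQ _ Lg)).
apply: ae_le_Rintegral => //; [exact: (ip_cylinder_integrable oO LD LD)|exact: (ip_cylinder_integrable oO Lg (L2Z mQ _ Lg))|].
apply: filterS2 (slice_L2 oO Lg) (slice_L2 oO LD) => x Lx LDx Ox.
have {}Lx := Lx Ox; have {}LDx := LDx Ox; rewrite (ipZr mI _ Lx Lx).
rewrite -lee_fin fineK; last exact: (integrable_fin_num mI (L2M_integrable mI LDx LDx)).
pose v t := g (x, t).
have mwin := window_measurable h Lx.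
apply: (@le_trans _ _ (\int[leb]_(t in I)
    (h%:E * (ipL leb `]Num.max 0 (t - h), t[ v v)%:E))%E).
  apply: ge0_le_integral => //.
  - by move=> t _; rewrite lee_fin -expr2 sqr_ge0.
  - by case/integrableP: (L2M_integrable mI LDx LDx).
  - exact: measurable_funeM.
  move=> t; rewrite /= in_itv /= => /andP[t0 tT]; rewrite -EFinM lee_fin -expr2.
  have m0 : 0 <= Num.max 0 (t - h) by rewrite le_max lexx.
  have mt : Num.max 0 (t - h) <= t by rewrite ge_max (ltW t0) lerBlDr lerDl ltW.
  have -> : prim g (x, t) - back h (prim g) (x, t) =
      \int[leb]_(r in `]Num.max 0 (t - h), t[) v r.
    rewrite -(prim_diff Lx m0 mt (ltW tT)); congr (_ - _).
    rewrite /back /cut /time_shift /=; have [ht|ht] := ltP h t.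
      by rewrite max_r ?subr_ge0 ?ltW.
    by rewrite max_l ?subr_le0// /prim /= set_itvoo0 ?Rintegral_set0.
  have wI : `]Num.max 0 (t - h), t[ `<=` I.
    move=> s /=; rewrite !in_itv /= => /andP[s0 st].
    by rewrite (le_lt_trans m0 s0) (lt_trans st tT).
  have mw : measurable (`]Num.max 0 (t - h), t[%classic : set TR) by exact: measurable_itv.
  apply: le_trans (Rintegral_sqr_le mt (L2S mI mw wI Lx)) _.
  rewrite ler_wpM2r ?ip_ge0// lerBlDr -lerBlDl le_max lexx orbT//.
rewrite ge0_integralZl//; last 2 first.
- by move=> t _; rewrite lee_fin ip_ge0.
- by rewrite lee_fin ltW.
rewrite expr2 -mulrA EFinM lee_wpmul2l ?lee_fin ?(ltW h0)//.
exact: window_le.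
Qed.

Lemma ip_bounded_le (D_ : (S -> R)^nat) C psi : (forall n, L2 (D_ n)) -> 0 <= C ->
  (forall n, ip (D_ n) (D_ n) <= C) -> L2 psi -> forall n,
  `|ip (D_ n) psi| <= Num.sqrt C * Num.sqrt (ip psi psi).
Proof.
move=> LD C0 DC Lpsi n; apply: le_trans (ip_CS_sqrt mQ (LD n) Lpsi) _.
by rewrite ler_wpM2r ?sqrtr_ge0// ler_wsqrtr.
Qed.

Let sqrt_cvg0 (a : R^nat) : a n @[n --> \oo] --> (0 : R) ->
  Num.sqrt (a n) @[n --> \oo] --> (0 : R).
Proof.
move=> ca; have := @sqrt_continuous R 0; rewrite /continuous_at sqrtr0 => c.
exact: (cvg_comp _ _ ca c).
Qed.

Let dist_le_three (a c p q e : R) : `|q - p| <= e / 3 -> `|p - a| <= e / 3 ->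
  `|q - c| <= e / 3 -> `|c - a| <= e.
Proof.
by rewrite !ler_norml => /andP[? ?] /andP[? ?] /andP[? ?]; apply/andP; split; lra.
Qed.

Let scaled_third (K e : R) : K != 0 -> K * (e / (3 * K)) = e / 3.
Proof. by move=> K0; field. Qed.

Let le_of_split (e p q a : R) : a <= 2 * p + 2 * (2 * q + 2 * q) -> p <= e / 4 -> q <= e / 16 ->
  a <= e.
Proof. by move=> ? ? ?; lra. Qed.

(** By the uniform bound the functions psi for which the convergence holds are
    closed under L2-limits, so [L2_bump_ind] extends it from bumps to L2(Q). *)
Lemma weak_cvg_test (D_ : (S -> R)^nat) C g : (forall n, L2 (D_ n)) -> 0 <= C ->
  (forall n, ip (D_ n) (D_ n) <= C) -> L2 g ->
  (forall phi, test_function Q phi -> ip (D_ n) phi @[n --> \oo] --> ip g phi) ->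
  forall psi, L2 psi -> ip (D_ n) psi @[n --> \oo] --> ip g psi.
Proof.
move=> LD C0 DC Lg test; pose P psi := ip (D_ n) psi @[n --> \oo] --> ip g psi.
apply: (@L2_bump_ind _ _ _ _ oO bO P) => [k a b s t bQ|a p q Lp Lq Pp Pq|p_ p Lp_ Pp Lp cp].
- by apply: test; exact: test_function_bump.
- rewrite /P (ipDr mQ Lg Lp (L2Z mQ a Lq)) (ipZr mQ a Lg Lq).
  have e n : ip (D_ n) (fun z => p z + a * q z) = ip (D_ n) p + a * ip (D_ n) q.
    by rewrite (ipDr mQ (LD n) Lp (L2Z mQ a Lq)) (ipZr mQ a (LD n) Lq).
  under eq_fun do rewrite e.
  by apply: cvgD => //; apply: cvgM => //; exact: cvg_cst.
rewrite /P; apply/cvgrPdist_le => /= e e0.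
pose K := Num.sqrt C + Num.sqrt (ip g g) + 1.
have K0 : 0 < K by rewrite ltr_pwDr// addr_ge0 ?sqrtr_ge0.
have e3 : 0 < e / (3 * K) by rewrite divr_gt0// mulr_gt0.
have /cvgrPdist_le /(_ _ e3) [k _ hk] := sqrt_cvg0 cp.
have Ld : L2 (fun z => p_ k z - p z) := L2B mQ (Lp_ k) Lp.
have dk : Num.sqrt (ip (fun z => p_ k z - p z) (fun z => p_ k z - p z)) <= e / (3 * K).
  by have := hk k (leqnn k); rewrite /= sub0r normrN ger0_norm ?sqrtr_ge0.
have e3' : 0 < e / 3 by rewrite divr_gt0.
have /cvgrPdist_le /(_ _ e3') [N _ hN] := Pp k.
exists N => // n /= Nn; have := hN n Nn => /= h1.
have h2 := ip_bounded_le LD C0 DC Ld n.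
have h3 := ip_CS_sqrt mQ Lg Ld.
rewrite (ipBr mQ (LD n) (Lp_ k) Lp) in h2.
rewrite (ipBr mQ Lg (Lp_ k) Lp) in h3.
have h4 : Num.sqrt C * Num.sqrt (ip (fun z => p_ k z - p z) (fun z => p_ k z - p z)) <= e / 3.
  apply: (@le_trans _ _ (K * (e / (3 * K)))).
    by rewrite ler_pM ?sqrtr_ge0// /K -addrA lerDl addr_ge0 ?sqrtr_ge0.
  by rewrite scaled_third ?gt_eqF.
have h5 : Num.sqrt (ip g g) * Num.sqrt (ip (fun z => p_ k z - p z) (fun z => p_ k z - p z)) <= e / 3.
  apply: (@le_trans _ _ (K * (e / (3 * K)))).
    by rewrite ler_pM ?sqrtr_ge0// /K addrAC lerDr addr_ge0 ?sqrtr_ge0.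
  by rewrite scaled_third ?gt_eqF.
exact: (dist_le_three h1 (le_trans h2 h4) (le_trans h3 h5)).
Qed.

Section sequence.
Variable h : R^nat.
Hypotheses (h0 : forall n, 0 < h n) (h_cvg0 : h n @[n --> \oo] --> (0 : R)).

Let hge0 n : 0 <= h n. Proof. exact: ltW. Qed.

(** Continuity of translations in L2(Q): clear on bumps by dominated convergence,
    and inherited by limits because delays are contractions. *)
Lemma back_cvg psi : L2 psi ->
  ip (fun z => back (h n) psi z - psi z) (fun z => back (h n) psi z - psi z)
    @[n --> \oo] --> (0 : R).
Proof.
pose P psi := ip (fun z => back (h n) psi z - psi z) (fun z => back (h n) psi z - psi z)
    @[n --> \oo] --> (0 : R).
apply: (@L2_bump_ind _ _ _ _ oO bO P) => [k a b s t bQ|a p q Lp Lq Pp Pq|p_ p Lp_ Pp Lp cp].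
- have := test_function_bump k bQ; move: (prodfun _ _ _ _) => phi tphi.
  have Lphi := L2Q_test T oO bO tphi.
  have [M hM] := test_function_bounded tphi; have [sphi _ _] := tphi.
  have [|z Qz|||_ _ +] := @L2_dominated_cvg _ _ _ mu Q mQ (fun n => back (h n) phi) phi (fun=> `|M|).
  + by move=> n; exact: L2_meas (back_L2 oO (hge0 n) Lphi).
  + have -> : phi z = phi (z.1, z.2 - 0) by rewrite subr0 -surjective_pairing.
    have c : (phi \o (fun r => (z.1, z.2 - r) : S)) (h n) @[n --> \oo] --> phi (z.1, z.2 - 0).
      have cc : (fun r => (z.1, z.2 - r) : S) r @[r --> (0 : R)] --> ((z.1, z.2 - 0) : S).
        apply: (@cvg_pair _ _ _ (nbhs (0 : R)) (nbhs z.1) (nbhs (z.2 - 0))).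
          exact: cvg_cst.
        by apply: cvgB; [exact: cvg_cst|exact: cvg_id].
      apply: (cvg_comp _ _ h_cvg0).
      by apply: (cvg_comp _ _ cc); exact: (smooth_continuous sphi).
    apply: cvg_trans c; apply: near_eq_cvg.
    have z20 : 0 < z.2 by case: Qz => _; rewrite /= in_itv /= => /andP[].
    have [N _ hN] := cvgr_lt _ h_cvg0 _ z20; exists N => // n /hN hn.
    by rewrite /back /cut /= hn.
  + exact: L2_cst mQ _ (cylinder_fin T oO bO).
  + move=> n z _; rewrite /back /cut; case: ifP => _; last by rewrite normr0.
    by rewrite (le_trans (hM _))// ler_norm.
  by [].
- rewrite /P.
  have Lb n u : L2 u -> L2 (fun z => back (h n) u z - u z).
    by move=> Lu; apply: (L2B mQ) => //; exact: back_L2.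
  apply: (@squeeze_cvgr _ _ _ _ (fun=> 0) (fun n =>
    2 * ip (fun z => back (h n) p z - p z) (fun z => back (h n) p z - p z) +
    2 * (a ^+ 2 * ip (fun z => back (h n) q z - q z) (fun z => back (h n) q z - q z)))).
  + apply: nearW => n; rewrite ip_ge0 /=.
    have := ip_sqrD_le mQ (Lb n _ Lp) (L2Z mQ a (Lb n _ Lq)).
    rewrite (ipZl mQ a (Lb n _ Lq) (L2Z mQ a (Lb n _ Lq))) (ipZr mQ a (Lb n _ Lq) (Lb n _ Lq)).
    rewrite (mulrA a a) -expr2; apply: le_trans; rewrite le_eqVlt; apply/orP; left; apply/eqP.
    apply: eq_ip => z _; congr (_ * _); rewrite /back /cut /=; case: ifP => _; ring.
  + exact: cvg_cst.
  + rewrite [X in _ --> X](_ : 0 = 2 * 0 + 2 * (a ^+ 2 * 0)); last by rewrite !mulr0 addr0.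
    by apply: cvgD; apply: cvgM; do ?exact: cvg_cst; [exact: Pp|apply: cvgM; [exact: cvg_cst|exact: Pq]].
- rewrite /P; apply/cvgrPdist_le => /= e e0.
  have e16 : 0 < e / 16 by rewrite divr_gt0.
  have e4 : 0 < e / 4 by rewrite divr_gt0.
  have /cvgrPdist_le /(_ _ e16) [k _ hk] := cp.
  have /cvgrPdist_le /(_ _ e4) [N _ hN] := Pp k.
  exists N => // n /= Nn; rewrite sub0r normrN ger0_norm ?ip_ge0//.
  have Ld : L2 (fun z => p_ k z - p z) := L2B mQ (Lp_ k) Lp.
  have := hk k (leqnn k); rewrite /= sub0r normrN ger0_norm ?ip_ge0// => h1.
  have := hN n Nn; rewrite /= sub0r normrN ger0_norm ?ip_ge0// => h2.
  have Lb u : L2 u -> L2 (fun z => back (h n) u z - u z).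
    by move=> Lu; apply: (L2B mQ) => //; exact: back_L2.
  have h3 := ip_sqrB_le mQ (back_L2 oO (hge0 n) Ld) Ld.
  have h4 := back_norm_le oO (hge0 n) Ld.
  have h5 := ip_sqrB_le mQ (Lb _ (Lp_ k)) (Lb _ Ld).
  refine (le_of_split _ h2 h1).
  have -> : ip (fun z => back (h n) p z - p z) (fun z => back (h n) p z - p z) =
      ip (fun z => back (h n) (p_ k) z - p_ k z -
            (back (h n) (fun z => p_ k z - p z) z - (p_ k z - p z)))
         (fun z => back (h n) (p_ k) z - p_ k z -
            (back (h n) (fun z => p_ k z - p z) z - (p_ k z - p z))).
    by apply: eq_ip => z _; congr (_ * _); rewrite backB; ring.
  apply: (le_trans h5); rewrite lerD2l ler_wpM2l//; apply: (le_trans h3).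
  by rewrite lerD2r ler_wpM2l.
Qed.

End sequence.

End difference_quotients.

Section weak_difference_quotients.
Context {R : realType} {d : nat}.
Local Notation X := 'rV[R]_d.
Local Notation TR := (measurableTypeR R).
Local Notation S := (X * measurableTypeR R)%type.
Variables (Omega : set X) (T : R).
Hypotheses (oO : open Omega) (bO : bounded_set Omega) (T0 : 0 < T).
Local Notation mu := (@lebesgue_ST R d).
Local Notation leb := (@lebesgue_measure R).
Local Notation Q := (cylinder Omega T).
Local Notation I := (`]0, T[%classic : set TR).
Local Notation ip := (ip mu Q).
Local Notation L2 := (L2 mu Q).
Let mQ : measurable Q := measurable_cylinder T oO.
Let mO : measurable Omega := measurable_base oO.
Let mI : measurable I. Proof. exact: measurable_itv. Qed.
Let Ioo : (leb I < +oo)%E. Proof. exact: itv_lebesgue_fin. Qed.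
Implicit Types (w g : S -> R).

Lemma weak_strong_cvg (D_ psi_ : (S -> R)^nat) C g psi :
  (forall n, L2 (D_ n)) -> 0 <= C -> (forall n, ip (D_ n) (D_ n) <= C) ->
  ip (D_ n) psi @[n --> \oo] --> ip g psi ->
  (forall n, L2 (psi_ n)) -> L2 psi ->
  ip (fun z => psi_ n z - psi z) (fun z => psi_ n z - psi z) @[n --> \oo] --> (0 : R) ->
  ip (D_ n) (psi_ n) @[n --> \oo] --> ip g psi.
Proof.
move=> LD C0 DC Dg Lpsi_ Lpsi cpsi.
have Ld n : L2 (fun z => psi_ n z - psi z) := L2B mQ (Lpsi_ n) Lpsi.
have e n : ip (D_ n) (psi_ n) = ip (D_ n) psi + ip (D_ n) (fun z => psi_ n z - psi z).
  by rewrite (ipBr mQ (LD n) (Lpsi_ n) Lpsi) addrC subrK.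
under eq_fun do rewrite e.
have -> : ip g psi = ip g psi + 0 by rewrite addr0.
apply: cvgD => //.
have s : Num.sqrt C * Num.sqrt (ip (fun z => psi_ n z - psi z) (fun z => psi_ n z - psi z))
    @[n --> \oo] --> (0 : R).
  rewrite -(mulr0 (Num.sqrt C)); apply: cvgM; first exact: cvg_cst.
  have := @sqrt_continuous R 0; rewrite /continuous_at sqrtr0 => c.
  exact: (cvg_comp _ _ cpsi c).
apply/norm_cvg0P; apply: (@squeeze_cvgr _ _ _ _ (fun=> 0) _ _ _ 0 _ s); last exact: cvg_cst.
apply: nearW => n; rewrite normr_ge0 /=; apply: le_trans (ip_CS_sqrt mQ (LD n) (Ld n)) _.
by rewrite ler_wpM2r ?sqrtr_ge0// ler_wsqrtr.
Qed.

Section sequence.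
Variable h : R^nat.
Hypotheses (h0 : forall n, 0 < h n) (h_cvg0 : h n @[n --> \oo] --> (0 : R)).

Let hge0 n : 0 <= h n. Proof. exact: ltW. Qed.

(** The quotient is moved to the test function, where it converges to minus the
    time derivative, dominated by the maximum of the latter. *)
Lemma test_difference_cvg w g phi : L2 w ->
  is_weak_partial Omega T (@dir_t R d) w g -> test_function Q phi ->
  (h n)^-1 * (ip w phi - ip (back (h n) w) phi) @[n --> \oo] --> ip g phi.
Proof.
move=> Lw [Lg wg] tphi; have [sphi _ supp] := tphi; have Lphi := L2Q_test T oO bO tphi.
pose v := @dir_t R d.
have tDphi := test_function_derive v tphi.
have LDphi := L2Q_test T oO bO tDphi.
have [M hM] := test_function_bounded tDphi.
have Lshift k : L2 (fun z => phi (time_shift k z)) := L2Q_test T oO bO (test_function_shift k tphi).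
pose q n z := (h n)^-1 * (phi (time_shift (h n) z) - phi z).
have Lq n : L2 (q n) by apply: (L2Z mQ); exact: (L2B mQ (Lshift (h n)) Lphi).
have qE n : (h n)^-1 * (ip w phi - ip (back (h n) w) phi) = - ip w (q n).
  have -> : ip (back (h n) w) phi = ip w (fun z => phi (time_shift (h n) z)).
    rewrite (ip_back oO (hge0 n) Lw Lphi) ipC [RHS]ipC.
    rewrite [RHS](@ip_sub _ _ Q (slab Omega 0 (T - h n)))//.
      by apply: slab_sub => //; rewrite gerBl.
    move=> [x t] [/= Ox]; rewrite in_itv /= => /andP[t0 tT] nz.
    apply/eqP; apply: contra_notT nz => /tsupp_neq0 /supp [_].
    by rewrite /time_shift /= in_itv /= => /andP[_ ht]; split => //=; rewrite in_itv /= t0 ltrBrDr.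
  rewrite (ipZr mQ _ Lw (L2B mQ (Lshift _) Lphi)) (ipBr mQ Lw (Lshift _) Lphi).
  by rewrite -mulrN opprB.
under eq_fun do rewrite qE.
have -> : ip g phi = - ip w ('D_v phi) by rewrite /v [ip w _](wg _ tphi) opprK.
apply: cvgN.
have [|z Qz|||_ _ c] := @L2_dominated_cvg _ _ _ mu Q mQ q ('D_v phi) (fun=> `|M|).
- by move=> n; exact: L2_meas (Lq n).
- have [dz _] := smooth_is_derive z v sphi.
  have hd : h n @[n --> \oo] --> (0 : R)^'.
    move=> A /h_cvg0 [N _ hN]; exists N => // n /hN; apply; by rewrite gt_eqF.
  have c := cvg_comp _ _ hd dz.
  apply: cvg_trans c; apply: near_eq_cvg; apply: nearW => n.
  by rewrite /q /= time_shiftE [z + _]addrC.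
- exact: L2_cst mQ _ (cylinder_fin T oO bO).
- move=> n z _; have [t _ e] := mean_value_line z v sphi (h0 n).
  rewrite /q time_shiftE [z + _]addrC e mulrCA mulVf ?gt_eqF// mulr1.
  by rewrite (le_trans (hM _))// ler_norm.
rewrite ipC; under eq_fun do rewrite ipC.
exact: (ip_cvgl mQ Lq LDphi Lw c).
Qed.

(** A function with zero initial trace is the primitive of its time derivative, so
    extending it by zero to negative times creates no jump: its full backward
    difference quotients are bounded and converge weakly. *)
Lemma back_quotient_cvg w g : L2 w -> is_weak_partial Omega T (@dir_t R d) w g ->
  {ae mu, forall z, Q z -> w z = prim g z} ->
  let D_ n z := (h n)^-1 * (w z - back (h n) w z) in
  [/\ forall n, L2 (D_ n), forall n, ip (D_ n) (D_ n) <= ip g g &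
    forall psi, L2 psi -> ip (D_ n) psi @[n --> \oo] --> ip g psi].
Proof.
move=> Lw wg wprim D_; have [Lg _] := wg; have LG := prim_L2 oO Lg.
have Ld n : L2 (fun z => w z - back (h n) w z).
  by apply: (L2B mQ) => //; exact: back_L2.
have LD n : L2 (D_ n) by exact: L2Z.
have Db n : ip (D_ n) (D_ n) <= ip g g.
  rewrite (ipZl mQ _ (Ld n) (LD n)) (ipZr mQ _ (Ld n) (Ld n)) mulrA.
  have LdG : L2 (fun z => prim g z - back (h n) (prim g) z).
    by apply: (L2B mQ) => //; exact: back_L2.
  have ed : {ae mu, forall z, Q z -> w z - back (h n) w z = prim g z - back (h n) (prim g) z}.
    by apply: filterS2 wprim (ae_back oO (hge0 n) Lw LG wprim) => z h1 h2 Qz; rewrite h1// h2.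
  rewrite (ae_eq_ip mQ (Ld n) LdG (Ld n) ed) ipC (ae_eq_ip mQ (Ld n) LdG LdG ed).
  rewrite -expr2 exprVn ler_pdivrMl ?exprn_gt0//.
  exact: prim_back_norm_le.
split => //; apply: (weak_cvg_test oO bO LD (ip_ge0 _ _ _) Db Lg) => phi tphi.
have Lphi := L2Q_test T oO bO tphi.
have e n : ip (D_ n) phi = (h n)^-1 * (ip w phi - ip (back (h n) w) phi).
  by rewrite (ipZl mQ _ (Ld n) Lphi) (ipBl mQ Lw (back_L2 oO (hge0 n) Lw) Lphi).
under eq_fun do rewrite e.
exact: test_difference_cvg.
Qed.

(* the support of a test function is compact, hence at a positive distance from
   the initial face *)
Let test_late phi : test_function Q phi ->
  \forall n \near \oo, forall z, phi z != 0 -> h n < z.2.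
Proof.
move=> [_ cK KQ].
have /compact_near_coveringP /(_ _ \oo (fun n z => h n < z.2)) := cK.
have near_time z : tsupp phi z ->
    \forall z' \near z & n \near \oo, h n < z'.2.
  move=> /KQ [_]; rewrite /= in_itv /= => /andP[z0 _].
  have z20 : 0 < z.2 / 2 by rewrite divr_gt0.
  have c : continuous (fun z : S => z.2 : R) by move=> u; exact: cvg_snd.
  exists ([set z' : S | z.2 / 2 < z'.2], [set n | h n < z.2 / 2]).
    split => /=; last exact: (cvgr_lt _ h_cvg0).
    by apply: (cvgr_gt _ (c z)); rewrite ltr_pdivrMr// mulr_natr mulr2n ltrDl.
  by move=> [z' n] [/= h1 h2]; exact: lt_trans h2 h1.
move=> /(_ _ near_time); apply: filterS => n nK z /tsupp_neq0.
exact: nK.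
Qed.

(** Without an initial condition the quotient has to be cut off at the times t < h,
    where the extension by zero would contribute a term of order 1/h; the
    integration constant cancels at the other times. *)
Lemma cut_quotient_cvg w g : L2 w -> is_weak_partial Omega T (@dir_t R d) w g ->
  let D_ n z := (h n)^-1 * cut (h n) (fun z => w z - back (h n) w z) z in
  [/\ forall n, L2 (D_ n), forall n, ip (D_ n) (D_ n) <= ip g g &
    forall psi, L2 psi -> ip (D_ n) psi @[n --> \oo] --> ip g psi].
Proof.
move=> Lw wg D_; have [Lg _] := wg; have LG := prim_L2 oO Lg.
have [c [Lc wc]] := weak_dt_primitive oO bO T0 Lw wg.
have Ld n : L2 (fun z => w z - back (h n) w z).
  by apply: (L2B mQ) => //; exact: back_L2.
have Lcut n := cut_L2 oO (hge0 n) (Ld n).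
have LD n : L2 (D_ n) by exact: L2Z.
have Db n : ip (D_ n) (D_ n) <= ip g g.
  rewrite (ipZl mQ _ (Lcut n) (LD n)) (ipZr mQ _ (Lcut n) (Lcut n)) mulrA.
  have LdG : L2 (fun z => prim g z - back (h n) (prim g) z).
    by apply: (L2B mQ) => //; exact: back_L2.
  have LcG := cut_L2 oO (hge0 n) LdG.
  have LcpG : L2 (fun z => c z.1 + prim g z).
    apply: (L2D mQ) => //.
    exact: (L2_fst mO mI Ioo Lc).
  have ed : {ae mu, forall z, Q z -> cut (h n) (fun z => w z - back (h n) w z) z =
      cut (h n) (fun z => prim g z - back (h n) (prim g) z) z}.
    apply: filterS2 wc (ae_back oO (hge0 n) Lw LcpG wc) => z h1 h2 Qz.
    rewrite /cut; case: ifPn => // hz; rewrite h1// h2// /back /cut hz /=.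
    by rewrite opprD addrACA subrr add0r.
  rewrite (ae_eq_ip mQ (Lcut n) LcG (Lcut n) ed) ipC (ae_eq_ip mQ (Lcut n) LcG LcG ed).
  rewrite -expr2 exprVn ler_pdivrMl ?exprn_gt0//.
  by apply: le_trans (cut_norm_le oO (hge0 n) LdG) _; exact: prim_back_norm_le.
split => //; apply: (weak_cvg_test oO bO LD (ip_ge0 _ _ _) Db Lg) => phi tphi.
have Lphi := L2Q_test T oO bO tphi.
have := test_difference_cvg Lw wg tphi.
apply: cvg_trans; apply: near_eq_cvg; apply: filterS (test_late tphi) => n late.
rewrite (ipZl mQ _ (Lcut n) Lphi); congr (_ * _).
rewrite -(ipBl mQ Lw (back_L2 oO (hge0 n) Lw) Lphi); apply: eq_ip => z _.
have [->|/late hz] := eqVneq (phi z) 0; first by rewrite !mulr0.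
by rewrite /cut hz.
Qed.

End sequence.

End weak_difference_quotients.

(** * Green's formula with a delay *)

Section green.
Context {R : realType} {d : nat}.
Local Notation X := 'rV[R]_d.
Local Notation TR := (measurableTypeR R).
Local Notation S := (X * measurableTypeR R)%type.
Variables (Omega : set X) (T : R).
Hypotheses (oO : open Omega) (bO : bounded_set Omega) (T0 : 0 < T).
Local Notation mu := (@lebesgue_ST R d).
Local Notation Q := (cylinder Omega T).
Local Notation ip := (ip mu Q).
Local Notation L2 := (L2 mu Q).
Let mQ : measurable Q := measurable_cylinder T oO.
Implicit Types (w g : S -> R).

Lemma cvg_sumr n (f : nat -> 'I_n -> R) (l : 'I_n -> R) :
  (forall i, f k i @[k --> \oo] --> l i) -> \sum_i f k i @[k --> \oo] --> \sum_i l i.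
Proof.
elim: n f l => [|n IH] f l h.
  by rewrite big_ord0; under eq_fun do rewrite big_ord0; exact: cvg_cst.
rewrite big_ord_recl; under eq_fun do rewrite big_ord_recl.
exact: cvgD (h ord0) (IH (fun k i => f k (lift ord0 i)) _ (fun i => h (lift ord0 i))).
Qed.

Let is_derive_time (chi : R -> R) (i : 'I_d) (z : S) :
  is_derive z (dir_x i) (fun z : S => chi z.2) 0.
Proof.
apply/is_derive_lineE.
have -> : (fun t : R => chi (t *: dir_x i + z).2) = cst (chi z.2).
  by apply/funext => t /=; rewrite scaler0 add0r.
exact: is_derive_cst.
Qed.

Let closed_time (a b : R) : closed [set z : S | z.2 \in `[a, b]].
Proof.
have c : continuous (fun z : S => z.2 : R) by move=> u; exact: cvg_snd.
have cl : closed (`[a, b]%classic : set R) by exact: itv_closed.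
exact: (@preimage_closed _ _ (fun z : S => z.2 : R) _ (fun z _ => c z) cl).
Qed.

(** Functions that are only supported away from the lateral boundary become test
    functions of Q once they are cut off in time. *)
Lemma test_function_delay phi (h a b : R) k : test_function (Omega `*` setT) phi ->
  0 < a -> b < T ->
  test_function Q (fun z : S => phi (time_shift (- h) z) * plateau k a b z.2).
Proof.
move=> tphi a0 bT.
have [ss cs sub] := test_function_shift (- h) tphi.
apply: (@test_function_support _ _ _
  (tsupp (phi \o time_shift (- h)) `&` [set z | z.2 \in `[a, b]])).
- apply: smoothM ss _.
  by apply: smooth_comp; [exact: smooth_plateau|exact: smooth_time].
- by apply: compact_closedI; [exact: cs|exact: closed_time].
- move=> z nz; split.
    by apply: tsupp_neq0; apply: contra_neq nz => /= ->; rewrite mul0r.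
  have : z.2 \in `]a, b[ by apply: contraNT nz => /plateau_out ->; rewrite mulr0.
  exact: subset_itv_oo_cc.
- move=> z [/sub [Oz _]]; rewrite /= in_itv /= => /andP[az zb].
  by split => //=; rewrite in_itv /= (lt_le_trans a0 az) (le_lt_trans zb bT).
Qed.

Section test_green.
Variables (phi : S -> R) (h : R) (F : S -> X) (k : S -> R).
Hypotheses (tphi : test_function (Omega `*` setT) phi) (h0 : 0 <= h).
Hypotheses (LF : L2vec mu Q F) (Fk : is_weak_div Omega T F k).

Let delayed (u : S -> R) (chi : R -> R) : S -> R :=
  fun z => u (time_shift (- h) z) * chi z.2.

Let P (chi : R -> R) :=
  \sum_i ip (delayed ('D_(dir_x i) phi) chi) (fun z => F z ord0 i) = - ip (delayed phi chi) k.

(* The cutoff depends on time only, so the space derivatives in [P] do not act on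
   it, and [P] survives bounded pointwise limits of cutoffs: smooth plateaus give
   indicators of compactly contained intervals, and these exhaust ]h, T[. *)
Let P_lim (chi_ : (R -> R)^nat) chi : (forall n, measurable_fun setT (chi_ n)) ->
  (forall n t, `|chi_ n t| <= 1) ->
  (forall t, t \in `]0, T[ -> chi_ n t @[n --> \oo] --> chi t) ->
  (forall n, P (chi_ n)) -> P chi.
Proof.
move=> mchi chi1 cchi Pn; have [Lk _] := Fk.
have lim u g : test_function (Omega `*` setT) u -> L2 g ->
    ip (delayed u (chi_ n)) g @[n --> \oo] --> ip (delayed u chi) g.
  move=> tu Lg; have [M hM] := test_function_bounded tu; have [su _ _] := tu.
  have [|z Qz|||Ld Ldn c] := @L2_dominated_cvg _ _ _ mu Q mQ (fun n => delayed u (chi_ n))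
      (delayed u chi) (fun=> `|M|).
  - move=> n; apply: measurable_funTS; apply: measurable_funM.
      apply: measurableT_comp (measurable_time_shift _).
      by apply: continuous_measurable_ST; exact: smooth_continuous.
    exact: measurableT_comp (mchi n) measurable_snd.
  - by apply: cvgM; [exact: cvg_cst|apply: cchi; case: Qz].
  - exact: L2_cst mQ _ (cylinder_fin T oO bO).
  - move=> n z _; rewrite normrM -[leRHS]mulr1 ler_pM//.
    by rewrite (le_trans (hM _))// ler_norm.
  exact: (ip_cvgl mQ Ldn Ld Lg c).
have c1 : \sum_i ip (delayed ('D_(dir_x i) phi) (chi_ n)) (fun z => F z ord0 i)
    @[n --> \oo] --> \sum_i ip (delayed ('D_(dir_x i) phi) chi) (fun z => F z ord0 i).
  apply: cvg_sumr => i; apply: lim => //; exact: test_function_derive.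
have c2 : - ip (delayed phi (chi_ n)) k @[n --> \oo] --> - ip (delayed phi chi) k.
  by apply: cvgN; exact: lim.
have e : (fun n => - ip (delayed phi (chi_ n)) k) =
    fun n => \sum_i ip (delayed ('D_(dir_x i) phi) (chi_ n)) (fun z => F z ord0 i).
  by apply/funext => n; rewrite -Pn.
by rewrite e in c2; exact: cvg_unique c1 c2.
Qed.

Let P_plateau n a b : 0 < a -> b < T -> P (plateau n a b).
Proof.
move=> a0 bT; have t := test_function_delay h n tphi a0 bT.
have := weak_divE oO bO LF Fk t; have [sphi _ _] := tphi.
rewrite /P ipC => <-; apply: eq_bigr => i _; rewrite ipC; apply: eq_ip => z _.
congr (_ * _).
have d1 : is_derive z (dir_x i) (fun z => phi (time_shift (- h) z))
    ('D_(dir_x i) phi (time_shift (- h) z)).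
  have := @is_derive_shift _ _ phi (- h *: dir_t) z (dir_x i) _ (smooth_is_derive _ _ sphi).
  by rewrite -time_shiftE; congr is_derive; apply/funext => y; rewrite time_shiftE.
have [_ ->] := is_deriveM d1 (is_derive_time (plateau n a b) i z).
by rewrite scaler0 add0r [_ *: _]mulrC.
Qed.

Let P_itv a b : 0 < a -> b < T -> P (\1_(`]a, b[%classic : set TR)).
Proof.
move=> a0 bT; apply: (P_lim (chi_ := fun n => plateau n a b)) => [n|n t|t _|n].
- by apply: continuous_measurable_fun; exact: smooth_continuous (smooth_plateau n a b).
- by rewrite ger0_norm ?plateau_ge0// plateau_le1.
- rewrite indicE; have [/set_mem tab|/negP tab] := boolP (t \in _).
    exact: plateau_cvg.
  rewrite (_ : (fun n => _) = fun=> 0); first exact: cvg_cst.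
  apply/funext => n; apply: plateau_out; apply/negP => tab'; apply: tab.
  exact: mem_set.
- exact: P_plateau.
Qed.

Lemma green_test : \sum_i ip (back h ('D_(dir_x i) phi)) (fun z => F z ord0 i) =
  - ip (back h phi) k.
Proof.
have backE u z : Q z -> back h u z = delayed u (\1_(`]h, T[%classic : set TR)) z.
  case: z => x t [_ /=]; rewrite in_itv /= => /andP[_ tT].
  rewrite /back /cut /delayed indicE /=; case: ifPn => ht.
    by rewrite mem_set ?mulr1//= in_itv /= ht.
  rewrite (_ : _ \in _ = false) ?mulr0//; apply/negP => /set_mem.
  by rewrite /= in_itv /= (negbTE ht).
have : P (\1_(`]h, T[%classic : set TR)).
  apply: (P_lim (chi_ := fun n => \1_(`]h + n.+1%:R^-1, T - n.+1%:R^-1[%classic : set TR)))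
      => [n|n t|t _|n].
  - exact: measurable_indic.
  - by rewrite indicE; case: (_ \in _); rewrite ?normr0 ?normr1.
  - rewrite indicE; have [/set_mem|/negP th] := boolP (t \in _); last first.
      rewrite (_ : (fun n => _) = fun=> 0); first exact: cvg_cst.
      apply/funext => n; rewrite indicE (_ : _ \in _ = false)//; apply/negP => /set_mem tn.
      apply: th; apply/mem_set; move: tn; rewrite /= !in_itv /= => /andP[hn nT].
      by rewrite (le_lt_trans _ hn) ?lerDl// (lt_le_trans nT)// gerBl.
    rewrite /= in_itv /= => /andP[ht tT].
    have cn := @cvg_harmonic R.
    have ca : h + n.+1%:R^-1 @[n --> \oo] --> h.
      by rewrite -[X in _ --> X]addr0; apply: cvgD => //; exact: cvg_cst.
    have cb : T - n.+1%:R^-1 @[n --> \oo] --> T.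
      by rewrite -[X in _ --> X]subr0; apply: cvgB => //; exact: cvg_cst.
    have [N1 _ hN1] := cvgr_lt _ ca _ ht.
    have [N2 _ hN2] := cvgr_gt _ cb _ tT.
    apply: cvg_near_cst; exists (maxn N1 N2) => // n /=; rewrite geq_max => /andP[n1 n2].
    by rewrite indicE mem_set//= in_itv /= (hN1 _ n1) (hN2 _ n2).
  - by apply: P_itv; rewrite ?ltr_wpDl ?gtrBl.
rewrite /P => e.
transitivity (- ip (delayed phi (\1_(`]h, T[%classic : set TR))) k).
  by rewrite -e; apply: eq_bigr => i _; apply: eq_ip => z Qz; rewrite backE.
by congr (- _); apply: eq_ip => z Qz; rewrite backE.
Qed.

End test_green.

(** The vanishing of w on the lateral boundary is by definition an approximation by
    functions supported away from it, for which [green_test] holds; delays are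
    contractions, so the formula passes to the limit. *)
Lemma green_back w F k h : L2 w -> has_grad_x Omega T w -> zero_on_Sigma Omega T w ->
  L2vec mu Q F -> is_weak_div Omega T F k -> 0 <= h ->
  \sum_i ip (back h (weak_partial Omega T (dir_x i) w)) (fun z => F z ord0 i) =
  - ip (back h w) k.
Proof.
move=> Lw gw [phi [tphi cphi cDphi]] LF Fk h0; have [Lk _] := Fk.
have lim (u_ : (S -> R)^nat) u g : (forall n, test_function (Omega `*` setT) (u_ n)) ->
    L2 u -> L2 g -> normQ Omega T (u \- u_ n) @[n --> \oo] --> (0 : R) ->
    ip (back h (u_ n)) g @[n --> \oo] --> ip (back h u) g.
  move=> tu Lu Lg c; have Lun n := L2Q_test T oO bO (tu n).
  apply: (ip_cvgl mQ (fun n => back_L2 oO h0 (Lun n)) (back_L2 oO h0 Lu) Lg).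
  apply: (@squeeze_cvgr _ _ _ _ (fun=> 0) (fun n => normQ Omega T (u \- u_ n) ^+ 2)).
  - apply: nearW => n; rewrite ip_ge0 /= L2normE.
    have := back_norm_le oO h0 (L2B mQ Lu (Lun n)); apply: le_trans.
    rewrite le_eqVlt; apply/orP; left; apply/eqP; apply: eq_ip => z _.
    by rewrite !backB -mulrNN !opprB.
  - exact: cvg_cst.
  - rewrite -(mulr0 0); under eq_fun do rewrite expr2; exact: cvgM.
have c1 : \sum_i ip (back h ('D_(dir_x i) (phi n))) (fun z => F z ord0 i) @[n --> \oo] -->
    \sum_i ip (back h (weak_partial Omega T (dir_x i) w)) (fun z => F z ord0 i).
  apply: cvg_sumr => i; apply: lim => //; last by have [] := weak_partialP (gw i).
  by move=> n; exact: test_function_derive.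
have c2 : - ip (back h (phi n)) k @[n --> \oo] --> - ip (back h w) k.
  by apply: cvgN; exact: lim.
have e : (fun n => - ip (back h (phi n)) k) =
    fun n => \sum_i ip (back h ('D_(dir_x i) (phi n))) (fun z => F z ord0 i).
  by apply/funext => n; rewrite (green_test (tphi n) h0 LF Fk).
by rewrite e in c2; exact: cvg_unique c1 c2.
Qed.

End green.

(** * The mass near the final face *)

Section face_mass.
Context {R : realType} {d : nat}.
Local Notation X := 'rV[R]_d.
Local Notation TR := (measurableTypeR R).
Local Notation S := (X * measurableTypeR R)%type.
Variables (Omega : set X) (T : R).
Hypotheses (oO : open Omega) (bO : bounded_set Omega) (T0 : 0 < T).
Local Notation mu := (@lebesgue_ST R d).
Local Notation nu := (lebesgue_rV R d).
Local Notation leb := (@lebesgue_measure R).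
Local Notation Q := (cylinder Omega T).
Local Notation I := (`]0, T[%classic : set TR).
Local Notation ipL := ip.
Local Notation ip := (ip mu Q).
Local Notation L2 := (L2 mu Q).
Let mQ : measurable Q := measurable_cylinder T oO.
Let mO : measurable Omega := measurable_base oO.
Let mI : measurable I. Proof. exact: measurable_itv. Qed.
Implicit Types (w g : S -> R).

(** On the diagonal this is the squared norm over the last slab of height h, see
    [face_mass_slab]; in this form it is visibly bilinear, and it is what a discrete
    integration by parts in time leaves at the final face. *)
Definition face_mass h w g : R := ip w g - ip (back h w) (back h g).

Definition trace_sqr w : R := ipL nu Omega (time_trace Omega T w T) (time_trace Omega T w T).

Let young_ring (eps a b c : R) : 0 < eps -> 0 <= a - 2 * eps * b + eps ^+ 2 * c ->
  b <= (eps^-1 * a + eps * c) / 2.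
Proof.
move=> e0 h; rewrite ler_pdivlMr// -subr_ge0.
have -> : eps^-1 * a + eps * c - b * 2 = eps^-1 * (a - 2 * eps * b + eps ^+ 2 * c).
  by field; rewrite gt_eqF.
by rewrite mulr_ge0// invr_ge0 ltW.
Qed.

(** Delaying does not increase the norm, so that the face mass is a nonnegative
    quadratic form, to which Young's inequality applies. *)
Lemma face_mass_young h eps w g : 0 <= h -> 0 < eps -> L2 w -> L2 g ->
  face_mass h w g <= (eps^-1 * face_mass h w w + eps * face_mass h g g) / 2.
Proof.
move=> h0 e0 Lw Lg; apply: young_ring => //.
have Lb u : L2 u -> L2 (back h u) by move=> Lu; exact: back_L2.
have := back_norm_le oO h0 (L2D mQ Lw (L2Z mQ (- eps) Lg)).
have -> : ip (back h (fun z => w z + - eps * g z)) (back h (fun z => w z + - eps * g z)) =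
    ip (fun z => back h w z + - eps * back h g z) (fun z => back h w z + - eps * back h g z).
  by apply: eq_ip => z _; congr (_ * _); rewrite /back /cut; case: ifP; rewrite // mulr0 addr0.
rewrite (ipDD mQ _ Lw Lg) (ipDD mQ _ (Lb _ Lw) (Lb _ Lg)) -subr_ge0.
rewrite /face_mass; congr (0 <= _); ring.
Qed.

Lemma face_mass_slab h w : 0 < h -> h < T -> L2 w ->
  face_mass h w w = ipL mu (last_slab Omega T h) w w.
Proof.
move=> h0 hT Lw.
have sub' : slab Omega 0 (T - h) `<=` Q by apply: slab_sub; rewrite ?gerBl ?(ltW h0).
have sub : last_slab Omega T h `<=` Q by apply: slab_sub; rewrite ?subr_ge0 ?(ltW hT).
rewrite /face_mass (ip_back oO (ltW h0) Lw (back_L2 oO (ltW h0) Lw)).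
rewrite (@eq_ip _ _ _ mu (slab Omega 0 (T - h)) w w _ w); last first.
  move=> [x t] [/= Ox]; rewrite in_itv /= => /andP[t0 tT].
  by rewrite /back /cut /time_shift /= ltrDr t0 addrK.
have Iw := L2M_integrable mQ Lw Lw.
pose n s := \int[nu]_(x in Omega) (w (x, s) * w (x, s)).
have In : leb.-integrable I (EFin \o n).
  by have := fubini_integrable2 mO mI Iw; apply => z; rewrite -expr2 sqr_ge0.
have part (J : set TR) : measurable J -> J `<=` I ->
    ipL mu (Omega `*` J) w w = \int[leb]_(s in J) n s.
  move=> mJ JI; have OJ : Omega `*` J `<=` Q by move=> z [Oz /JI].
  have mOJ : measurable (Omega `*` J) by exact: measurableX.
  have LwJ := L2S mQ mOJ OJ Lw.
  exact: (fubini_setX2 mO mJ (L2M_integrable mOJ LwJ LwJ)).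
have J1 : (`]0, T - h[%classic : set TR) `<=` I.
  by move=> s; rewrite /= !in_itv /= => /andP[-> sT]; rewrite (lt_le_trans sT)// gerBl ltW.
have J2 : (`]T - h, T[%classic : set TR) `<=` I.
  by move=> s; rewrite /= !in_itv /= => /andP[hs ->]; rewrite (lt_trans _ hs)// subr_gt0.
have m1 : measurable (`]0, T - h[%classic : set TR) by exact: measurable_itv.
have m2 : measurable (`]T - h, T[%classic : set TR) by exact: measurable_itv.
rewrite [X in X - _](part I mI)// [X in _ - X](part _ m1 J1) [RHS](part _ m2 J2).
rewrite -(@Rintegral_itvB _ _ (BRight 0) (BLeft T) (T - h))//.
- congr (_ - _); apply: Rintegral_itv_bndo_bndc.
  exact: (integrableS _ m1 J1 In).
- by rewrite bnd_simp subr_ge0 ltW.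
- by rewrite bnd_simp gtrBl.
Qed.

Lemma time_traceP w : (exists W, time_continuous_rep Omega T w W) ->
  time_continuous_rep Omega T w (time_trace Omega T w).
Proof. by case=> W hW; exact: (xgetPex _ (ex_intro _ W hW)). Qed.


Section sequence.
Variable h : R^nat.
Hypotheses (h0 : forall n, 0 < h n) (hT : forall n, h n < T).
Hypothesis (h_cvg0 : h n @[n --> \oo] --> (0 : R)).

Lemma face_mass_cvg w : L2 w -> (exists W, time_continuous_rep Omega T w W) ->
  (h n)^-1 * face_mass (h n) w w @[n --> \oo] --> trace_sqr w.
Proof.
move=> Lw /time_traceP rep; apply/cvgrPdist_le => /= e e0.
have [dl dl0 hdl] := slab_average oO T0 Lw rep e0.
have [N _ hN] := cvgr_lt _ h_cvg0 _ dl0; exists N => // n /hN hn.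
by rewrite distrC face_mass_slab// hdl.
Qed.

(** A function without a continuous representative has trace zero by convention,
    so the trace is always dominated by the mean square over thin slabs. *)
Lemma trace_sqr_minorant w : L2 w -> exists a : R^nat,
  (forall n, a n <= (h n)^-1 * face_mass (h n) w w) /\ a n @[n --> \oo] --> trace_sqr w.
Proof.
move=> Lw; have [rep|norep] := pselect (exists W, time_continuous_rep Omega T w W).
  by exists (fun n => (h n)^-1 * face_mass (h n) w w); split => //; exact: face_mass_cvg.
exists (fun=> 0); split => [n|].
  rewrite mulr_ge0 ?invr_ge0 ?(ltW (h0 n))// subr_ge0.
  by rewrite back_norm_le ?(ltW (h0 n)).
have -> : trace_sqr w = 0.
  rewrite /trace_sqr /time_trace xgetPN => [|W hW]; last by apply: norep; exists W.
  by rewrite ip0l.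
exact: cvg_cst.
Qed.

End sequence.

End face_mass.

(** * The two energy estimates *)

Section energy.
Context {R : realType} {d : nat}.
Local Notation X := 'rV[R]_d.
Local Notation S := (X * measurableTypeR R)%type.
Variables (Omega : set X) (T : R).
Hypotheses (oO : open Omega) (bO : bounded_set Omega) (T0 : 0 < T).
Local Notation mu := (@lebesgue_ST R d).
Local Notation Q := (cylinder Omega T).
Local Notation ip := (ip mu Q).
Local Notation L2 := (L2 mu Q).
Let mQ : measurable Q := measurable_cylinder T oO.

Variables (e et q k : S -> R) (F : S -> X) (r rt : 'I_d -> S -> R).
Let g i := weak_partial Omega T (dir_x i) e.
Hypotheses (Le : L2 e) (det : is_weak_partial Omega T (@dir_t R d) e et).
Hypothesis e_prim : {ae mu, forall z, Q z -> e z = prim et z}.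
Hypotheses (ge : has_grad_x Omega T e) (ze : zero_on_Sigma Omega T e).
Hypotheses (LF : L2vec mu Q F) (Fk : is_weak_div Omega T F k).
Hypotheses (Lq : L2 q) (kE : {ae mu, forall z, Q z -> k z = et z - q z}).
Hypothesis Lr : forall i, L2 (r i).
(* the dual residual r splits the flux: F = grad e - r, with divergence k = e_t - q *)
Hypothesis FE : forall i, {ae mu, forall z, Q z -> F z ord0 i = g i z - r i z}.
Hypothesis drt : forall i, is_weak_partial Omega T (@dir_t R d) (r i) (rt i).

Let Let_ : L2 et. Proof. by case: det. Qed.
Let Lk : L2 k. Proof. by case: Fk. Qed.
Let Lg i : L2 (g i). Proof. by have [] := weak_partialP (ge i). Qed.
Let Lb h w : 0 <= h -> L2 w -> L2 (back h w). Proof. by move=> h0 Lw; exact: back_L2. Qed.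

Let h n : R := T / n.+2%:R.
Let h0 n : 0 < h n. Proof. by rewrite divr_gt0. Qed.
Let hge0 n : 0 <= h n. Proof. exact: ltW. Qed.
Let hT n : h n < T. Proof. by rewrite ltr_pdivrMr// ltr_pMr// ltr1n. Qed.
Let h_cvg0 : h n @[n --> \oo] --> (0 : R).
Proof.
rewrite -(mulr0 T); apply: cvgM; first exact: cvg_cst.
by have := @cvg_harmonic R; rewrite -(cvg_shiftS).
Qed.

Let half_ineq (a b c : R) : 0 <= a + 2 * -1 * b + (-1) ^+ 2 * c -> b <= (a + c) / 2.
Proof. by move=> ?; lra. Qed.

Let ip_mean w v : L2 w -> L2 v -> ip w v <= (ip w w + ip v v) / 2.
Proof. by move=> Lw Lv; apply: half_ineq; rewrite -(ipDD mQ _ Lw Lv) ip_ge0. Qed.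

Let ipF i w : L2 w -> ip w (fun z => F z ord0 i) = ip w (g i) - ip w (r i).
Proof.
move=> Lw; rewrite -(ipBr mQ Lw (Lg i) (Lr i)) ipC [RHS]ipC.
exact: (ae_eq_ip mQ (LF i) (L2B mQ (Lg i) (Lr i)) Lw (FE i)).
Qed.

Let ipk w : L2 w -> ip w k = ip et w - ip q w.
Proof.
move=> Lw; rewrite -(ipBl mQ Let_ Lq Lw) ipC.
exact: (ae_eq_ip mQ Lk (L2B mQ Let_ Lq) Lw kE).
Qed.

Let green0 : \sum_i (ip (g i) (g i) - ip (g i) (r i)) = - ip e k.
Proof.
have back0 w z : Q z -> back 0 w z = w z.
  case: z => x t [_ /=]; rewrite in_itv /= => /andP[t0 _].
  by rewrite /back /cut /time_shift /= t0 subr0.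
have := green_back oO bO Le ge ze LF Fk (lexx 0).
rewrite (eq_ip _ _ (w := back 0 e) (w' := e) (g := k) (g' := k)); last first.
  by move=> z Qz; rewrite back0.
move=> <-; apply: eq_bigr => i _; rewrite -ipF//.
by apply: eq_ip => z Qz; rewrite back0.
Qed.

(** Multiplying the error equation by e. The discrete form of d/dt |e|^2 = 2 e e_t
    is |e|^2 - (delayed e) e >= (|e|^2 - |delayed e|^2) / 2; in the limit h -> 0 the
    right-hand side gives the trace. *)
Lemma energy_error : trace_sqr Omega T e / 2 + \sum_i ip (g i) (g i) <=
  \sum_i ip (g i) (r i) + ip q e.
Proof.
have etE : ip et e = - \sum_i ip (g i) (g i) + \sum_i ip (g i) (r i) + ip q e.
  have := green0; rewrite (ipk Le) sumrB; lra.
suff : trace_sqr Omega T e / 2 <= ip et e by rewrite etE; lra.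
have [LD _ cD] := back_quotient_cvg oO bO h0 h_cvg0 Le det e_prim.
have rep := weak_dt_continuous_rep oO bO T0 Le det.
have cL := face_mass_cvg oO T0 h0 hT h_cvg0 Le rep.
have cL2 : (h n)^-1 * face_mass Omega T (h n) e e / 2 @[n --> \oo] -->
    trace_sqr Omega T e / 2 by apply: cvgM => //; exact: cvg_cst.
apply: (ler_cvg_to cL2 (cD e Le)); apply: nearW => n.
have Lbe := Lb (hge0 n) Le.
rewrite (ipZl mQ _ (L2B mQ Le Lbe) Le) -mulrA ler_wpM2l ?invr_ge0//.
rewrite (ipBl mQ Le Lbe Le).
have := ip_mean Lbe Le; rewrite /face_mass; lra.
Qed.

Let term_ineq (gg gr bb bg br bbr rr eps : R) :
  bg <= (bb + gg) / 2 -> gr - bbr <= (eps^-1 * (gg - bb) + eps * rr) / 2 ->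
  - (gg - gr) + (bg - br) <=
  - ((1 - eps^-1) / 2 * (gg - bb)) + eps / 2 * rr - (br - bbr).
Proof. by move: (eps^-1) => c h1 h2; lra. Qed.

(** Multiplying the error equation by e_t. As grad e may have no weak derivative in
    time, e_t is replaced by a backward difference quotient; Green's formula is
    applied to e and to its delayed copy, and F = grad e - r is inserted. The part
    with grad e gives minus half of its face mass. In the part with r the quotient
    is moved from grad e to r, at the price of a face mass of the pair (grad e, r),
    which is split by Young's inequality with the weight eps. *)
Lemma energy_derivative eps : 1 <= eps ->
  ip et et + (1 - eps^-1) / 2 * \sum_i trace_sqr Omega T (g i) <=
  ip et q + eps / 2 * \sum_i trace_sqr Omega T (r i) - \sum_i ip (rt i) (g i).
Proof.
move=> eps1; have eps0 : 0 < eps by exact: lt_le_trans eps1.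
have c0 : 0 <= (1 - eps^-1) / 2 by rewrite divr_ge0// subr_ge0 invf_le1.
have [LD _ cD] := back_quotient_cvg oO bO h0 h_cvg0 Le det e_prim.
have rep i := weak_dt_continuous_rep oO bO T0 (Lr i) (drt i).
have cR i := face_mass_cvg oO T0 h0 hT h_cvg0 (Lr i) (rep i).
have [a ha] := choice (fun i => trace_sqr_minorant oO T0 h0 hT h_cvg0 (Lg i)).
have cdr i := cut_quotient_cvg oO bO T0 h0 h_cvg0 (Lr i) (drt i).
pose Dr i n z := (h n)^-1 * cut (h n) (fun z => r i z - back (h n) (r i) z) z.
have cX i : ip (Dr i n) (back (h n) (g i)) @[n --> \oo] --> ip (rt i) (g i).
  have [LDr Drb cDr] := cdr i.
  apply: (weak_strong_cvg oO LDr (ip_ge0 _ _ _) Drb (cDr _ (Lg i)) _ (Lg i)).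
    by move=> n; exact: Lb.
  exact: back_cvg.
suff : ip et k <= \sum_i (- ((1 - eps^-1) / 2 * trace_sqr Omega T (g i)) +
    eps / 2 * trace_sqr Omega T (r i) - ip (rt i) (g i)).
  rewrite (ipk Let_) !big_split/= !sumrN -!mulr_sumr (ipC _ _ q et); lra.
(* the right-hand side before the passage to the limit, with the traces of grad e
   already bounded from below *)
pose U n := \sum_i (- ((1 - eps^-1) / 2 * a i n) +
    eps / 2 * ((h n)^-1 * face_mass Omega T (h n) (r i) (r i)) -
    ip (Dr i n) (back (h n) (g i))).
apply: (@ler_cvg_to _ _ _ _ _ U _ _ (cD k Lk)).
  apply: cvg_sumr => i; have [_ cai] := ha i.
  apply: cvgB => //; apply: cvgD; first by apply: cvgN; apply: cvgM => //; exact: cvg_cst.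
  by apply: cvgM => //; exact: cvg_cst.
apply: nearW => n; have Lbe := Lb (hge0 n) Le.
rewrite (ipZl mQ _ (L2B mQ Le Lbe) Lk) (ipBl mQ Le Lbe Lk).
have -> : ip e k - ip (back (h n) e) k = \sum_i (- (ip (g i) (g i) - ip (g i) (r i)) +
    (ip (back (h n) (g i)) (g i) - ip (back (h n) (g i)) (r i))).
  rewrite big_split/= sumrN green0 opprK; congr (_ + _).
  rewrite -(green_back oO bO Le ge ze LF Fk (hge0 n)); apply: eq_bigr => i _.
  by rewrite -ipF//; exact: Lb.
rewrite mulr_sumr; apply: ler_sum => i _; have [hai _] := ha i.
have Lbg := Lb (hge0 n) (Lg i); have Lbr := Lb (hge0 n) (Lr i).
have Lrb := L2B mQ (Lr i) Lbr.
have DrE : ip (Dr i n) (back (h n) (g i)) =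
    (h n)^-1 * (ip (back (h n) (g i)) (r i) - ip (back (h n) (g i)) (back (h n) (r i))).
  rewrite (ipZl mQ _ (cut_L2 oO (hge0 n) Lrb) Lbg) -(ipBr mQ Lbg (Lr i) Lbr) ipC.
  congr (_ * _); apply: eq_ip => z _; rewrite /cut.
  by case: ifPn => // hz; rewrite /back /cut (negbTE hz) !mul0r.
apply: (@le_trans _ _ (- ((1 - eps^-1) / 2 * ((h n)^-1 * face_mass Omega T (h n) (g i) (g i))) +
    eps / 2 * ((h n)^-1 * face_mass Omega T (h n) (r i) (r i)) -
    ip (Dr i n) (back (h n) (g i)))); last first.
  by rewrite lerD2r lerD2r lerN2 ler_wpM2l.
rewrite DrE.
have -> : forall x y z : R, - ((1 - eps^-1) / 2 * ((h n)^-1 * x)) + eps / 2 * ((h n)^-1 * y) -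
    (h n)^-1 * z = (h n)^-1 * (- ((1 - eps^-1) / 2 * x) + eps / 2 * y - z) by move=> *; ring.
rewrite ler_wpM2l ?invr_ge0//.
apply: term_ineq; first exact: ip_mean.
have := face_mass_young oO (hge0 n) eps0 (Lg i) (Lr i).
by rewrite {1 2}/face_mass.
Qed.

End energy.

(** * Absorption of the cross terms *)

Section young.
Context {R : realFieldType}.
Implicit Types a b c : R.

Lemma young2 eps a b : 0 < eps -> 2 * (a * b) <= eps * a ^+ 2 + eps^-1 * b ^+ 2.
Proof.
move=> e0; rewrite -subr_ge0.
have -> : eps * a ^+ 2 + eps^-1 * b ^+ 2 - 2 * (a * b) = eps^-1 * (eps * a - b) ^+ 2.
  by field; rewrite gt_eqF.
by rewrite mulr_ge0 ?sqr_ge0// invr_ge0 ltW.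
Qed.

Lemma sqrrD_young beta a b : 0 < beta ->
  (a + b) ^+ 2 <= (1 + beta) * a ^+ 2 + (1 + beta^-1) * b ^+ 2.
Proof. by move=> b0; have := young2 a b b0; move: (beta^-1) => c h; rewrite sqrrD; lra. Qed.

Lemma le_of_sqr_le a b c : 0 <= a -> 0 <= b -> c ^+ 2 <= a ^+ 2 * b ^+ 2 -> c <= a * b.
Proof.
move=> a0 b0; rewrite -exprMn => h; rewrite leNgt; apply/negP => lt.
have ab : 0 <= a * b by exact: mulr_ge0.
by move: h; rewrite leNgt ltr_pXn2r ?nnegrE ?lt// (le_trans ab)// ltW.
Qed.

(** The constants of the majorant: lambda times the first energy estimate plus mu
    times the second one, the cross terms being absorbed by Young's inequality. *)
Lemma majorant_of_energy (lambda mu zeta eps beta1 beta2 C_F G E A B C TG TE TR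
    X1 X2 X3 X4 : R) : 0 < lambda -> 0 < mu -> 0 < zeta -> 0 < beta1 -> 0 < beta2 ->
  TE / 2 + G ^+ 2 <= X1 + X2 ->
  E ^+ 2 + (1 - eps^-1) / 2 * TG <= X4 + eps / 2 * TR - X3 ->
  X1 <= G * A -> X2 <= B * (C_F * G) -> - X3 <= C * G -> X4 <= B * E ->
  (2 - zeta^-1) * (lambda * G ^+ 2 + mu * E ^+ 2) + mu * (1 - eps^-1) * TG + lambda * TE <=
  eps * mu * TR + zeta * (lambda * ((1 + beta1) *
      ((1 + beta2) * A ^+ 2 + (1 + beta2^-1) * C_F ^+ 2 * B ^+ 2) +
    (1 + beta1^-1) * (mu ^+ 2 / lambda ^+ 2) * C ^+ 2) + mu * B ^+ 2).
Proof.
move=> l0 m0 z0 b10 b20 hI hII h1 h2 h3 h4.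
set M := (1 + beta1) * _ + _.
pose Sm := A + C_F * B + mu / lambda * C.
have SM : Sm ^+ 2 <= M.
  apply: le_trans (sqrrD_young (A + C_F * B) (mu / lambda * C) b10) _.
  rewrite /M exprMn expr_div_n [leLHS]addrC [leRHS]addrC mulrA lerD2l ler_wpM2l ?addr_ge0 ?(ltW b10)//.
  by have := sqrrD_young A (C_F * B) b20; rewrite exprMn [X in _ <= _ + X]mulrA.
have y1 : 2 * (G * Sm) <= zeta^-1 * G ^+ 2 + zeta * M.
  have := young2 Sm G z0; rewrite (mulrC Sm) => h; apply: (le_trans h).
  by rewrite addrC lerD2l ler_wpM2l// ltW.
have y2 : 2 * (B * E) <= zeta * B ^+ 2 + zeta^-1 * E ^+ 2 by exact: young2.
have lSm : lambda * (G * Sm) = lambda * (G * A) + lambda * (B * (C_F * G)) + mu * (C * G).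
  by rewrite /Sm; field; rewrite gt_eqF.
have i1 : lambda * (TE + 2 * G ^+ 2) <= lambda * (2 * (G * A) + 2 * (B * (C_F * G))).
  by rewrite ler_wpM2l ?(ltW l0)//; lra.
have i2 : mu * (2 * E ^+ 2 + (1 - eps^-1) * TG) <=
    mu * (2 * (B * E) + eps * TR + 2 * (C * G)).
  by rewrite ler_wpM2l ?(ltW m0)//; move: (eps^-1) hII => c hII; lra.
have i3 := ler_wpM2l (ltW l0) y1.
have i4 := ler_wpM2l (ltW m0) y2.
move: (zeta^-1) (eps^-1) M Sm lSm i1 i2 i3 i4 {SM y1 y2 hI hII h1 h2 h3 h4} =>
  zi ei M Sm lSm i1 i2 i3 i4; lra.
Qed.

End young.

(** * Differences of admissible functions *)

Section differences.
Context {R : realType} {d : nat}.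
Local Notation X := 'rV[R]_d.
Local Notation S := (X * measurableTypeR R)%type.
Variables (Omega : set X) (T : R).
Hypotheses (oO : open Omega) (bO : bounded_set Omega).
Local Notation mu := (@lebesgue_ST R d).
Local Notation nu := (lebesgue_rV R d).
Local Notation Q := (cylinder Omega T).
Local Notation L2 := (L2 mu Q).
Let mQ : measurable Q := measurable_cylinder T oO.
Let mO : measurable Omega := measurable_base oO.

Let subACA (a b c e : R) : a - b - (c - e) = a - c - (b - e).
Proof. ring. Qed.

Lemma L2normB_le {dU} {U : measurableType dU} (m : {measure set U -> \bar R}) (D : set U)
    (w g : U -> R) : measurable D -> Defs.L2 m D w -> Defs.L2 m D g ->
  L2norm m D (fun x => w x - g x) <= 2 * (L2norm m D w + L2norm m D g).
Proof.
move=> mD Lw Lg; have := ip_sqrB_le mD Lw Lg; rewrite -!L2normE => h.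
have a0 := L2norm_ge0 m D w; have b0 := L2norm_ge0 m D g.
rewrite -ler_sqr ?nnegrE ?L2norm_ge0 ?mulr_ge0 ?addr_ge0//; apply: (le_trans h).
move: a0 b0; move: (L2norm _ _ w) (L2norm _ _ g) => a b a0 b0.
have ab := mulr_ge0 a0 b0; have := sqr_ge0 a; have := sqr_ge0 b.
by rewrite exprMn sqrrD; lra.
Qed.

Lemma ae_eq_L2norm {dU} {U : measurableType dU} (m : {measure set U -> \bar R}) (D : set U)
    (w g : U -> R) : measurable D -> Defs.L2 m D w -> Defs.L2 m D g ->
  {ae m, forall x, D x -> w x = g x} -> L2norm m D w = L2norm m D g.
Proof.
move=> mD Lw Lg wg; apply/eqP; rewrite -(@eqrXn2 _ 2) ?L2norm_ge0//; apply/eqP.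
by rewrite !L2normE (ae_eq_ip mD Lw Lg Lw wg) ipC (ae_eq_ip mD Lw Lg Lg wg).
Qed.

Let L2norm_cvgB {dU} {U : measurableType dU} (m : {measure set U -> \bar R}) (D : set U)
    {I : Type} (F : set_system I) {FF : Filter F} (w g : I -> U -> R) : measurable D ->
  (\forall i \near F, Defs.L2 m D (w i)) -> (\forall i \near F, Defs.L2 m D (g i)) ->
  L2norm m D (w i) @[i --> F] --> (0 : R) -> L2norm m D (g i) @[i --> F] --> (0 : R) ->
  L2norm m D (fun x => w i x - g i x) @[i --> F] --> (0 : R).
Proof.
move=> mD Lw Lg cw cg.
apply: (@squeeze_cvgr _ _ _ _ (fun=> 0) (fun i => 2 * (L2norm m D (w i) + L2norm m D (g i)))).
- by apply: filterS2 Lw Lg => i Lwi Lgi; rewrite L2norm_ge0 L2normB_le.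
- exact: cvg_cst.
- rewrite [X in _ --> X](_ : 0 = 2 * (0 + 0)); last by rewrite addr0 mulr0.
  by apply: cvgM; [exact: cvg_cst|exact: cvgD].
Qed.

Lemma zero_on_Sigma0B w w' : zero_on_Sigma0 Omega T w -> zero_on_Sigma0 Omega T w' ->
  zero_on_Sigma0 Omega T (w \- w').
Proof.
move=> [W [[LW cW eW] W0]] [W' [[LW' cW' eW'] W'0]].
exists (fun t x => W t x - W' t x); split; last first.
  by apply: filterS2 W0 W'0 => x h h' Ox; rewrite h// h'// subrr.
split.
- by move=> t tI; apply: (L2B mO); [exact: LW|exact: LW'].
- move=> t tI.
  have near_itv V : (forall s, s \in `[0, T] -> Defs.L2 nu Omega (V s)) ->
      \forall s \near within `[0, T]%classic (nbhs t), Defs.L2 nu Omega (fun x => V s x - V t x).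
    by move=> LV; rewrite near_withinE; apply: nearW => s sI; apply: (L2B mO); exact: LV.
  have c : L2norm nu Omega (fun x => (W s x - W t x) - (W' s x - W' t x))
      @[s --> within `[0, T]%classic (nbhs t)] --> (0 : R).
    exact: (L2norm_cvgB mO (near_itv W LW) (near_itv W' LW') (cW t tI) (cW' t tI)).
  rewrite (_ : (fun s => _) = fun s => L2norm nu Omega
    (fun x => (W s x - W t x) - (W' s x - W' t x)))//.
  apply/funext => s; congr (L2norm _ _ _).
  by apply/funext => x; exact: subACA.
- by apply: filterS2 eW eW' => z h h' Qz /=; rewrite h// h'.
Qed.

Lemma zero_on_SigmaB w w' : L2 w -> L2 w' -> has_grad_x Omega T w -> has_grad_x Omega T w' ->
  zero_on_Sigma Omega T w -> zero_on_Sigma Omega T w' -> zero_on_Sigma Omega T (w \- w').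
Proof.
move=> Lw Lw' gw gw' [p [tp cp cDp]] [p' [tp' cp' cDp']].
exists (fun n z => p n z - p' n z); split.
- by move=> n; exact: test_functionB.
- have c : L2norm mu Q (fun z => (w z - p n z) - (w' z - p' n z)) @[n --> \oo] --> (0 : R).
    apply: (L2norm_cvgB mQ _ _ cp cp'); apply: nearW => n; apply: (L2B mQ) => //; exact: (L2Q_test T oO bO).
  rewrite (_ : (fun n => _) = fun n => L2norm mu Q (fun z => (w z - p n z) - (w' z - p' n z)))//.
  apply/funext => n; congr (L2norm _ _ _).
  by apply/funext => z; exact: subACA.
- move=> i; have [Lg _] := weak_partialP (gw i); have [Lg' _] := weak_partialP (gw' i).
  have LDp n := L2Q_test T oO bO (test_function_derive (dir_x i) (tp n)).
  have LDp' n := L2Q_test T oO bO (test_function_derive (dir_x i) (tp' n)).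
  have c : L2norm mu Q (fun z => (weak_partial Omega T (dir_x i) w z - 'D_(dir_x i) (p n) z) -
      (weak_partial Omega T (dir_x i) w' z - 'D_(dir_x i) (p' n) z)) @[n --> \oo] --> (0 : R).
    have n1 : \forall n \near \oo, L2 (weak_partial Omega T (dir_x i) w \- 'D_(dir_x i) (p n)).
      by apply: nearW => n; exact: (L2B mQ Lg (LDp n)).
    have n2 : \forall n \near \oo, L2 (weak_partial Omega T (dir_x i) w' \- 'D_(dir_x i) (p' n)).
      by apply: nearW => n; exact: (L2B mQ Lg' (LDp' n)).
    exact: (L2norm_cvgB mQ n1 n2 (cDp i) (cDp' i)).
  rewrite (_ : (fun n => _) = fun n => L2norm mu Q (fun z =>
    (weak_partial Omega T (dir_x i) w z - 'D_(dir_x i) (p n) z) -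
    (weak_partial Omega T (dir_x i) w' z - 'D_(dir_x i) (p' n) z)))//.
  apply/funext => n; apply/esym.
  have pB := weak_partialB oO bO Lw Lw' (weak_partialP (gw i)) (weak_partialP (gw' i)).
  have pw := weak_partialP (ex_intro _ _ pB); have [Lgd _] := pw.
  have LB := L2B mQ (L2B mQ Lg (LDp n)) (L2B mQ Lg' (LDp' n)).
  have LDd := L2B mQ Lgd (L2Q_test T oO bO (test_function_derive (dir_x i) (test_functionB (tp n) (tp' n)))).
  apply: (ae_eq_L2norm mQ LB LDd); apply: filterS (weak_partial_unique oO bO pB pw) => z h Qz.
  have [sp _ _] := tp n; have [sp' _ _] := tp' n.
  have d1 := smooth_is_derive z (dir_x i) sp; have d2 := smooth_is_derive z (dir_x i) sp'.
  have [_ /= ->] := is_deriveB d1 d2.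
  by rewrite -(h Qz); exact: subACA.
Qed.

Lemma is_weak_divB (y y' : S -> X) g g' : L2vec mu Q y -> L2vec mu Q y' ->
  is_weak_div Omega T y g -> is_weak_div Omega T y' g' ->
  is_weak_div Omega T (fun z => y z - y' z) (fun z => g z - g' z).
Proof.
move=> Ly Ly' yg yg'; have [Lg _] := yg; have [Lg' _] := yg'.
have Lyy' : L2vec mu Q (fun z => y z - y' z).
  move=> i; have := L2B mQ (Ly i) (Ly' i); congr (Defs.L2 _ _ _).
  by apply/funext => z; rewrite !mxE.
split=> [|phi tphi]; first exact: L2B.
have Lphi := L2Q_test T oO bO tphi.
have LD i := L2Q_test T oO bO (test_function_derive (dir_x i) tphi).
rewrite (weak_div_pairing oO bO)// -[RHS]/(- ip mu Q (fun z => g z - g' z) phi) (ipBl mQ Lg Lg' Lphi).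
rewrite opprD -(weak_divE oO bO Ly yg tphi) -(weak_divE oO bO Ly' yg' tphi) -sumrB.
apply: eq_bigr => i _; rewrite -(ipBl mQ (Ly i) (Ly' i) (LD i)).
by apply: eq_ip => z _; rewrite !mxE.
Qed.

Lemma L2vec_grad_x w : has_grad_x Omega T w -> L2vec mu Q (grad_x Omega T w).
Proof.
move=> gw i; have -> : (fun z => grad_x Omega T w z ord0 i) = weak_partial Omega T (dir_x i) w.
  by apply/funext => z; rewrite mxE.
by have [] := weak_partialP (gw i).
Qed.

End differences.

(** * The majorant *)

Section conclusion.
Context {R : realType} {d : nat}.
Local Notation X := 'rV[R]_d.
Local Notation S := (X * measurableTypeR R)%type.
Variables (Omega : set X) (T : R).
Hypotheses (oO : open Omega) (bO : bounded_set Omega) (T0 : 0 < T).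
Local Notation mu := (@lebesgue_ST R d).
Local Notation nu := (lebesgue_rV R d).
Local Notation Q := (cylinder Omega T).
Local Notation L2 := (L2 mu Q).
Let mQ : measurable Q := measurable_cylinder T oO.
Let mO : measurable Omega := measurable_base oO.

Lemma grad_xE w i : (fun z => grad_x Omega T w z ord0 i) = weak_partial Omega T (dir_x i) w.
Proof. by apply/funext => z; rewrite mxE. Qed.

Lemma dt_vecE (y : S -> X) i :
  (fun z => dt_vec Omega T y z ord0 i) = dt Omega T (fun z => y z ord0 i).
Proof. by apply/funext => z; rewrite mxE. Qed.

Lemma norm_SigmaTE w : norm_SigmaT Omega T w ^+ 2 = trace_sqr Omega T w.
Proof. exact: L2normE. Qed.

Lemma time_trace_L2 w : Defs.L2 nu Omega (time_trace Omega T w T).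
Proof.
have [[W hW]|no] := pselect (exists W, time_continuous_rep Omega T w W).
  have [LW _ _] := time_traceP (ex_intro _ W hW); apply: LW.
  by rewrite in_itv /= lexx ltW.
rewrite /time_trace xgetPN => [|W hW]; first exact: L2_0.
by apply: no; exists W.
Qed.

Lemma norm_SigmaT_vecE (y : S -> X) :
  norm_SigmaT_vec Omega T y ^+ 2 = \sum_i trace_sqr Omega T (fun z => y z ord0 i).
Proof.
have e i : (fun x => time_trace_vec Omega T y T x ord0 i) =
    time_trace Omega T (fun z => y z ord0 i) T by apply/funext => x; rewrite mxE.
rewrite /norm_SigmaT_vec (L2norm_vecE mO) => [|i]; last by rewrite e; exact: time_trace_L2.
by apply: eq_bigr => i _; rewrite e.
Qed.

Lemma ip_le_norm w g : L2 w -> L2 g -> ip mu Q w g <= normQ Omega T w * normQ Omega T g.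
Proof.
move=> Lw Lg; apply: le_of_sqr_le; rewrite ?L2norm_ge0// !L2normE.
exact: ip_CS.
Qed.

Lemma sum_ip_le_norm (y y' : S -> X) : L2vec mu Q y -> L2vec mu Q y' ->
  `|\sum_i ip mu Q (fun z => y z ord0 i) (fun z => y' z ord0 i)| <=
  normQ_vec Omega T y * normQ_vec Omega T y'.
Proof.
move=> Ly Ly'; apply: le_of_sqr_le; rewrite ?sqrtr_ge0// -normrX ger0_norm ?sqr_ge0//.
rewrite !(L2norm_vecE mQ)//; exact: ip_CS_sum.
Qed.

Lemma residual_identity (a b c l : R) : l - c = a - b - (a - l - b + c).
Proof. ring. Qed.

Lemma flux_identity (a b c : R) : a - c = a - b - (c - b).
Proof. ring. Qed.

End conclusion.

Theorem theorem3 (R : realType) (d : nat) (hd : (1 <= d <= 3)%N)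
    (Omega : set 'rV[R]_d) (hOmega : bounded_lipschitz_domain Omega)
    (T : R) (hT : 0 < T)
    (C_F : R) (hC_F0 : 0 < C_F) (hC_F : friedrichs Omega T C_F)
    (lambda mu : R) (hlambda : 0 < lambda) (hmu : 0 < mu)
    (f u : 'rV[R]_d * measurableTypeR R -> R)
    (hf : L2Q Omega T f) (hu : VDelta Omega T u)
    (heq : {ae lebesgue_ST, forall z, cylinder Omega T z ->
       dt Omega T u z - laplace_x Omega T u z = f z})
    (v : 'rV[R]_d * measurableTypeR R -> R) (hv : Vgraddt Omega T v)
    (y : 'rV[R]_d * measurableTypeR R -> 'rV[R]_d) (hy : Hdiv1 Omega T y)
    (zeta eps beta1 beta2 : R)
    (hzeta : 2^-1 <= zeta) (heps : 1 <= eps)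
    (hbeta1 : 0 < beta1) (hbeta2 : 0 < beta2) :
  let e := u \- v in
  let r_eq := fun z => f z - dt Omega T v z + div_x Omega T y z in
  let r_d := fun z => y z - grad_x Omega T v z in
  let M :=
    eps * mu * norm_SigmaT_vec Omega T r_d ^+ 2
    + zeta * (lambda * ((1 + beta1)
                          * ((1 + beta2) * normQ_vec Omega T r_d ^+ 2
                             + (1 + beta2^-1) * C_F ^+ 2
                               * normQ Omega T r_eq ^+ 2)
                        + (1 + beta1^-1) * (mu ^+ 2 / lambda ^+ 2)
                          * normQ_vec Omega T (dt_vec Omega T r_d) ^+ 2)
              + mu * normQ Omega T r_eq ^+ 2) in
  (2 - zeta^-1) * (lambda * normQ_vec Omega T (grad_x Omega T e) ^+ 2
                   + mu * normQ Omega T (dt Omega T e) ^+ 2)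
  + mu * (1 - eps^-1) * norm_SigmaT_vec Omega T (grad_x Omega T e) ^+ 2
  + lambda * norm_SigmaT Omega T e ^+ 2
  <= M.
Proof.
cbv zeta; set e := u \- v.
set r_eq := (fun z => f z - dt Omega T v z + div_x Omega T y z).
set r_d := (fun z => y z - grad_x Omega T v z).
have [oO _ _ bO _] := hOmega.
have [[[Lu gu du] zu] lu z0u] := hu.
have [[[[Lv gv dv] zv] lv z0v] gdv] := hv.
have [Ly divy dty] := hy.
have mQ := measurable_cylinder T oO.
have Le : L2 lebesgue_ST (cylinder Omega T) e by exact: L2B.
have dtu := weak_partialP du; have dtv := weak_partialP dv.
have dteB := weak_partialB oO bO Lu Lv dtu dtv.
have det : is_weak_partial Omega T (@dir_t R d) e (dt Omega T e).
  exact: weak_partialP (ex_intro _ _ dteB).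
have gB i := weak_partialB oO bO Lu Lv (weak_partialP (gu i)) (weak_partialP (gv i)).
have ge : has_grad_x Omega T e by move=> i; exact: ex_intro (gB i).
have ze := zero_on_SigmaB oO bO Lu Lv gu gv zu zv.
have e_prim := zero_trace_primitive oO bO hT Le det (zero_on_Sigma0B oO z0u z0v).
have LF := L2vec_grad_x gu.
have LF' : L2vec lebesgue_ST (cylinder Omega T) (fun z => grad_x Omega T u z - y z).
  move=> i; have := L2B mQ (LF i) (Ly i); congr (L2 _ _ _).
  by apply/funext => z; rewrite !mxE.
(* the flux grad u - y, whose divergence is laplace u - div y *)
have Fk := is_weak_divB oO bO LF Ly (div_xP lu) (div_xP divy).
have [Ldtv _] := dtv.
have [Ldy _] := div_xP divy.
have Lq : L2 lebesgue_ST (cylinder Omega T) r_eq by exact: (L2D mQ (L2B mQ hf Ldtv) Ldy).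
have Lgv i : L2 lebesgue_ST (cylinder Omega T) (weak_partial Omega T (dir_x i) v).
  by have [] := weak_partialP (gv i).
have r_dE i : (fun z => r_d z ord0 i) =
    (fun z => y z ord0 i - weak_partial Omega T (dir_x i) v z).
  by apply/funext => z; rewrite !mxE.
have Lr i : L2 lebesgue_ST (cylinder Omega T) (fun z => r_d z ord0 i).
  by rewrite r_dE; exact: (L2B mQ (Ly i) (Lgv i)).
(* the extra regularity of v makes the residual r differentiable in time *)
have dtgv i : is_weak_partial Omega T (@dir_t R d) (weak_partial Omega T (dir_x i) v)
    (weak_partial Omega T (dir_x i) (dt Omega T v)).
  exact: weak_partial_comm (weak_partialP (gv i)) dtv (weak_partialP (gdv i)).
have drt i : is_weak_partial Omega T (@dir_t R d) (fun z => r_d z ord0 i)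
    (dt Omega T (fun z => r_d z ord0 i)).
  have := weak_partialB oO bO (Ly i) (Lgv i) (weak_partialP (dty i)) (dtgv i).
  by rewrite -r_dE => rB; exact: weak_partialP (ex_intro _ _ rB).
have kE : {ae lebesgue_ST, forall z, cylinder Omega T z ->
    laplace_x Omega T u z - div_x Omega T y z = dt Omega T e z - r_eq z}.
  apply: filterS2 heq (weak_partial_unique oO bO dteB det) => z hz he Qz.
  by rewrite -[dt Omega T e z](he Qz) /r_eq -(hz Qz); exact: residual_identity.
have FE i : {ae lebesgue_ST, forall z, cylinder Omega T z ->
    (grad_x Omega T u z - y z) ord0 i =
    weak_partial Omega T (dir_x i) e z - r_d z ord0 i}.
  have uniq_g := weak_partial_unique oO bO (gB i) (weak_partialP (ge i)).
  apply: filterS uniq_g => z he Qz.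
  rewrite -[weak_partial _ _ _ e z](he Qz) !mxE; exact: flux_identity.
have eI := energy_error oO bO hT Le det e_prim ge ze LF' Fk Lq kE Lr FE.
have eII := energy_derivative oO bO hT Le det e_prim ge ze LF' Fk Lq kE Lr FE drt heps.
have Lge := L2vec_grad_x ge.
have Lrt : L2vec lebesgue_ST (cylinder Omega T) (dt_vec Omega T r_d).
  move=> i; rewrite dt_vecE; by have [] := drt i.
have [Ldte _] := det.
have GE : normQ_vec Omega T (grad_x Omega T e) ^+ 2 =
    \sum_i ip lebesgue_ST (cylinder Omega T) (weak_partial Omega T (dir_x i) e)
                                             (weak_partial Omega T (dir_x i) e).
  by rewrite /normQ_vec (L2norm_vecE mQ Lge); apply: eq_bigr => i _; rewrite grad_xE.
have TGE : norm_SigmaT_vec Omega T (grad_x Omega T e) ^+ 2 =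
    \sum_i trace_sqr Omega T (weak_partial Omega T (dir_x i) e).
  by rewrite (norm_SigmaT_vecE oO hT); apply: eq_bigr => i _; rewrite grad_xE.
rewrite -GE -norm_SigmaTE in eI.
rewrite -TGE -(norm_SigmaT_vecE oO hT) -L2normE in eII.
have zeta0 : 0 < zeta by apply: lt_le_trans hzeta; rewrite invr_gt0.
apply: (majorant_of_energy hlambda hmu zeta0 hbeta1 hbeta2 eI eII).
- have := sum_ip_le_norm oO Lge Lr; apply: le_trans; apply: le_trans (ler_norm _).
  by rewrite le_eqVlt; apply/orP; left; apply/eqP/eq_bigr => i _; rewrite grad_xE.
- apply: (le_trans (ip_le_norm oO Lq Le)); rewrite ler_wpM2l ?L2norm_ge0//.
  exact: hC_F.
- have := sum_ip_le_norm oO Lrt Lge; apply: le_trans; rewrite -normrN.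
  apply: le_trans (ler_norm _); rewrite lerN2 le_eqVlt; apply/orP; left.
  apply/eqP/eq_bigr => i _.
  by congr (ip _ _ _ _); [exact: (dt_vecE Omega T r_d i)|exact: (grad_xE Omega T e i)].
- by rewrite ipC; exact: (ip_le_norm oO Lq Ldte).
Qed.
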